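(* Let $A$ be an abelian group. (a) If $A$ has infinite torsion-free rank, then $IE(A)=M\oplus F(A)$ (direct sum in the additive group of $IE(A)$), where $M\simeq\mathbb Z$ is the ring of multiplications of $A$ by integers. (b) If $A$ has finite torsion-free rank, then $$IE(A)=SM(A)+UI(A)+N,$$ where $SM(A)$ is the (central) subring of semi-multiplications of $A$, $UI(A)$ is the subring of uniform inertial endomorphisms of $A$, and $N\simeq\bigoplus_{p\in\pi_c(A)}\mathbb Z(p^{c_p})$ is a subring of inertial mini-multiplications of $A$ (the ring $N$ attached to fixed sequences $(B_i),(C_i)$ as described in the context). Further: 1) $UI(A)+N$ is the ideal of all inertial endomorphisms of $A$ with periodic image; 2) $IE(A)/(UI(A)+N)\simeq\mathbb Q^{\pi_*(A)}$ as rings, provided $A$ is non-periodic; 3) $UI(A)/F(A)$ is isomorphic to a subring of $\mathcal H(A)$. (c) In particular, if $A$ is periodic, then: i) $IE(A)=M(A)+F(A)+N$; ii) $SM(A)=M(A)$ and $UI(A)=M(A)+F(A)$; iii) $UI(A)/F(A)\simeq\mathcal H(A)$ as rings.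
   Context: All groups are abelian, written additively. $E(A)$ is the endomorphism ring of $A$; ''periodic'' means torsion; $T(A)$ is the torsion subgroup. The torsion-free rank $r_0(A)$ is the rank of $A/T(A)$. $A_p$ and $A_\pi$ denote the $p$-component and $\pi$-component of (the torsion subgroup of) $A$, for $p$ a prime and $\pi$ a set of primes. $A$ is bounded if $nA=0$ for some positive integer $n$; the least such $n$ is the bound of $A$. $\operatorname{div}(A)$ is the maximum divisible subgroup. $A$ is $\pi$-divisible if $pA=A$ for all $p\in\pi$. $\mathbb Z(n)$ is the cyclic ring $\mathbb Z/n\mathbb Z$. $\mathbb Q^\pi$ is the ring of rationals whose denominator (in lowest terms) is divisible by primes in $\pi$ only. $Q_p^*$ is the ring of $p$-adic integers and $\mathcal J=\prod_pQ_p^*$, acting componentwise on every periodic abelian group. $\varphi\in E(A)$ is inertial if $H$ has finite index in $H+\varphi(H)$ for every subgroup $H\le A$; $IE(A)$ is the ring of inertial endomorphisms of $A$. $\varphi$ is finitary if $\varphi(A)$ is finite; $F(A)$ is the ideal of finitary endomorphisms. For $A$ periodic, $M(A)$ is the ring of multiplications of $A$, i.e. the endomorphisms of $A$ given by the action of elements of $\mathcal J$. Decomposition $\oplus_\pi$: for a finite set $\pi$ of primes, $A=B\oplus_\pi C$ means $A=B\oplus C$ with $B$ a bounded $\pi$-group and the $\pi$-component $C_\pi$ of $C$ divisible of finite rank. A mini-multiplication of $A$ is an endomorphism of the form $n\oplus_\pi0$ for some such decomposition, i.e. acting as multiplication by $n\in\mathbb Z$ on $B$ and as $0$ on $C$.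 Semi-multiplications: let $\pi_*(A)$ be the set of primes $p$ such that $A_p$ is bounded and $A/A_p$ is $p$-divisible. If $\pi$ is a finite subset of $\pi_*(A)$, then $A=A_\pi\oplus_\pi C$ with $C$ a uniquely determined fully invariant subgroup which is a $\mathbb Q^\pi$-module. A semi-multiplication of $A$ is an endomorphism $n\oplus_\pi\alpha$ (for some such $\pi$) which is multiplication by $n\in\mathbb Z$ on $A_\pi$ and by $\alpha$ on $C$, where $\alpha\in\mathcal J$ if $C$ is periodic and $\alpha\in\mathbb Q^\pi$ otherwise. $SM(A)$ is the ring of semi-multiplications. Uniform inertial endomorphisms: an inertial endomorphism $\varphi$ of $A$ is uniform if there are $\varphi$-invariant subgroups $F\le A_0\le A$ such that $A/A_0$ is finite, $A_0/F$ is periodic and $\varphi$ acts on $A_0/F$ as multiplication by some $\alpha\in\mathcal J$, and $F$ is free abelian with $\varphi=0$ on $F$. $UI(A)$ is the set of these. Critical primes and $N$ (for $A$ of finite torsion-free rank): $\pi_c(A)$ is the set of primes $p$ such that for some free abelian subgroup $F\le A$ with $A/F$ periodic, the $p$-component of $A/F$ has the form $B\oplus D$ with $B$ infinite and bounded and $D\ne0$ divisible of finite positive rank (this is independent of $F$). For $p\in\pi_c(A)$, $p^{c_p}$ is the bound of $A_p/\operatorname{div}(A_p)$. Enumerate $\pi_c(A)=\{p_1,p_2,\dots\}$ (finite or infinite) and put $\pi_i=\{p_1,\dots,p_i\}$. There exist sequences of subgroups $(B_i)$, $(C_i)$ with $B_i$ a bounded $p_i$-group, $A=(B_1\oplus\dots\oplus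 B_i)\oplus_{\pi_i}C_i$ and $C_i=B_{i+1}\oplus C_{i+1}$ for all $i$; fix such sequences. $N$ is the ring of all mini-multiplications $n\oplus_{\pi_i}0$ (for some $i$ and some $n\in\mathbb Z$) acting as $n$ on $B_1\oplus\dots\oplus B_i$ and as $0$ on $C_i$. The ring $\mathcal H(A)$ (for $A$ of finite torsion-free rank): fix a free abelian subgroup $F\le A$ with $A/F$ periodic. For each prime $p$ let $p^{e_p}$ be the bound of $(A/F)_p$ if this is bounded, and $e_p=\infty$ otherwise; let $\epsilon_p$ be the smallest $\epsilon$ such that $p^{\epsilon}(A/F)_p$ is finite if $(A/F)_p$ is bounded, and $\epsilon_p=\infty$ otherwise. Let $(p^x)$ be the ideal of $Q_p^*$ generated by $p^x$, with $p^\infty:=0$. Then $$\mathcal H(A):=\frac{\prod_pQ_p^*/(p^{e_p})}{\bigoplus_p(p^{\epsilon_p})/(p^{e_p})}\simeq\frac{\prod_pQ_p^*}{\bigoplus_p(p^{\epsilon_p})+\prod_p(p^{e_p})},$$ which does not depend on the choice of $F$. All sums of subrings are sums in the additive group of $IE(A)$. *)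

(* Defs.v *)
From HB Require Import structures.
From mathcomp Require Import all_boot all_algebra.
From mathcomp Require Import generic_quotient ring_quotient.
From mathcomp Require Import all_classical.

Set Implicit Arguments.
Unset Strict Implicit.
Unset Printing Implicit Defensive.

Import GRing.Theory.
Local Open Scope ring_scope.
Local Open Scope classical_set_scope.
Local Open Scope quotient_scope.

Notation "{ 'quot' F }" := (@Quotient.quot _ F) (format "{ 'quot'  F }") : type_scope.

Definition primeT := {p : nat | prime p}.
Definition nat_of_primeT (p : primeT) : nat := val p.
Coercion nat_of_primeT : primeT >-> nat.

Definition prodr (I : Type) (R : I -> comPzRingType) : Type := forall i, R i.

Section ProdRing.
Variables (I : Type) (R : I -> comPzRingType).
Implicit Types x y z : prodr R.

HB.instance Definition _ := gen_eqMixin (prodr R).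
HB.instance Definition _ := gen_choiceMixin (prodr R).

Definition prodr_zero : prodr R := fun=> 0.
Definition prodr_opp x : prodr R := fun i => - x i.
Definition prodr_add x y : prodr R := fun i => x i + y i.
Definition prodr_one : prodr R := fun=> 1.
Definition prodr_mul x y : prodr R := fun i => x i * y i.

Fact prodr_addA : associative prodr_add.
Proof. by move=> x y z; apply/functional_extensionality_dep => i; exact: addrA. Qed.
Fact prodr_addC : commutative prodr_add.
Proof. by move=> x y; apply/functional_extensionality_dep => i; exact: addrC. Qed.
Fact prodr_add0 : left_id prodr_zero prodr_add.
Proof. by move=> x; apply/functional_extensionality_dep => i; exact: add0r. Qed.
Fact prodr_addN : left_inverse prodr_zero prodr_opp prodr_add.
Proof. by move=> x; apply/functional_extensionality_dep => i; exact: addNr. Qed.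

HB.instance Definition _ := GRing.isZmodule.Build (prodr R)
  prodr_addA prodr_addC prodr_add0 prodr_addN.

Fact prodr_mulA : associative prodr_mul.
Proof. by move=> x y z; apply/functional_extensionality_dep => i; exact: mulrA. Qed.
Fact prodr_mulC : commutative prodr_mul.
Proof. by move=> x y; apply/functional_extensionality_dep => i; exact: mulrC. Qed.
Fact prodr_mul1 : left_id prodr_one prodr_mul.
Proof. by move=> x; apply/functional_extensionality_dep => i; exact: mul1r. Qed.
Fact prodr_mulD : left_distributive prodr_mul prodr_add.
Proof. by move=> x y z; apply/functional_extensionality_dep => i; exact: mulrDl. Qed.

HB.instance Definition _ := GRing.Zmodule_isComPzRing.Build (prodr R)
  prodr_mulA prodr_mulC prodr_mul1 prodr_mulD.

End ProdRing.

(* The ring of p-adic integers as the inverse limit of the rings Z/p^k, k >= 1: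
   the coordinate of index k is the residue modulo p^(k+1).  All these moduli
   are at least 2, so that 'Z_(p ^ k.+1) is Z/p^(k+1). *)
Definition padic_coherent (p : primeT)
    (x : prodr (fun k : nat => 'Z_(p ^ k.+1))) : bool :=
  `[< forall k, (x k : nat) = ((x k.+1 : nat) %% p ^ k.+1)%N >].

Section Padic.
Variable p : primeT.
Local Open Scope nat_scope.

Let pow_gt1 k : 1 < p ^ k.+1.
Proof. by rewrite -(exp1n k.+1) ltn_exp2r // prime_gt1 // (valP p). Qed.

Let valM m (a b : 'Z_m) : 1 < m -> ((a * b)%R : nat) = (a * b) %% m.
Proof. by case: m a b => [|[|m]]. Qed.

Let valB m (a b : 'Z_m) : 1 < m -> ((a - b)%R + b) %% m = a.
Proof.
case: m a b => [|[|m]] // a b _.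
by have /(congr1 val) := subrK b a.
Qed.

Let val_lt m (a : 'Z_m) : 1 < m -> a < m.
Proof. by case: m a => [|[|m]]. Qed.

Let redM k (u v : 'Z_(p ^ k.+2)) (a b : 'Z_(p ^ k.+1)) :
  (a : nat) = u %% p ^ k.+1 -> (b : nat) = v %% p ^ k.+1 ->
  ((a * b)%R : nat) = (u * v)%R %% p ^ k.+1.
Proof.
move=> ha hb; rewrite !valM ?pow_gt1 // ha hb modnMml modnMmr modn_dvdm //.
by rewrite dvdn_exp2l.
Qed.

Let redB k (u v : 'Z_(p ^ k.+2)) (a b : 'Z_(p ^ k.+1)) :
  (a : nat) = u %% p ^ k.+1 -> (b : nat) = v %% p ^ k.+1 ->
  ((a - b)%R : nat) = (u - v)%R %% p ^ k.+1.
Proof.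
move=> ha hb; rewrite -(modn_small (val_lt (a - b)%R (pow_gt1 k))).
apply/eqP; rewrite -(eqn_modDr b) valB ?pow_gt1 // hb modnDmr.
rewrite -(@modn_dvdm (p ^ k.+2)) ?dvdn_exp2l // valB ?pow_gt1 //.
by rewrite ha.
Qed.

Fact padic_coherent_subring : subring_closed (@padic_coherent p).
Proof.
split.
- apply/asboolP => k /=.
  rewrite !Zp_cast // !modn_small //.
- move=> x y /asboolP hx /asboolP hy; apply/asboolP => k.
  exact: redB (hx k) (hy k).
- move=> x y /asboolP hx /asboolP hy; apply/asboolP => k.
  exact: redM (hx k) (hy k).
Qed.

HB.instance Definition _ := GRing.isSubringClosed.Build
  _ (@padic_coherent p) padic_coherent_subring.

Record padic := Padic {
  residue : prodr (fun k : nat => 'Z_(p ^ k.+1));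
  _ : padic_coherent residue
}.

HB.instance Definition _ := [isSub for residue].
HB.instance Definition _ := [Choice of padic by <:].
HB.instance Definition _ := GRing.SubChoice_isSubComPzRing.Build
  _ (@padic_coherent p) padic padic_coherent_subring.

End Padic.

Definition padics : Type := prodr (fun p : primeT => padic p).
HB.instance Definition _ := GRing.ComPzRing.on padics.

(* The subrings below need not contain the identity of the ambient ring, so
   that they are treated as subsets of it. *)
Definition sumset (V : zmodType) (S T : set V) : set V :=
  [set x + y | x in S & y in T].

Definition is_subring (R : pzRingType) (S : set R) : Prop :=
  [/\ S 0, forall x y, S x -> S y -> S (x - y)
    & forall x y, S x -> S y -> S (x * y)].

Definition is_ideal (R : pzRingType) (S I : set R) : Prop :=
  [/\ I `<=` S, I 0, forall x y, I x -> I y -> I (x - y)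
    & forall s x, S s -> I x -> I (s * x) /\ I (x * s)].

Record rng := Rng {
  rng_sort : Type;
  rng_dom : set rng_sort;
  rng_add : rng_sort -> rng_sort -> rng_sort;
  rng_mul : rng_sort -> rng_sort -> rng_sort
}.
Arguments rng_dom : clear implicits.

Definition sub_rng (R : pzRingType) (S : set R) : rng :=
  Rng S (fun x y => x + y) (fun x y => x * y).

(* S/I as the set of the cosets x + I with x in S; the product of two cosets
   (as sets) is only contained in a coset of I, hence the summand I. *)
Definition quot_rng (R : pzRingType) (S I : set R) : rng :=
  Rng [set sumset [set x] I | x in S]
      (fun X Y => sumset X Y)
      (fun X Y => sumset [set x * y | x in X & y in Y] I).

Definition rng_iso (R1 R2 : rng) : Prop :=
  exists f : rng_sort R1 -> rng_sort R2,
    [/\ set_bij (rng_dom R1) (rng_dom R2) f,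
        forall x y, rng_dom R1 x -> rng_dom R1 y ->
          f (rng_add x y) = rng_add (f x) (f y)
      & forall x y, rng_dom R1 x -> rng_dom R1 y ->
          f (rng_mul x y) = rng_mul (f x) (f y)].

Section Groups.
Variable V : zmodType.
Implicit Types (S : set V) (pi : nat_pred).

Definition pipart pi : {pred V} :=
  [pred x | `[< exists2 n, pi.-nat n & x *+ n = 0 >]].

Fact pipart_zmod_closed pi : zmod_closed (pipart pi).
Proof.
split; first by apply/asboolP; exists 1%N.
move=> x y /asboolP[n pn xn] /asboolP[m pm ym]; apply/asboolP.
exists (n * m)%N; first by rewrite pnatM pn.
by rewrite mulrnBl mulrnA xn mul0rn mulnC mulrnA ym mul0rn subr0.
Qed.
HB.instance Definition _ pi :=
  GRing.isZmodClosed.Build V (pipart pi) (pipart_zmod_closed pi).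

Definition torsion : {pred V} :=
  [pred x | `[< exists2 n, (0 < n)%N & x *+ n = 0 >]].

Fact torsion_zmod_closed : zmod_closed torsion.
Proof.
split; first by apply/asboolP; exists 1%N.
move=> x y /asboolP[n pn xn] /asboolP[m pm ym]; apply/asboolP.
exists (n * m)%N; first by rewrite muln_gt0 pn.
by rewrite mulrnBl mulrnA xn mul0rn mulnC mulrnA ym mul0rn subr0.
Qed.
HB.instance Definition _ :=
  GRing.isZmodClosed.Build V torsion torsion_zmod_closed.

Definition periodic S : Prop := S `<=` [set` torsion].

Definition killed_by S (n : nat) : Prop :=
  (0 < n)%N /\ forall x, S x -> x *+ n = 0.

Definition bounded S : Prop := exists n, killed_by S n.

Definition is_least (P : set nat) (n : nat) : Prop :=
  P n /\ forall m, P m -> (n <= m)%N.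

Definition is_bound S (n : nat) : Prop := is_least (killed_by S) n.

Definition divisible S : Prop :=
  forall n x, (0 < n)%N -> S x -> exists2 y, S y & y *+ n = x.

Definition pdivisible (p : nat) S : Prop :=
  forall x, S x -> exists2 y, S y & y *+ p = x.

(* Independence in the sense of Fuchs (torsion elements allowed), used for the
   rank of torsion-free groups and of divisible p-groups alike. *)
Definition independent (s : seq V) : Prop :=
  0 \notin s /\
  forall m : nat -> int, \sum_(i < size s) s`_i *~ m i = 0 ->
    forall i, (i < size s)%N -> s`_i *~ m i = 0.

Definition finite_rank S : Prop :=
  exists r : nat, forall s : seq V,
    (forall x, x \in s -> S x) -> independent s -> (size s <= r)%N.

Definition free_abelian S : Prop :=
  exists X : set V,
    [/\ X `<=` S,
        forall a, S a -> exists (s : seq V) (m : V -> int),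
          (forall x, x \in s -> X x) /\ a = \sum_(x <- s) x *~ m x
      & forall (s : seq V) (m : V -> int), uniq s -> (forall x, x \in s -> X x) ->
          \sum_(x <- s) x *~ m x = 0 -> forall x, x \in s -> m x = 0].

Definition direct_sum S (B C : set V) : Prop :=
  S = sumset B C /\ B `&` C = [set 0].

Definition oplus pi (B C : set V) : Prop :=
  [/\ finite_set [set` pi] /\ {subset pi <= prime},
      direct_sum [set: V] B C,
      bounded B, B `<=` [set` pipart pi]
    & let Cpi := C `&` [set` pipart pi] in divisible Cpi /\ finite_rank Cpi].

Definition is_maxdiv S (D : zmodClosed V) : Prop :=
  [/\ [set` D] `<=` S, divisible [set` D]
    & forall D' : zmodClosed V, [set` D'] `<=` S -> divisible [set` D'] ->
        [set` D'] `<=` [set` D]].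

End Groups.
Arguments pipart : clear implicits.
Arguments torsion : clear implicits.

Definition mod_sub (V : zmodType) (F : zmodClosed V) (S : set V) : set {quot F} :=
  [set \pi_({quot F}) x | x in S].
Arguments mod_sub {V} F S.

Definition finite_tf_rank (A : zmodType) : Prop :=
  finite_rank [set: {quot torsion A}].

Definition pi_star (A : zmodType) : nat_pred :=
  [pred p | prime p &&
    `[< bounded [set` pipart A p] /\
        pdivisible p [set: {quot pipart A p}] >]].

(* y = a x for a p-adic integer a; x is killed by some p^(k+1), and a acts as
   its residue modulo p^(k+1). *)
Definition padic_acts (p : primeT) (a : padic p) (V : zmodType) (x y : V) : Prop :=
  exists2 k, x *+ p ^ k.+1 = 0 & y = x *+ (residue a k : nat).

(* g x = alpha (f x) for all x in S, when f @` S is a periodic group and f, g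
   are additive: it is enough to look at the p-components of f @` S. *)
Definition padics_scale (alpha : padics) (U V : zmodType) (S : set U)
    (f g : U -> V) : Prop :=
  forall (p : primeT) x, S x -> f x \in pipart V p ->
    padic_acts (alpha p) (f x) (g x).

Definition rat_pi (pi : nat_pred) : set rat := [set r | pi.-nat `|denq r|%N].

Definition is_endo (A : zmodType) (f : A -> A) : bool :=
  `[< {morph f : x y / x + y} >].

Record endo (A : zmodType) := Endo { endo_fun :> A -> A; _ : is_endo endo_fun }.

Section EndoRing.
Variable A : zmodType.
Implicit Types f g h : endo A.

Fact is_endo_zmod_closed : zmod_closed (@is_endo A).
Proof.
split; first by apply/asboolP => x y; rewrite addr0.
move=> f g /asboolP hf /asboolP hg; apply/asboolP => x y.
by rewrite !fctE hf hg opprD addrACA.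
Qed.
HB.instance Definition _ :=
  GRing.isZmodClosed.Build (A -> A) (@is_endo A) is_endo_zmod_closed.

HB.instance Definition _ := [isSub for @endo_fun A].
HB.instance Definition _ := [Choice of endo A by <:].
HB.instance Definition _ := [SubChoice_isSubZmodule of endo A by <:].

Lemma endoD f : {morph f : x y / x + y}.
Proof. exact/asboolP/(valP f). Qed.

Fact endo1_subproof : is_endo (@id A).
Proof. exact/asboolP. Qed.
Definition endo1 : endo A := Endo endo1_subproof.

Fact endo_comp_subproof f g : is_endo (f \o g).
Proof. by apply/asboolP => x y /=; rewrite !endoD. Qed.
Definition endo_comp f g : endo A := Endo (endo_comp_subproof f g).

Fact endo_compA : associative endo_comp.
Proof. by move=> f g h; apply/val_inj. Qed.
Fact endo_comp1l : left_id endo1 endo_comp.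
Proof. by move=> f; apply/val_inj. Qed.
Fact endo_comp1r : right_id endo1 endo_comp.
Proof. by move=> f; apply/val_inj. Qed.
Fact endo_compDl : left_distributive endo_comp +%R.
Proof. by move=> f g h; apply/val_inj. Qed.
Fact endo_compDr : right_distributive endo_comp +%R.
Proof. by move=> f g h; apply/val_inj/funext => x; exact: endoD. Qed.

HB.instance Definition _ := GRing.Zmodule_isPzRing.Build (endo A)
  endo_compA endo_comp1l endo_comp1r endo_compDl endo_compDr.

End EndoRing.

Section Inertial.
Variable A : zmodType.
Implicit Types (phi : endo A) (S : set A) (p : nat -> nat).

Definition inertial phi : Prop :=
  forall H : zmodClosed A,
    finite_set (mod_sub H (sumset [set` H] (phi @` [set` H]))).

Definition IE : set (endo A) := inertial.

Definition FE : set (endo A) := [set phi | finite_set (range phi)].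

Definition int_scale (n : int) S phi : Prop := forall x, S x -> phi x = x *~ n.

Definition int_mults : set (endo A) :=
  [set phi | exists n, int_scale n [set: A] phi].

(* Meaningful for periodic A only. *)
Definition padics_mults : set (endo A) :=
  [set phi | exists alpha, padics_scale alpha [set: A] id phi].

Definition endo_stable phi (H : zmodClosed A) : Prop :=
  forall x, x \in H -> phi x \in H.

Definition mini_mult phi : Prop :=
  exists (pi : nat_pred) (B C : zmodClosed A) (n : int),
    [/\ oplus pi [set` B] [set` C], int_scale n [set` B] phi
      & int_scale 0 [set` C] phi].

(* r acts on the Q^pi-module C, which is uniquely divisible by the denominator
   of r: phi x is the element y of C such that (denq r) y = (numq r) x. *)
Definition rat_scale (r : rat) S phi : Prop :=
  forall x, S x -> S (phi x) /\ phi x *~ denq r = x *~ numq r.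

Definition semi_mult phi : Prop :=
  exists (pi : nat_pred) (C : zmodClosed A) (n : int),
    [/\ {subset pi <= pi_star A},
        oplus pi [set` pipart A pi] [set` C],
        int_scale n [set` pipart A pi] phi
      & (periodic [set` C] /\
          exists alpha, padics_scale alpha [set` C] id phi) \/
        (~ periodic [set` C] /\
          exists2 r, rat_pi pi r & rat_scale r [set` C] phi)].

Definition SM : set (endo A) := semi_mult.

Definition uniform phi : Prop :=
  inertial phi /\
  exists (F A0 : zmodClosed A) (alpha : padics),
    [/\ {subset F <= A0}, endo_stable phi F /\ endo_stable phi A0,
        finite_set [set: {quot A0}],
        periodic (mod_sub F [set` A0]) /\
        padics_scale alpha [set` A0] \pi_({quot F}) (\pi_({quot F}) \o phi)
      & free_abelian [set` F] /\ int_scale 0 [set` F] phi].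

Definition UI : set (endo A) := uniform.

Definition free_periodic_quot (F : zmodClosed A) : Prop :=
  free_abelian [set` F] /\ periodic [set: {quot F}].

Definition pi_c : nat_pred :=
  [pred p | prime p &&
    `[< exists (F : zmodClosed A) (B D : zmodClosed {quot F}),
          [/\ free_periodic_quot F,
              direct_sum [set` pipart {quot F} p] [set` B] [set` D],
              infinite_set [set` B] /\ bounded [set` B]
            & [/\ [set` D] <> [set 0], divisible [set` D]
                & finite_rank [set` D]]] >]].

(* Meaningful for p in pi_c: p^(c_exp p) is the bound of A_p/div(A_p). *)
Definition c_exp (p : nat) : nat :=
  xget 0%N [set c | exists2 D : zmodClosed A,
    is_maxdiv [set` pipart A p] D
    & is_bound (mod_sub D [set` pipart A p]) (p ^ c)%N].

(* The direct sum of the rings Z/p^(c_p), p in pi_c.  All these c_p are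
   positive; the coordinates outside pi_c are 0 and play no role. *)
Definition sum_cyclic : set (prodr (fun p : primeT => 'Z_(p ^ c_exp p))) :=
  [set f | finite_set [set q | f q != 0] /\
           forall q : primeT, (q : nat) \notin pi_c -> f q = 0].

(* n <= len, where None stands for infinity. *)
Definition le_len (n : nat) (len : option nat) : bool :=
  if len is Some l then (n <= l)%N else true.

(* The sum of the first i groups of the sequence. *)
Definition sum_first (B : nat -> zmodClosed A) (i : nat) : set A :=
  [set x | exists2 b : nat -> A, (forall j, (j < i)%N -> b j \in B j)
             & x = \sum_(j < i) b j].

(* The length len is the number of critical primes, which are enumerated as
   p 0, p 1, ..., without repetition.  B i is a p i-group, and C i is the
   complement of the sum B 0 + ... + B (i-1) of the first i groups, so that
   C 0 = A. *)
Record critical_sequence (len : option nat) p (B C : nat -> zmodClosed A) : Prop := {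
  crit_inj : forall i j, le_len i.+1 len -> le_len j.+1 len ->
    p i = p j -> i = j;
  crit_enum : forall q, q \in pi_c <-> exists2 i, le_len i.+1 len & q = p i;
  crit_bounded : forall i, le_len i.+1 len ->
    bounded [set` B i] /\ [set` B i] `<=` [set` pipart A (p i)];
  crit_direct : forall (b : nat -> A) i, le_len i len ->
    (forall j, (j < i)%N -> b j \in B j) -> \sum_(j < i) b j = 0 ->
    forall j, (j < i)%N -> b j = 0;
  crit_oplus : forall i, le_len i len ->
    oplus [pred q | q \in [seq p j | j <- iota 0 i]] (sum_first B i) [set` C i];
  crit_split : forall i, le_len i.+1 len ->
    direct_sum [set` C i] [set` B i] [set` C i.+1]
}.

(* The index i = 0 only contributes the endomorphism 0; it makes N = 0 when
   there are no critical primes. *)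
Definition Nring (len : option nat) (B C : nat -> zmodClosed A) : set (endo A) :=
  [set phi | exists i n, [/\ le_len i len, int_scale n (sum_first B i) phi
                           & int_scale 0 [set` C i] phi]].

Section HRing.
Variable F : zmodClosed A.

Let comp (q : nat) : set {quot F} := [set` pipart {quot F} q].

Definition e_exp (q : nat) : option nat :=
  if `[< bounded (comp q) >]
  then Some (xget 0%N [set e | is_bound (comp q) (q ^ e)%N]) else None.

Definition eps_exp (q : nat) : option nat :=
  if `[< bounded (comp q) >]
  then Some (xget 0%N [set e |
         is_least [set d | finite_set [set x *+ (q ^ d) | x in comp q]] e])
  else None.

End HRing.

(* The ideal (p^x), where None stands for infinity and p^infinity = 0. *)
Definition padic_ideal (p : primeT) (x : option nat) : set (padic p) :=
  if x is Some e then [set p%:R ^+ e * b | b in [set: padic p]] else [set 0].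

(* The ring H(A) is the quotient of the product of the p-adic integers by this
   ideal. *)
Definition H_ideal (F : zmodClosed A) : set padics :=
  sumset
    [set beta : padics | finite_set [set q | beta q != 0] /\
                forall q : primeT, padic_ideal (eps_exp F q) (beta q)]
    [set gamma : padics | forall q : primeT, padic_ideal (e_exp F q) (gamma q)].

End Inertial.

Arguments IE : clear implicits.
Arguments FE : clear implicits.
Arguments int_mults : clear implicits.
Arguments padics_mults : clear implicits.
Arguments SM : clear implicits.
Arguments UI : clear implicits.
Arguments pi_c : clear implicits.
Arguments c_exp : clear implicits.
Arguments sum_cyclic : clear implicits.

(* Main.v *)
From HB Require Import structures.
Require Import Defs.
From mathcomp Require Import all_boot all_algebra.
From mathcomp Require Import all_classical.
From mathcomp Require Import generic_quotient ring_quotient zify ring.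

(** An endomorphism phi is inertial if phi(H) meets only finitely many cosets of H, for every
    subgroup H. This is exploited in two ways. Zorn's lemma and residual finiteness provide
    subgroups of finite index on which phi preserves all cyclic subgroups, hence is a scalar;
    and recursively chosen sequences, whose terms and images are as independent as possible,
    contradict inertiality, since two of the images would be congruent modulo the subgroup
    generated by the sequence ([inertial_seq]).

    Infinite torsion-free rank. Modulo torsion phi is a rational number m/n, because any two
    elements have the same factor of proportionality. An infinite independent sequence forces n
    to divide m ([inertial_integer]), and an inertial endomorphism with periodic image is then
    finitary ([periodic_image_finite]), since its kernel contains elements independent of any
    given finite family.

    Finite torsion-free rank, periodic image. Choose a lattice F, free of finite rank with A/F
    periodic, in the kernel of phi, and consider phi on the p-components of A/F. By
    [pprim_structure] phi is a p-adic integer there up to a finite image, except when the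
    component is the sum of a divisible group of finite rank and of an infinite bounded group,
    in which case phi may be two different scalars on the summands; then p is critical. At
    almost all primes phi is exactly a scalar ([almost_all_scalar]). The bounded summand is the
    image of the group B_i that belongs to p, up to a finite group, so that the exceptional
    components are corrected by an element nu of N, and phi - nu acts on A/F as an element of
    the product J of the rings of p-adic integers, up to finitely many values
    ([decompose_over]). Such endomorphisms are the uniform ones: they are characterized, with
    respect to any lattice, by acting as an element of J modulo F on a subgroup of finite index
    ([uniformP]). In this form their sums and products are evident.

    Finite torsion-free rank, general case. Let phi be m/n modulo torsion, in lowest terms. If p
    divides n, some combination psi of phi and 1 is an inverse of p modulo torsion, and the
    sequence of the psi^i f, for a basis element f of a lattice, shows that A_p is bounded and
    A/A_p is p-divisible ([pi_star_of_inverse]). Hence m/n also acts as a semi-multiplication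
    sigma, and phi - sigma has periodic image. That semi-multiplications form a central ring of
    inertial endomorphisms follows from a description of them without decompositions
    ([semi_multP]) and from the finiteness of H/pH modulo the torsion of H.

    The isomorphisms. IE/(UI + N) is the ring of the numbers m/n; N is the ring of the residues
    by which its elements act on the groups B_i; and a uniform endomorphism that acts as alpha
    is finitary if and only if alpha has finite image on A/F, which means that alpha is in the
    ideal defining H(A) ([H_idealP]). For periodic A every alpha occurs. *)

Import GRing.Theory.
Local Open Scope ring_scope.
Local Open Scope classical_set_scope.
Set Implicit Arguments.
Unset Strict Implicit.
Unset Printing Implicit Defensive.

(** * Linear identities in abelian groups *)

Section Abel.
Variable V : zmodType.

Inductive aexpr := AVar of nat | AZero | AAdd of aexpr & aexpr | AOpp of aexpr.

Fixpoint aeval (env : seq V) e : V :=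
  match e with
  | AVar i => env`_i
  | AZero => 0
  | AAdd e1 e2 => aeval env e1 + aeval env e2
  | AOpp e1 => - aeval env e1
  end.

Fixpoint acoef e (i : nat) : int :=
  match e with
  | AVar j => (i == j)%:R
  | AZero => 0
  | AAdd e1 e2 => acoef e1 i + acoef e2 i
  | AOpp e1 => - acoef e1 i
  end.

Lemma aevalE env e : aeval env e = \sum_(i < size env) env`_i *~ acoef e i.
Proof.
elim: e => [j||e1 IH1 e2 IH2|e1 IH] /=.
- have [jn|nj] := ltnP j (size env); last first.
    rewrite nth_default // big1 // => i _.
    by rewrite ltn_eqF ?mulr0z // (leq_trans (ltn_ord i)).
  rewrite (bigD1 (Ordinal jn)) //= eqxx big1 ?addr0 // => i.
  by rewrite -val_eqE /= => /negPf ->; rewrite mulr0z.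
- by rewrite big1 // => i _; rewrite mulr0z.
- by rewrite IH1 IH2 -big_split; apply: eq_bigr => i _; rewrite mulrzDr.
- by rewrite IH -sumrN; apply: eq_bigr => i _; rewrite mulrNz.
Qed.

Lemma abelP env e1 e2 :
  all (fun i => acoef e1 i == acoef e2 i) (iota 0 (size env)) -> aeval env e1 = aeval env e2.
Proof.
move=> /allP h; rewrite !aevalE; apply: eq_bigr => i _; congr (_ *~ _); apply/eqP/h.
by rewrite mem_iota /=.
Qed.
End Abel.

(* equal atoms may carry different but convertible instances of the algebraic structures *)
Ltac abel_same x y :=
  match constr:((x, y)) with
  | (?z, ?z) => idtac
  | (?f ?a, ?g ?b) => abel_same a b; unify f g
  end.

Ltac abel_index x l :=
  match l with
  | ?y :: _ => let same := match goal with _ => abel_same x y end in constr:(O)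
  | _ :: ?l' => let n := abel_index x l' in constr:(S n)
  end.

Ltac abel_add x l :=
  match l with
  | _ => let n := abel_index x l in l
  | _ => constr:(x :: l)
  end.

Ltac abel_atoms t l :=
  lazymatch t with
  | 0%R => l
  | (?a + ?b)%R => let l1 := abel_atoms a l in abel_atoms b l1
  | (- ?a)%R => abel_atoms a l
  | _ => abel_add t l
  end.

Ltac abel_reify t l :=
  lazymatch t with
  | 0%R => constr:(AZero)
  | (?a + ?b)%R => let a' := abel_reify a l in let b' := abel_reify b l in constr:(AAdd a' b')
  | (- ?a)%R => let a' := abel_reify a l in constr:(AOpp a')
  | _ => let n := abel_index t l in constr:(AVar n)
  end.

(** Reflection: the two sides are compared through the integer coefficients of their atoms. *)
Ltac abel := simpl;
  lazymatch goal with
  | |- @eq ?T ?a ?b =>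
      let l := abel_atoms a (@nil T) in let l := abel_atoms b l in
      let a' := abel_reify a l in let b' := abel_reify b l in
      exact: (@abelP _ l a' b' isT)
  end.

(** * Subgroups and finite index *)

Fact endo_is_zmod_morphism (A : zmodType) (f : endo A) : zmod_morphism f.
Proof. by move=> x y; apply/eqP; rewrite eq_sym subr_eq -endoD subrK. Qed.

HB.instance Definition _ (A : zmodType) (f : endo A) :=
  GRing.isZmodMorphism.Build A A f (@endo_is_zmod_morphism A f).

Section EndoMorphism.
Variables (A : zmodType) (f : endo A).

Lemma endo0 : f 0 = 0. Proof. exact: (raddf0 f). Qed.
Lemma endoB x y : f (x - y) = f x - f y. Proof. exact: (raddfB f). Qed.
Lemma endoMn x n : f (x *+ n) = f x *+ n. Proof. exact: (raddfMn f). Qed.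
Lemma endoMz x n : f (x *~ n) = f x *~ n. Proof. exact: (raddfMz f). Qed.

End EndoMorphism.

Section Subgroups.
Variable V : zmodType.
Implicit Types (H K R S : set V) (x y : V) (s : seq V).

Definition subgroup H : Prop := H 0 /\ forall x y, H x -> H y -> H (x - y).

Lemma subg0 H : subgroup H -> H 0. Proof. by case. Qed.

Lemma subgB H x y : subgroup H -> H x -> H y -> H (x - y).
Proof. by case=> _; apply. Qed.

Lemma subgN H x : subgroup H -> H x -> H (- x).
Proof. by move=> sH Hx; rewrite -sub0r; apply: subgB => //; exact: subg0. Qed.

Lemma subgD H x y : subgroup H -> H x -> H y -> H (x + y).
Proof.
by move=> sH Hx Hy; rewrite -[y]opprK; apply: subgB => //; exact: subgN.
Qed.

Lemma subgMn H x n : subgroup H -> H x -> H (x *+ n).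
Proof.
move=> sH Hx; elim: n => [|n IH]; first by rewrite mulr0n; exact: subg0.
by rewrite mulrS; exact: subgD.
Qed.

Lemma subgMz H x c : subgroup H -> H x -> H (x *~ c).
Proof.
case: c => n sH Hx; first exact: subgMn.
by rewrite NegzE mulrNz; apply: subgN => //; exact: subgMn.
Qed.

Lemma subg_sub H x y : subgroup H -> H (x - y) -> H y -> H x.
Proof. by move=> sH Hxy Hy; rewrite -(subrK y x); exact: subgD. Qed.

Lemma subg_subC H x y : subgroup H -> H (x - y) -> H (y - x).
Proof. by move=> sH Hxy; rewrite -opprB; exact: subgN. Qed.

Lemma subg_trans H x y z : subgroup H -> H (x - y) -> H (y - z) -> H (x - z).
Proof. by move=> sH Hxy Hyz; rewrite -(subrKA y); exact: subgD. Qed.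

Lemma subg_abs H x (c : int) : subgroup H -> H (x *~ c) <-> H (x *+ `|c|%N).
Proof.
case: c => n sH //=; have -> : x *~ Negz n = - (x *+ n.+1) by rewrite NegzE mulrNz.
by split=> [h|]; [rewrite -[_ *+ _]opprK|]; exact: subgN.
Qed.

Lemma subg_gcd H x m n : subgroup H ->
  H (x *+ m) -> H (x *+ n) -> H (x *+ gcdn m n).
Proof.
move=> sH; case: (posnP m) => [->|m0] Hm Hn; first by rewrite gcd0n.
case: (egcdnP n m0) => u v e _.
have -> : x *+ gcdn m n = (x *+ m) *+ u - (x *+ n) *+ v.
  by rewrite -!mulrnA mulnC [(n * v)%N]mulnC e mulrnDr addrAC subrr add0r.
by apply: subgB => //; apply: subgMn.
Qed.

Lemma subg_zmod (H : zmodClosed V) : subgroup [set` H].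
Proof. by split=> [|x y] /=; [exact: rpred0 | exact: rpredB]. Qed.

Lemma subg_set0 : subgroup [set 0 : V].
Proof. by split=> // x y /= -> ->; rewrite subr0. Qed.

Lemma subgT : subgroup [set: V]. Proof. by []. Qed.

Lemma subgI H K : subgroup H -> subgroup K -> subgroup (H `&` K).
Proof.
move=> sH sK; split; first by split; exact: subg0.
by move=> x y [Hx Kx] [Hy Ky]; split; exact: subgB.
Qed.

Lemma subg_sumset H K : subgroup H -> subgroup K -> subgroup (sumset H K).
Proof.
move=> sH sK; split.
  by exists 0; [exact: subg0 | exists 0; [exact: subg0 | rewrite addr0]].
move=> _ _ [a Ha [b Kb <-]] [c Hc [d Kd <-]].
exists (a - c); first exact: subgB.
by exists (b - d); [exact: subgB | rewrite opprD addrACA].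
Qed.

Lemma sumset_subl H K : K 0 -> H `<=` sumset H K.
Proof. by move=> K0 x Hx; exists x => //; exists 0; rewrite ?addr0. Qed.

Lemma sumset_subr H K : H 0 -> K `<=` sumset H K.
Proof. by move=> H0 x Kx; exists 0 => //; exists x; rewrite ?add0r. Qed.

Lemma sumset_min H K (L : set V) : subgroup L -> H `<=` L -> K `<=` L -> sumset H K `<=` L.
Proof. by move=> sL HL KL _ [x Hx [y Ky <-]]; apply: subgD; auto. Qed.

Definition cyc x : set V := [set x *~ c | c in [set: int]].

Lemma subg_cyc x : subgroup (cyc x).
Proof.
split; first by exists 0.
by move=> _ _ [c _ <-] [d _ <-]; exists (c - d) => //; rewrite mulrzBr.
Qed.

Lemma cyc_id x : cyc x x. Proof. by exists 1. Qed.

Lemma cyc_min H x : subgroup H -> H x -> cyc x `<=` H.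
Proof. by move=> sH Hx _ [c _ <-]; exact: subgMz. Qed.

(** H + <s>; the elements of s are added from left to right, so that both ends
    of the sequence can be split off. *)
Definition gens H s : set V := foldl (fun K x => sumset K (cyc x)) H s.

Lemma gens_rcons H x s : gens H (rcons s x) = sumset (gens H s) (cyc x).
Proof. by rewrite /gens foldl_rcons. Qed.

Lemma subg_gens H s : subgroup H -> subgroup (gens H s).
Proof.
by elim: s H => //= x s IH H sH; apply: IH; apply: subg_sumset => //; exact: subg_cyc.
Qed.

Lemma gens_sub H s : H `<=` gens H s.
Proof.
elim: s H => [|x s IH] H //= y Hy; apply: IH.
by apply: sumset_subl Hy; exact: subg0 (subg_cyc x).
Qed.

Lemma gens_mem H s x : subgroup H -> x \in s -> gens H s x.
Proof.
elim: s H => //= y s IH H sH; rewrite in_cons => /predU1P[->|xs].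
  by apply: gens_sub; apply: sumset_subr; [exact: subg0 | exact: cyc_id].
by apply: IH => //; apply: subg_sumset => //; exact: subg_cyc.
Qed.

Lemma gens_min H s (L : set V) : subgroup L -> H `<=` L -> (forall x, x \in s -> L x) ->
  gens H s `<=` L.
Proof.
move=> sL; elim: s H => //= x s IH H HL sub; apply: IH.
  by apply: sumset_min => //; apply: cyc_min => //; apply: sub; rewrite mem_head.
by move=> y ys; apply: sub; rewrite in_cons ys orbT.
Qed.

Lemma gens_subseq H H' s s' : subgroup H' -> H `<=` H' ->
  {subset s <= s'} -> gens H s `<=` gens H' s'.
Proof.
move=> sH' HH' sub; apply: gens_min; first exact: subg_gens.
- exact: subset_trans HH' (@gens_sub _ _).
- by move=> x /sub; exact: gens_mem.
Qed.

(** For subgroups K of S this means that K has finite index in S. All finiteness statements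
    below take this form, which needs no quotient type and makes sense for any set S. *)
Definition fin_mod K S : Prop :=
  exists2 X : set V, finite_set X & forall x, S x -> exists2 r, X r & K (x - r).

Lemma fin_mod_subl K K' S : K `<=` K' -> fin_mod K S -> fin_mod K' S.
Proof.
by move=> KK' [X fX h]; exists X => // x /h[r Xr Kxr]; exists r => //; exact: KK'.
Qed.

Lemma fin_mod_subr K S S' : S' `<=` S -> fin_mod K S -> fin_mod K S'.
Proof. by move=> SS' [X fX h]; exists X => // x /SS'/h. Qed.

Lemma fin_mod_self K S : subgroup K -> S `<=` K -> fin_mod K S.
Proof.
move=> sK SK; exists [set 0]; first exact: finite_set1.
by move=> x Sx; exists 0; rewrite ?subr0 //; exact: SK.
Qed.

Lemma fin_mod_finite K S : subgroup K -> finite_set S -> fin_mod K S.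
Proof.
by move=> sK fS; exists S => // x Sx; exists x; rewrite ?subrr //; exact: subg0.
Qed.

Lemma fin_mod0 S : fin_mod [set 0] S <-> finite_set S.
Proof.
split=> [[X fX h]|]; last exact/fin_mod_finite/subg_set0.
by apply: sub_finite_set fX => x /h[r Xr /= /eqP]; rewrite subr_eq0 => /eqP ->.
Qed.

Lemma fin_mod_trans K (L S : set V) : fin_mod K L -> fin_mod L S -> fin_mod K S.
Proof.
move=> [X fX hX] [Y fY hY]; exists (sumset X Y).
  by apply: finite_image2.
move=> x /hY[y Yy /hX[z Xz h]]; exists (z + y).
  by exists z => //; exists y.
by rewrite [z + y]addrC opprD addrA.
Qed.

Lemma fin_mod_sumset K S S' : subgroup K -> fin_mod K S -> fin_mod K S' ->
  fin_mod K (sumset S S').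
Proof.
move=> sK [X fX hX] [Y fY hY]; exists (sumset X Y); first exact: finite_image2.
move=> _ [x /hX[r Xr hr] [y /hY[t Yt ht] <-]]; exists (r + t).
  by exists r => //; exists t.
by rewrite opprD addrACA; exact: subgD.
Qed.

End Subgroups.

(** Subtracting from each element of S a representative of its class modulo L leaves only
    differences of elements of the same class. *)
Lemma fin_mod_refine (V W : zmodType) (L : set W) (f : V -> W) (K S : set V) :
  subgroup L ->
  (exists2 X : set W, finite_set X & forall x, S x -> exists2 r, X r & L (f x - r)) ->
  fin_mod K [set z | exists x y, [/\ S x, S y, L (f x - f y) & z = x - y]] ->
  fin_mod K S.
Proof.
move=> sL [X fX hX] [Y fY hY].
pose g r := xget 0 [set y | S y /\ L (f y - r)].
exists (sumset Y (g @` X)); first by apply: finite_image2 => //; exact: finite_image.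
move=> x Sx; have [r Xr Lxr] := hX _ Sx.
have [Sg Lg] : S (g r) /\ L (f (g r) - r).
  by apply: (@xgetPex V 0 [set y | S y /\ L (f y - r)]); exists x.
have [|t Yt Kt] := hY (x - g r).
  exists x, (g r); split=> //.
  by apply: subg_trans Lxr _ => //; exact: subg_subC.
exists (t + g r); first by exists t => //; exists (g r) => //; exists r.
by rewrite [t + _]addrC opprD addrA.
Qed.

Section FiniteIndex.
Variable V : zmodType.
Implicit Types (K S : set V).

Lemma fin_mod_sub_refine (L K S : set V) : subgroup L -> fin_mod L S ->
  fin_mod K [set z | exists x y, [/\ S x, S y, L (x - y) & z = x - y]] ->
  fin_mod K S.
Proof. by move=> sL h1 h2; exact: (@fin_mod_refine V V L id). Qed.

Lemma fin_modI K K' S : subgroup K -> subgroup K' -> subgroup S ->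
  fin_mod K S -> fin_mod K' S -> fin_mod (S `&` (K `&` K')) S.
Proof.
move=> sK sK' sS h h'; have sI := subgI sS (subgI sK sK').
apply: (fin_mod_sub_refine sK h).
set Z := (Z in fin_mod _ Z); have hZ : Z `<=` S `&` K.
  by move=> _ [x [y [Sx Sy Kxy ->]]]; split=> //; exact: subgB.
have: fin_mod K' Z by apply: fin_mod_subr h' => x /hZ[].
move=> hK'; apply: (fin_mod_sub_refine sK' hK').
apply: fin_mod_self => // _ [x [y [/hZ[Sx Kx] /hZ[Sy Ky] Kxy ->]]].
by split; [|split=> //]; apply: subgB.
Qed.

End FiniteIndex.

Lemma fin_mod_image (V W : zmodType) (f : {additive V -> W}) K S :
  fin_mod K S -> fin_mod (f @` K) (f @` S).
Proof.
move=> [X fX h]; exists (f @` X); first exact: finite_image.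
move=> _ [x Sx <-]; have [r Xr Kr] := h x Sx.
by exists (f r); [exists r | exists (x - r) => //; rewrite raddfB].
Qed.

Lemma subg_image (V W : zmodType) (f : {additive V -> W}) S :
  subgroup S -> subgroup (f @` S).
Proof.
move=> sS; split; first by exists 0; rewrite ?raddf0 //; exact: subg0.
by move=> _ _ [x Sx <-] [y Sy <-]; exists (x - y); rewrite ?raddfB //; exact: subgB.
Qed.

Lemma subg_preim (V W : zmodType) (f : {additive V -> W}) K :
  subgroup K -> subgroup (f @^-1` K).
Proof.
move=> sK; split; first by rewrite /preimage /= raddf0; exact: subg0.
by move=> x y; rewrite /preimage /= raddfB; exact: subgB.
Qed.

Lemma fin_mod_preim (V W : zmodType) (f : {additive V -> W}) K S :
  subgroup K -> subgroup S -> fin_mod K (f @` S) -> fin_mod (S `&` f @^-1` K) S.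
Proof.
move=> sK sS [X fX h].
have sP : subgroup (S `&` f @^-1` K) by apply: subgI => //; exact: subg_preim.
apply: (@fin_mod_refine _ _ K f) => //.
  by exists X => // x Sx; apply: h; exists x.
apply: fin_mod_self => // _ [x [y [Sx Sy Kxy ->]]].
by split; [exact: subgB | rewrite /preimage /= raddfB].
Qed.

(** The usual way to bound f(S): find a subgroup K of finite index in S that f maps into R. *)
Lemma fin_mod_imageW (V W : zmodType) (f : {additive V -> W}) K S R :
  fin_mod K S -> (forall x, K x -> R (f x)) -> fin_mod R (f @` S).
Proof.
move=> h KR; apply: fin_mod_subl (fin_mod_image f h).
by move=> _ [x Kx <-]; exact: KR.
Qed.

Lemma fin_mod_bigcap (V : zmodType) (S R : set V) (s : seq V) (P : V -> set V -> Prop) :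
  subgroup S ->
  (forall x, x \in s -> exists K, [/\ subgroup K, R `<=` K, fin_mod K S & P x K]) ->
  (forall x K K', K' `<=` K -> P x K -> P x K') -> R `<=` S ->
  exists K, [/\ subgroup K, R `<=` K, fin_mod K S & forall x, x \in s -> P x K].
Proof.
move=> sS + mono RS; elim: s => [|x s IH] h.
  by exists S; split=> //; exact: fin_mod_self.
have [y ys|K [sK RK fK hK]] := IH.
  by apply: h; rewrite in_cons ys orbT.
have [|K' [sK' RK' fK' hK']] := h x; first by rewrite mem_head.
exists (S `&` (K `&` K')); split.
- by apply: subgI => //; exact: subgI.
- by move=> y Ry; split; [|split]; auto.
- exact: fin_modI.
- move=> y; rewrite in_cons => /predU1P[->|ys].
    by apply: mono hK' => z [_ []].
  by apply: mono (hK _ ys) => z [_ []].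
Qed.

Lemma fin_mod_cyc (V : zmodType) (K : set V) x n : subgroup K -> (0 < n)%N ->
  K (x *+ n) -> fin_mod K (sumset K (cyc x)).
Proof.
move=> sK n0 Kn; apply: fin_mod_sumset => //; first exact: fin_mod_self.
exists [set` [seq x *+ i | i <- iota 0 n]]; first exact: finite_seq.
have h m : exists2 i, (i < n)%N & K (x *+ m - x *+ i).
  exists (m %% n)%N; first by rewrite ltn_mod.
  by rewrite {1}(divn_eq m n) mulrnDr addrK mulnC mulrnA; exact: subgMn.
move=> _ [c _ <-].
have [m hm] : exists m, K (x *~ c - x *+ m).
  case: c => m; first by exists m; rewrite subrr; exact: subg0.
  exists (m.+1 * n.-1)%N; rewrite NegzE mulrNz -opprD -pmulrn -mulrnDr.
  rewrite -mulnS prednK // mulnC mulrnA; apply: subgN => //; exact: subgMn.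
have [i ilt hi] := h m; exists (x *+ i); last exact: subg_trans hm hi.
by apply: map_f; rewrite mem_iota.
Qed.

(** Finitely generated torsion groups are finite; here relative to K. *)
Lemma fin_mod_gens_torsion (V : zmodType) (K : set V) s : subgroup K ->
  fin_mod K [set y | gens K s y /\ exists2 n, (0 < n)%N & K (y *+ n)].
Proof.
elim: s K => [|x s IH] K sK; first by apply: fin_mod_self => // y [].
have sK' : subgroup (sumset K (cyc x)) by apply: subg_sumset => //; exact: subg_cyc.
have KK' : K `<=` sumset K (cyc x) by apply: sumset_subl; exact: subg0 (subg_cyc x).
apply: (fin_mod_sub_refine sK').
  apply: fin_mod_subr (IH _ sK') => y [gy [n n0 Kn]]; split=> //.
  by exists n => //; exact: KK'.
set Z := (Z in fin_mod _ Z).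
have [[n n0 Kn]|nt] := pselect (exists2 n, (0 < n)%N & K (x *+ n)).
  by apply: fin_mod_subr (fin_mod_cyc sK n0 Kn) => _ [y [z [_ _ h ->]]].
apply: fin_mod_self => // _ [y [z [[_ [n n0 Kn]] [_ [m m0 Km]] [h Kh [_ [c _ <-] e]] ->]]].
rewrite -e; case: (eqVneq c 0) => [->|c0]; first by rewrite mulr0z addr0.
case: nt; exists (`|c| * (n * m))%N; first by rewrite !muln_gt0 absz_gt0 c0 n0.
rewrite mulnC mulrnA; apply/subg_abs => //.
have -> : x *+ (n * m) *~ c = (y - z) *+ (n * m) - h *+ (n * m).
  by rewrite -e mulrnDl addrAC subrr add0r !pmulrn -!mulrzA mulrC.
apply: subgB => //; last exact: subgMn.
rewrite mulrnBl; apply: subgB => //; first by rewrite mulrnA; exact: subgMn.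
by rewrite mulnC mulrnA; exact: subgMn.
Qed.

(** * Pigeonhole and recursive choice of sequences *)

Lemma pigeonhole_nat (T : eqType) (X : set T) (f : nat -> T) :
  finite_set X -> (forall n, X (f n)) -> exists i j, (i < j)%N /\ f i = f j.
Proof.
move=> /finite_seqP[s ->] h.
have : ~~ uniq (map f (iota 0 (size s).+1)).
  apply/negP => u; have := uniq_leq_size u (s2 := s).
  rewrite size_map size_iota ltnn => h'; suff: false by [].
  by apply: h' => _ /mapP[n _ ->]; exact: h.
case/(uniqPn (f 0%N)) => i [j []]; rewrite size_map size_iota => ij jn.
by rewrite !(nth_map 0%N) ?size_iota ?nth_iota ?(ltn_trans ij) // => e; exists i, j.
Qed.

Lemma seq_choice (T : Type) (Q : seq T -> T -> Prop) :
  (forall s, exists x, Q s x) -> exists f : nat -> T, forall n, Q (mkseq f n) (f n).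
Proof.
move=> h; have [g hg] := choice h.
pose s n := iter n (fun s => rcons s (g s)) [::].
exists (fun n => g (s n)) => n.
suff -> : mkseq (fun n => g (s n)) n = s n by exact: hg.
by elim: n => //= n IH; rewrite mkseqS IH.
Qed.

(** * Interface with bundled subgroups, quotients and the classical order of an element *)

Lemma zmod_of_subg (V : zmodType) (H : set V) : subgroup H ->
  exists Z : zmodClosed V, [set` Z] = H.
Proof.
move=> sH; pose P : {pred V} := [pred x | `[< H x >]].
have cP : zmod_closed P.
  split=> [|x y /asboolP Hx /asboolP Hy]; apply/asboolP; first exact: subg0.
  exact: subgB.
pose m := GRing.isZmodClosed.Build V P cP.
pose Z : zmodClosed V := HB.pack P m.
by exists Z; apply/seteqP; split=> x /=; [move=> /asboolP | move=> h; apply/asboolP].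
Qed.

Section Quot.
Variables (V : zmodType) (F : zmodClosed V).

Local Notation pi := (\pi_({quot F})%qT).

Lemma quot_eq0 x : pi x = 0 <-> x \in F.
Proof.
rewrite -(raddf0 pi); split=> [/eqP|h]; first by rewrite -Quotient.idealrBE subr0.
by apply/eqP; rewrite -Quotient.idealrBE subr0.
Qed.

Lemma quot_eq x y : pi x = pi y <-> x - y \in F.
Proof. rewrite -quot_eq0 raddfB /=; split=> [e|/subr0_eq //]; apply/eqP.
by rewrite subr_eq0; apply/eqP. Qed.

Lemma quot_surj (z : {quot F}) : exists x, z = pi x.
Proof. by exists (repr z); rewrite reprK. Qed.

Lemma fin_mod_subP (S : set V) : finite_set (mod_sub F S) <-> fin_mod [set` F] S.
Proof.
split=> [fS|[X fX h]].
  exists (repr @` mod_sub F S); first exact: finite_image.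
  move=> x Sx; exists (repr (pi x)); last by apply/quot_eq; rewrite reprK.
  by exists (pi x) => //; exists x.
apply: (sub_finite_set _ (finite_image pi fX)) => _ [x Sx <-].
by have [r Xr /quot_eq e] := h x Sx; exists r.
Qed.

Lemma fin_mod_quotT : finite_set [set: {quot F}] <-> fin_mod [set` F] [set: V].
Proof.
rewrite -fin_mod_subP; suff -> : [set: {quot F}] = mod_sub F [set: V] by [].
by apply/seteqP; split=> // z _; have [x ->] := quot_surj z; exists x.
Qed.

End Quot.

Lemma inertialP (A : zmodType) (phi : endo A) :
  inertial phi <-> forall H : set A, subgroup H -> fin_mod H (phi @` H).
Proof.
split=> h H => [sH|].
  have [Z eZ] := zmod_of_subg sH; have /fin_mod_subP := h Z; rewrite eZ.
  by apply: fin_mod_subr => y Hy; apply: sumset_subr Hy; exact: subg0.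
have sH := subg_zmod H; apply/fin_mod_subP/fin_mod_sumset => //; last exact: h.
exact: fin_mod_self.
Qed.

Section Orders.
Variable V : zmodType.
Implicit Types (x : V) (K : set V).

Lemma subg_pdiv K x p M c j : prime p -> subgroup K ->
  K (x *+ p ^ M) -> K (x *+ c) -> ~~ (p ^ j.+1 %| c)%N -> K (x *+ p ^ j).
Proof.
move=> pp sK KM Kc ndv; have := subg_gcd sK KM Kc.
have /(dvdn_pfactor _ _ pp)[i iM e] := dvdn_gcdl (p ^ M) c.
rewrite e => Ki; have ij : (i <= j)%N.
  rewrite leqNgt; apply/negP => ji; case/negP: ndv.
  by apply: dvdn_trans (dvdn_gcdr (p ^ M) c); rewrite e dvdn_exp2l.
by rewrite -(subnKC ij) expnD mulrnA; exact: subgMn.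
Qed.

Lemma pipartP p x : prime p -> x \in pipart V p <-> exists k, x *+ p ^ k = 0.
Proof.
move=> pp; split=> [/asboolP[n /p_natP[k ->] xn]|[k xk]]; first by exists k.
by apply/asboolP; exists (p ^ k)%N; rewrite // pnatX pnat_id.
Qed.

Lemma mulrn_eqmod x n a b : x *+ n = 0 -> a = b %[mod n] -> x *+ a = x *+ b.
Proof.
move=> xn e; rewrite (divn_eq a n) (divn_eq b n) e !mulrnDr.
by rewrite ![(_ * n)%N]mulnC !mulrnA xn !mul0rn.
Qed.

Lemma torsionP x : x \in torsion V <-> exists2 n, (0 < n)%N & x *+ n = 0.
Proof. by split=> [/asboolP|?]; last exact/asboolP. Qed.

Lemma pipart_torsion pi x : x \in pipart V pi -> x \in torsion V.
Proof.
move=> /asboolP[n /andP[n0 _] xn]; apply/torsionP; by exists n.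
Qed.

(** A torsion element is a sum of multiples of itself of prime power orders. *)
Lemma primary_ind (K : set V) n x : (0 < n)%N -> x *+ n = 0 -> K 0 ->
  (forall y z, K y -> K z -> K (y + z)) ->
  (forall p k j, prime p -> x *+ j *+ p ^ k = 0 -> K (x *+ j)) -> K x.
Proof.
move=> n0 xn K0 KD h; rewrite -[x]mulr1n.
have [m lemn] := ubnP n; move: (1%N) => j.
have : x *+ j *+ n = 0 by rewrite mulrnAC xn mul0rn.
elim: m => // m IH in n n0 j lemn {xn} *.
have [n1 xj|n_gt1 xjn] := leqP n 1.
  by have -> : x *+ j = 0 by rewrite -[LHS]mulr1n; move: xj; have -> : n = 1%N by lia.
have pp := pdiv_prime n_gt1; set p := pdiv n in pp.
have [cop e] : coprime (n`_p) (n`_p^') /\ n = (n`_p * n`_p^')%N.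
  by rewrite partnC // coprime_partC.
have p0 : (0 < n`_p^')%N by rewrite part_gt0.
have lt : (n`_p^' < n)%N.
  rewrite {2}e ltn_Pmull // p_part_gt1 mem_primes pp n0 /=; exact: pdiv_dvd.
pose a := chinese (n`_p) (n`_p^') 1 0; pose b := chinese (n`_p) (n`_p^') 0 1.
have a0 : (n`_p^' %| a)%N by apply/eqP; rewrite chinese_modr // mod0n.
have b0 : (n`_p %| b)%N by apply/eqP; rewrite chinese_modl // mod0n.
have -> : x *+ j = x *+ (j * a) + x *+ (j * b).
  rewrite -mulrnDr -mulnDr mulrnA -[LHS]mulr1n; apply: mulrn_eqmod xjn _.
  have: (1 == a + b %[mod n`_p * n`_p^'])%N.
    rewrite chinese_remainder //; apply/andP; split; apply/eqP.
      by rewrite -modnDmr (eqP b0) addn0 chinese_modl.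
    by rewrite -modnDml (eqP a0) add0n chinese_modr.
  by rewrite -e => /eqP.
apply: KD.
  apply: (h p (logn p n)) => //; rewrite -p_part -mulrnA.
  have [t et] := dvdnP a0; have -> : (j * a * n`_p = j * n * t)%N by nia.
  by rewrite !mulrnA xjn mul0rn.
apply: (IH _ p0); first exact: leq_trans lt lemn.
rewrite -mulrnA; have [t et] := dvdnP b0.
have -> : (j * b * n`_p^' = j * n * t)%N by nia.
by rewrite !mulrnA xjn mul0rn.
Qed.

End Orders.

(** * Chinese remainders and the action of the ring of p-adic integers on periodic groups *)

Lemma crt_primes (s : seq nat) (e r : nat -> nat) : uniq s -> all prime s ->
  exists c, forall p, p \in s -> c = r p %[mod p ^ e p].
Proof.
elim: s => [|p s IH] /=; first by exists 0%N.
move=> /andP[ps us] /andP[pp als]; have [c hc] := IH us als.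
pose M := (\prod_(q <- s) q ^ e q)%N.
have cop : coprime (p ^ e p) M.
  rewrite /M; elim: s ps als {IH us hc M} => [|q s IH]; first by rewrite big_nil coprimen1.
  rewrite in_cons negb_or big_cons coprimeMr => /andP[pq ps] /= /andP[qp /(IH ps) ->].
  by rewrite andbT coprimeXl // coprimeXr // prime_coprime // dvdn_prime2.
exists (chinese (p ^ e p) M (r p) c) => q; rewrite in_cons => /predU1P[->|qs].
  exact: chinese_modl.
rewrite -hc //; have dv : (q ^ e q %| M)%N.
  by rewrite /M (big_rem q) //= dvdn_mulr.
by rewrite -(modn_dvdm _ dv) chinese_modr // modn_dvdm.
Qed.

Lemma eqn_mod_primes n a b : (0 < n)%N ->
  (forall p k, prime p -> (p ^ k.+1 %| n)%N -> a = b %[mod p ^ k.+1]) ->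
  a = b %[mod n].
Proof.
move=> n0; wlog le : a b / (b <= a)%N => [W h|h].
  have [/W|/ltnW/W] := leqP b a; first exact.
  by move=> W'; apply/esym/W' => p k pp dv; apply/esym/h.
apply/eqP; rewrite eqn_mod_dvd //; apply/dvdn_partP => // p.
rewrite mem_primes => /and3P[pp _ pn]; rewrite p_part.
have : (0 < logn p n)%N by rewrite logn_gt0 mem_primes pp n0.
case e: (logn p n) => [//|k] _; rewrite -eqn_mod_dvd //; apply/eqP/h => //.
by rewrite -e pfactor_dvdnn.
Qed.

Section PadicResidues.
Variable p : primeT.
Implicit Types a b : padic p.

Lemma prime_primeT : prime p. Proof. exact: (valP p). Qed.

Lemma expp_gt1 k : (1 < p ^ k.+1)%N.
Proof. by rewrite -(exp1n k.+1) ltn_exp2r // prime_gt1 // prime_primeT. Qed.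

Lemma Zp_valD m (a b : 'Z_m) : (1 < m)%N -> ((a + b)%R : nat) = ((a + b) %% m)%N.
Proof. by case: m a b => [|[|m]]. Qed.

Lemma Zp_valM m (a b : 'Z_m) : (1 < m)%N -> ((a * b)%R : nat) = ((a * b) %% m)%N.
Proof. by case: m a b => [|[|m]]. Qed.

Lemma Zp_val_lt m (a : 'Z_m) : (1 < m)%N -> (a < m)%N.
Proof. by case: m a => [|[|m]]. Qed.

Lemma residueD a b k : (residue (a + b) k : nat) = residue a k + residue b k %[mod p ^ k.+1].
Proof. by rewrite [LHS]modn_small ?Zp_val_lt ?expp_gt1 // -Zp_valD ?expp_gt1. Qed.

Lemma residueM a b k : (residue (a * b) k : nat) = residue a k * residue b k %[mod p ^ k.+1].
Proof. by rewrite [LHS]modn_small ?Zp_val_lt ?expp_gt1 // -Zp_valM ?expp_gt1. Qed.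

Lemma residue1 k : (residue (1 : padic p) k : nat) = 1%N.
Proof. by have := expp_gt1 k; rewrite /= /prodr_one; case: (p ^ k.+1)%N => [|[|m]]. Qed.

Lemma residue_le a k m : (k <= m)%N -> (residue a k : nat) = residue a m %[mod p ^ k.+1].
Proof.
elim: m => [|m IH]; first by rewrite leqn0 => /eqP ->.
rewrite leq_eqVlt => /predU1P[->//|km]; rewrite IH //.
have /asboolP h := valP a; rewrite [val a m : nat]h /= modn_dvdm //.
by rewrite dvdn_exp2l.
Qed.

Lemma padic_ext a b : (forall k, (residue a k : nat) = residue b k) -> a = b.
Proof.
move=> h; apply/val_inj/functional_extensionality_dep => k; exact/val_inj/h.
Qed.

End PadicResidues.

Lemma mk_padics (c : primeT -> nat -> nat) :
  (forall p k, c p k.+1 = c p k %[mod p ^ k.+1]) ->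
  exists alpha : padics, forall p k, (residue (alpha p) k : nat) = c p k %[mod p ^ k.+1].
Proof.
move=> h.
have val (p : primeT) k : (((c p k)%:R : 'Z_(p ^ k.+1)) : nat) = (c p k %% p ^ k.+1)%N.
  by rewrite val_Zp_nat ?expp_gt1.
have coh (p : primeT) : padic_coherent (fun k => (c p k)%:R : 'Z_(p ^ k.+1)).
  by apply/asboolP => k; rewrite !val modn_dvdm ?dvdn_exp2l // h.
exists (fun p => Padic (coh p)) => p k /=.
by rewrite val modn_mod.
Qed.

Lemma jrep_ex (alpha : padics) n : exists c, (0 < n)%N -> forall (p : primeT) k,
  (p ^ k.+1 %| n)%N -> c = residue (alpha p) k %[mod p ^ k.+1].
Proof.
pose r q := if insub q is Some p then residue (alpha p) (logn q n).-1 : nat else 0%N.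
have [|c hc] := @crt_primes (primes n) (fun q => logn q n) r (primes_uniq n).
  by apply/allP => q; rewrite mem_primes => /andP[].
exists c => n0 p k dv; have pp := prime_primeT p.
have pn : (val p \in primes n).
  by rewrite mem_primes pp n0 (dvdn_trans _ dv) // -{1}[val p]expn1 dvdn_exp2l.
have kl : (k < logn p n)%N by rewrite -pfactor_dvdn.
have := hc _ pn; rewrite /r valK => e.
have e' : c = residue (alpha p) (logn (val p) n).-1 %[mod p ^ k.+1].
  have dv' : (p ^ k.+1 %| val p ^ logn (val p) n)%N by apply: dvdn_exp2l.
  by rewrite -(modn_dvdm _ dv') e modn_dvdm.
apply: (etrans e' (esym (residue_le _ _))).
by rewrite -ltnS prednK // (leq_ltn_trans _ kl).
Qed.

(** The residue of alpha modulo n, up to multiples of n, glued from the p-adic residues by the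
    Chinese remainder theorem. *)
Definition jrep alpha n : nat := projT1 (cid (jrep_ex alpha n)).

Lemma jrepE alpha n (p : primeT) k : (0 < n)%N -> (p ^ k.+1 %| n)%N ->
  jrep alpha n = residue (alpha p) k %[mod p ^ k.+1].
Proof. by rewrite /jrep; case: cid => c /= h n0 dv; exact: h. Qed.

Lemma jrep_eqmod n c alpha : (0 < n)%N ->
  (forall (p : primeT) k, (p ^ k.+1 %| n)%N -> c = residue (alpha p) k %[mod p ^ k.+1]) ->
  c = jrep alpha n %[mod n].
Proof.
move=> n0 h; apply: eqn_mod_primes => // p k pp dv.
by rewrite (@jrepE _ _ (Sub p pp)) // (h (Sub p pp)).
Qed.

Lemma jrep_dvd alpha n m : (0 < m)%N -> (n %| m)%N -> jrep alpha m = jrep alpha n %[mod n].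
Proof.
move=> m0 nm; have n0 : (0 < n)%N by exact: dvdn_gt0 nm.
by apply: jrep_eqmod => // p k dv; rewrite (@jrepE _ _ p k) // (dvdn_trans dv).
Qed.

Lemma jrepD alpha beta n : (0 < n)%N ->
  jrep alpha n + jrep beta n = jrep (alpha + beta) n %[mod n].
Proof.
move=> n0; apply: jrep_eqmod => // p k dv.
by rewrite residueD -modnDm !(@jrepE _ _ p k) // modnDm.
Qed.

Lemma jrepM alpha beta n : (0 < n)%N ->
  jrep alpha n * jrep beta n = jrep (alpha * beta) n %[mod n].
Proof.
move=> n0; apply: jrep_eqmod => // p k dv.
by rewrite residueM -modnMm !(@jrepE _ _ p k) // modnMm.
Qed.

Lemma jrep1 n : (0 < n)%N -> 1 = jrep 1 n %[mod n].
Proof. by move=> n0; apply: jrep_eqmod => // p k dv; rewrite residue1. Qed.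

Section Action.
Variable V : zmodType.
Hypothesis perV : periodic [set: V].
Implicit Types (x y : V) (alpha beta : padics).

Lemma ord_ex x : exists n, (0 < n)%N /\ x *+ n = 0.
Proof. by have /torsionP[n n0 xn] := perV (t := x) I; exists n. Qed.

Definition jfun alpha x : V := x *+ jrep alpha (projT1 (cid (ord_ex x))).

Lemma jfunE alpha x n : (0 < n)%N -> x *+ n = 0 -> jfun alpha x = x *+ jrep alpha n.
Proof.
rewrite /jfun; case: cid => m /= [m0 xm] n0 xn.
have g0 : (0 < gcdn m n)%N by rewrite gcdn_gt0 m0.
have xg : x *+ gcdn m n = 0 by exact: (subg_gcd (@subg_set0 V) xm xn).
apply: (mulrn_eqmod xg).
by rewrite (jrep_dvd _ m0 (dvdn_gcdl _ _)) (jrep_dvd _ n0 (dvdn_gcdr _ _)).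
Qed.

Fact jfun_is_endo alpha : is_endo (jfun alpha).
Proof.
apply/asboolP => x y; have [n [n0 xn]] := ord_ex x; have [m [m0 ym]] := ord_ex y.
have nm0 : (0 < n * m)%N by rewrite muln_gt0 n0.
have xnm : x *+ (n * m) = 0 by rewrite mulrnA xn mul0rn.
have ynm : y *+ (n * m) = 0 by rewrite mulnC mulrnA ym mul0rn.
by rewrite !(jfunE _ nm0) // ?mulrnDl // xnm ynm addr0.
Qed.

Definition jact alpha : endo V := Endo (jfun_is_endo alpha).

Lemma jactE alpha x n : (0 < n)%N -> x *+ n = 0 -> jact alpha x = x *+ jrep alpha n.
Proof. exact: jfunE. Qed.

Lemma jact_nat alpha x : exists c, jact alpha x = x *+ c.
Proof. by rewrite /jact /= /jfun; eexists. Qed.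

Lemma jactD alpha beta x : jact (alpha + beta) x = jact alpha x + jact beta x.
Proof.
have [n [n0 xn]] := ord_ex x; rewrite !(jactE _ n0 xn) -mulrnDr.
by apply: (mulrn_eqmod xn); rewrite jrepD.
Qed.

Lemma jactM alpha beta x : jact (alpha * beta) x = jact alpha (jact beta x).
Proof.
have [n [n0 xn]] := ord_ex x; rewrite mulrC (jactE _ n0 xn) (jactE beta n0 xn).
rewrite (jactE _ n0) -?mulrnA; first by apply: (mulrn_eqmod xn); rewrite jrepM.
by rewrite mulnC mulrnA xn mul0rn.
Qed.

Lemma jact0 x : jact 0 x = 0.
Proof. by apply: (addrI (jact 0 x)); rewrite -jactD !addr0. Qed.

Lemma jactN alpha x : jact (- alpha) x = - jact alpha x.
Proof. by apply: (addrI (jact alpha x)); rewrite -jactD !subrr jact0. Qed.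

Lemma jactB alpha beta x : jact (alpha - beta) x = jact alpha x - jact beta x.
Proof. by rewrite jactD jactN. Qed.

Lemma jact1 x : jact 1 x = x.
Proof.
have [n [n0 xn]] := ord_ex x; rewrite (jactE _ n0 xn) -[RHS]mulr1n.
by apply: (mulrn_eqmod xn); rewrite -jrep1.
Qed.

Lemma jact_natr c x : jact (c%:R) x = x *+ c.
Proof.
elim: c => [|c IH]; first by rewrite mulr0n jact0.
by rewrite mulrSr jactD IH jact1 mulrSr.
Qed.

Lemma jact_pprim alpha (p : primeT) x k : x *+ p ^ k.+1 = 0 ->
  jact alpha x = x *+ (residue (alpha p) k : nat).
Proof.
move=> xk; have p0 : (0 < p ^ k.+1)%N by rewrite ltnW // expp_gt1.
rewrite (jactE _ p0 xk); apply: (mulrn_eqmod xk).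
by rewrite (@jrepE _ _ p k).
Qed.

Lemma jact_pprim_eq alpha beta (p : primeT) x k : alpha p = beta p ->
  x *+ p ^ k = 0 -> jact alpha x = jact beta x.
Proof.
move=> e xk; have xk1 : x *+ p ^ k.+1 = 0 by rewrite expnSr mulrnA xk mul0rn.
by rewrite !(jact_pprim _ xk1) e.
Qed.

(** Every element of f(S) is a sum of primary multiples of itself, so that the condition on the
    p-components determines g. *)
Lemma padics_scaleP (U : zmodType) (S : set U) (f g : {additive U -> V}) alpha :
  subgroup S ->
  padics_scale alpha S f g <-> (forall u, S u -> g u = jact alpha (f u)).
Proof.
move=> sS; split=> [h x Sx|h p x Sx].
  have [n [n0 xn]] := ord_ex (f x).
  pose K := [set y | exists2 u, S u & y = f u /\ g u = jact alpha y].
  have [|y z [u Su [-> eu]] [v Sv [-> ev]]|p k j pp e|u Su [e eu]] :=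
      @primary_ind _ K n (f x) n0 xn.
  - by exists 0; rewrite ?raddf0; [exact: subg0 | split].
  - by exists (u + v); [exact: subgD | rewrite !raddfD eu ev].
  - exists (x *+ j); first exact: subgMn.
    rewrite !raddfMn; split=> //.
    have [||k' e1 e2] := h (Sub p pp) (x *+ j); first exact: subgMn.
      by rewrite raddfMn; apply/pipartP => //; exists k.
    rewrite -!raddfMn e2; exact/esym/jact_pprim.
  - have [||k _ e2] := h (Sub 2%N isT) (x - u); first exact: subgB.
      by rewrite raddfB e subrr rpred0.
    move: e2; rewrite !raddfB e subrr mul0rn => /subr0_eq ->.
    by rewrite eu e.
move=> /(pipartP _ (prime_primeT p))[k xk]; exists k.
  by rewrite expnSr mulrnA xk mul0rn.
rewrite h // (@jact_pprim _ p _ k) //.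
by rewrite expnSr mulrnA xk mul0rn.
Qed.

End Action.

(** * The ring of inertial endomorphisms *)

Section InertialRing.
Variable A : zmodType.
Implicit Types (phi psi : endo A) (H R S : set A).

Lemma endo_ext phi psi : (forall x, phi x = psi x) -> phi = psi.
Proof. by move=> h; apply/val_inj/funext. Qed.

Lemma endoBE phi psi x : (phi - psi) x = phi x - psi x. Proof. by []. Qed.
Lemma endoDE phi psi x : (phi + psi) x = phi x + psi x. Proof. by []. Qed.
Lemma endoME phi psi x : (phi * psi) x = phi (psi x). Proof. by []. Qed.
Lemma endo1E x : (1 : endo A) x = x. Proof. by []. Qed.
Lemma endo0E x : (0 : endo A) x = 0. Proof. by []. Qed.
Lemma endoNE phi x : (- phi) x = - phi x. Proof. by []. Qed.

Lemma endoMnE phi n x : (phi *+ n) x = phi x *+ n.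
Proof. by elim: n => // n IH; rewrite !mulrSr endoDE IH. Qed.

Lemma endoMzE phi n x : (phi *~ n) x = phi x *~ n.
Proof. by case: n => n; rewrite ?NegzE ?mulrNz ?endoNE -!pmulrn endoMnE. Qed.

Lemma fin_modB phi psi H S : subgroup H -> fin_mod H (phi @` S) -> fin_mod H (psi @` S) ->
  fin_mod H ((phi - psi) @` S).
Proof.
move=> sH [X fX hX] [Y fY hY]; exists [set x - y | x in X & y in Y].
  exact: finite_image2.
move=> _ [x Sx <-]; have [|r Xr hr] := hX (phi x); first by exists x.
have [|t Yt ht] := hY (psi x); first by exists x.
exists (r - t); first by exists r => //; exists t.
have -> : (phi - psi) x - (r - t) = (phi x - r) - (psi x - t).
  by rewrite endoBE !opprD !opprK addrACA.
exact: subgB.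
Qed.

Lemma inertialB phi psi : inertial phi -> inertial psi -> inertial (phi - psi).
Proof.
move=> /inertialP hp /inertialP hq; apply/inertialP => H sH.
by apply: fin_modB => //; auto.
Qed.

Lemma inertial_fin phi : finite_set (range phi) -> inertial phi.
Proof.
move=> fp; apply/inertialP => H sH; apply: fin_mod_finite => //.
by apply: sub_finite_set fp => _ [x _ <-]; exists x.
Qed.

Lemma inertial0 : inertial (0 : endo A).
Proof.
apply: inertial_fin; apply: sub_finite_set (finite_set1 (0 : A)).
by move=> _ [x _ <-].
Qed.

Lemma inertialN phi : inertial phi -> inertial (- phi).
Proof. by move=> hp; rewrite -sub0r; apply: inertialB => //; exact: inertial0. Qed.

Lemma inertialD phi psi : inertial phi -> inertial psi -> inertial (phi + psi).
Proof. by move=> hp hq; rewrite -[psi]opprK; apply: inertialB => //; exact: inertialN. Qed.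

Lemma inertialM phi psi : inertial phi -> inertial psi -> inertial (phi * psi).
Proof.
move=> /inertialP hp /inertialP hq; apply/inertialP => H sH.
pose H1 := sumset H (psi @` H).
have sH1 : subgroup H1 by apply: subg_sumset => //; exact: subg_image.
have f1 : fin_mod H H1.
  by apply: fin_mod_sumset => //; [exact: fin_mod_self | exact: hq].
apply: fin_mod_trans f1 (fin_mod_subr _ (hp _ sH1)) => _ [x Hx <-].
exists (psi x) => //; apply: sumset_subr; first exact: subg0.
by exists x.
Qed.

Lemma inertial_stable phi : (forall H, subgroup H -> forall x, H x -> H (phi x)) ->
  inertial phi.
Proof.
move=> h; apply/inertialP => H sH; apply: fin_mod_self => // _ [x Hx <-].
exact: h.
Qed.

Lemma inertial_int (n : int) : inertial (1 *~ n : endo A).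
Proof. by apply: inertial_stable => H sH x Hx; rewrite endoMzE; exact: subgMz. Qed.

(** The subgroup H generated by R and the sequence has finite index in H + phi(H): two of the
    infinitely many images lie in the same coset of H. *)
Lemma inertial_seq phi R (x : nat -> A) : inertial phi -> subgroup R ->
  exists i j N, (i < j)%N /\ gens R (mkseq x N) (phi (x j) - phi (x i)).
Proof.
move=> /inertialP hp sR; pose G N := gens R (mkseq x N).
have Gmono i j : (i <= j)%N -> G i `<=` G j.
  move=> ij; apply: gens_subseq => // _ /mapP[k + ->].
  by rewrite mem_iota => /= ki; apply: map_f; rewrite mem_iota /=; lia.
have sG N : subgroup (G N) by exact: subg_gens.
pose H := \bigcup_N G N.
have sH : subgroup H.
  split; first by exists 0%N => //; exact: subg0.
  move=> a b [i _ Ga] [j _ Gb]; exists (maxn i j) => //.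
  by apply: subgB => //; [exact: Gmono (leq_maxl _ _) _ Ga | exact: Gmono (leq_maxr _ _) _ Gb].
have Hx n : H (x n).
  exists n.+1 => //; apply: gens_mem => //.
  by apply: map_f; rewrite mem_iota /=.
have [X fX hX] := hp _ sH.
have hX' n : exists r, X r /\ H (phi (x n) - r).
  by have [|r Xr Hr] := hX (phi (x n)); [exists (x n) | exists r].
have [r hr] := choice hX'.
have [i [j [ij e]]] := pigeonhole_nat fX (fun n => (hr n).1).
have [N _ GN] : H (phi (x j) - phi (x i)).
  apply: subg_trans (hr j).2 _ => //; rewrite -e.
  by apply: subg_subC => //; exact: (hr i).2.
by exists i, j, N.
Qed.

(** If phi took infinitely many values on S, the last hypothesis would provide elements x_n with
    distinct values that generate a subgroup disjoint from R. Two of the values would be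
    congruent modulo this subgroup, hence equal, as they lie in R. *)
Lemma inertial_disjoint_finite phi R S : inertial phi -> subgroup R ->
  S 0 -> (forall x, S x -> R (phi x)) ->
  (forall s x, (forall y, y \in s -> S y) -> S x -> exists z, [/\ S z, phi z = phi x
     & forall g c, gens [set 0] s g -> R (g + z *~ c) -> z *~ c = 0]) ->
  finite_set (phi @` S).
Proof.
move=> hp sR S0 SR E; apply: contrapT => inf.
pose ok s z := [/\ S z, phi z \notin map phi s
     & forall g c, gens [set 0] s g -> R (g + z *~ c) -> z *~ c = 0].
have step (s : seq A) : exists z, (forall y, y \in s -> S y) -> ok s z.
  have [Ss|] := pselect (forall y, y \in s -> S y); last by exists 0.
  have [x Sx nx] : exists2 x, S x & phi x \notin map phi s.
    apply: contrapT => nex; apply: inf.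
    apply: (sub_finite_set _ (finite_seq (map phi s))) => _ [x Sx <-] /=.
    by apply: contrapT => /negP nx; apply: nex; exists x.
  have [z [Sz ez hz]] := E s x Ss Sx; exists z => _; split=> //; by rewrite ez.
have [x hx] := seq_choice step.
have Sx n : S (x n).
  have [m] := ubnP n; elim: m n => // m IH n nm.
  have [] // := hx n; move=> y /mapP[k + ->]; rewrite mem_iota /= => kn.
  by apply: IH; lia.
have okx n : ok (mkseq x n) (x n) by apply: hx => y /mapP[k _ ->].
have dis N g : gens [set 0] (mkseq x N) g -> R g -> g = 0.
  elim: N g => // N IH g; rewrite mkseqS gens_rcons => -[a Ga [_ [c _ <-] <-]] Rg.
  have [_ _ h] := okx N; have e := h _ _ Ga Rg.
  by move: Rg; rewrite e addr0; exact: IH.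
have [i [j [N [ij hN]]]] := inertial_seq x hp (@subg_set0 A).
have /subr0_eq e := dis N _ hN (subgB sR (SR _ (Sx j)) (SR _ (Sx i))).
have [_ nx _] := okx j; case/negP: nx; rewrite e; apply: map_f; apply: map_f.
by rewrite mem_iota.
Qed.

(** Otherwise every subgroup of finite index contains an x with phi x outside <x> + R. As S/R is
    residually finite and periodic, such elements x_n can be chosen so that the groups
    <x_n, phi x_n> are independent modulo R; but then the phi x_n are pairwise incongruent modulo
    the subgroup generated by R and the x_n. *)
Lemma inertial_resid_finite phi R S : inertial phi -> periodic [set: A] ->
  subgroup R -> subgroup S -> R `<=` S ->
  (forall x, S x -> S (phi x)) -> (forall x, R x -> R (phi x)) ->
  (forall x, S x -> ~ R x -> exists K, [/\ subgroup K, R `<=` K, fin_mod K S & ~ K x]) ->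
  exists S', [/\ subgroup S', R `<=` S' /\ S' `<=` S, fin_mod S' S
    & forall x, S' x -> sumset R (cyc x) (phi x)].
Proof.
move=> hp perA sR sS RS Sphi Rphi res; apply: contrapT => nex.
have bad S' : subgroup S' -> R `<=` S' -> S' `<=` S -> fin_mod S' S ->
    exists2 x, S' x & ~ sumset R (cyc x) (phi x).
  move=> sS' RS' S'S fS'; apply: contrapT => h; apply: nex; exists S'; split=> // x S'x.
  by apply: contrapT => h'; apply: h; exists x.
pose W s := gens R (s ++ map phi s).
pose ok s x := [/\ S x, ~ sumset R (cyc x) (phi x) & exists K, [/\ subgroup K,
  K x, K (phi x) & forall w, W s w -> K w -> R w]].
have step (s : seq A) : exists x, (forall y, y \in s -> S y) -> ok s x.
  have [Ss|] := pselect (forall y, y \in s -> S y); last by exists 0.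
  have SW : W s `<=` S.
    apply: gens_min => // y; rewrite mem_cat => /orP[/Ss //|/mapP[z /Ss Sz ->]]; exact: Sphi.
  have [X /finite_seqP[X' ->] hX] : fin_mod R (W s).
    apply: fin_mod_subr (fin_mod_gens_torsion (s ++ map phi s) sR) => w Ww; split=> //.
    by have [n [n0 wn]] := ord_ex perA w; exists n => //; rewrite wn; exact: subg0.
  have [||K [sK RK fK hK]] := fin_mod_bigcap (s := X') (P := fun r K => S r -> K r -> R r) sS _ _ RS.
    move=> r _; have [[Sr nRr]|h] := pselect (S r /\ ~ R r).
      by have [K [sK RK fK nK]] := res _ Sr nRr; exists K; split=> // _ /nK.
    exists S; split=> //; first exact: fin_mod_self.
    by move=> Sr _; apply: contrapT => nR; apply: h.
  - by move=> r K K' sub h Sr /sub; exact: h.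
  have sP : subgroup (phi @^-1` K) by exact: subg_preim.
  have sI : subgroup (S `&` phi @^-1` K) by exact: subgI.
  have fP : fin_mod (S `&` phi @^-1` K) S.
    apply: fin_mod_preim => //; apply: fin_mod_subr fK => _ [y Sy <-]; exact: Sphi.
  have [||||x [Sx [Kx [_ Kpx]]] nx] := bad (S `&` (K `&` (S `&` phi @^-1` K))).
  - by do 2?[apply: subgI => //].
  - by move=> y Ry; do !split; auto; apply: RK; exact: Rphi.
  - by move=> y [].
  - exact: fin_modI.
  exists x => _; split=> //; exists K; split=> // w Ww Kw.
  have [r rX Rwr] := hX _ Ww.
  have Rrw := subg_subC sR Rwr; apply: (subg_sub sR Rwr); apply: (hK _ rX).
    exact: subg_sub (RS _ Rrw) (SW _ Ww).
  exact: subg_sub (RK _ Rrw) Kw.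
have [x hx] := seq_choice step.
have Sx n : S (x n).
  have [m] := ubnP n; elim: m n => // m IH n nm.
  have [] // := hx n; move=> y /mapP[k + ->]; rewrite mem_iota /= => kn.
  by apply: IH; lia.
have okx n : ok (mkseq x n) (x n) by apply: hx => y /mapP[k _ ->].
have sW s : subgroup (W s) by exact: subg_gens.
have Wx i n : (i < n)%N -> W (mkseq x n) (x i).
  by move=> lt; apply: gens_mem => //; rewrite mem_cat map_f // mem_iota.
have Wphi i n : (i < n)%N -> W (mkseq x n) (phi (x i)).
  move=> lt; apply: gens_mem => //; rewrite mem_cat orbC map_f // map_f //.
  by rewrite mem_iota.
have GW n : gens R (mkseq x n) `<=` W (mkseq x n).
  by apply: gens_subseq => // y ys; rewrite mem_cat ys.
have Wmono i n : (i <= n)%N -> W (mkseq x i) `<=` W (mkseq x n).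
  move=> le; apply: gens_min => // [y|y]; first exact: gens_sub.
  rewrite mem_cat => /orP[/mapP[k + ->]|/mapP[_ /mapP[k + ->] ->]];
  by rewrite mem_iota /= => kn; first [apply: Wx; lia | apply: Wphi; lia].
(* a relation modulo R has no component on the terms after x_j, and none on x_j *)
have key j u N : W (mkseq x j) u -> (j < N)%N -> ~ gens R (mkseq x N) (phi (x j) - u).
  move=> Wu; elim: N => // N IH; rewrite ltnS leq_eqVlt => /predU1P[<-|jN].
    rewrite mkseqS gens_rcons => -[g Gg [_ [c _ <-] e]].
    have [_ nx [K [sK Kx Kpx hK]]] := okx j; apply: nx.
    exists (phi (x j) - x j *~ c); last by exists (x j *~ c); [exists c | rewrite subrK].
    apply: hK; last by apply: subgB => //; exact: subgMz.
    have -> : phi (x j) - x j *~ c = g + u.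
      by apply/eqP; rewrite subr_eq addrAC e subrK.
    by apply: subgD => //; exact: GW.
  rewrite mkseqS gens_rcons => -[g Gg [_ [c _ <-] e]]; apply: (IH jN).
  rewrite -e; apply: subgD => //; first exact: subg_gens.
  apply: gens_sub; have [_ _ [K [sK Kx Kpx hK]]] := okx N.
  apply: hK; last exact: subgMz.
  have -> : x N *~ c = phi (x j) - u - g by rewrite -e addrC addKr.
  by apply: subgB (GW _ _ Gg) => //; apply: subgB (Wmono _ _ (ltnW jN) _ Wu) => //; exact: Wphi.
have [i [j [N [ij hN]]]] := inertial_seq x hp sR.
have [jN|Nj] := ltnP j N; first exact: (key j (phi (x i)) N (Wphi _ _ ij) jN hN).
apply: (key j (phi (x i)) j.+1 (Wphi _ _ ij) (ltnSn j)).
apply: gens_subseq hN => // _ /mapP[k + ->]; rewrite mem_iota /= => kN.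
by apply: map_f; rewrite mem_iota /=; lia.
Qed.

End InertialRing.

(** * Endomorphisms preserving all cyclic subgroups *)

Section Scalars.
Variables (V : zmodType) (p : nat) (phi : endo V) (R S : set V).
Hypotheses (pp : prime p) (sR : subgroup R) (sS : subgroup S).
Hypothesis hphi : forall y, S y -> sumset R (cyc y) (phi y).

(** By induction on the order of y modulo R: if phi - c did not kill y, its value would
    generate the socle of <y>; being also a multiple of x + y, it would lie in <x>, and
    subtracting a multiple of x from y would lower the order of y. *)
Lemma scalar_transfer x c l : S x -> R (x *+ p ^ l) -> R (phi x - x *~ c) ->
  forall k y, S y -> R (y *+ p ^ k) ->
  (forall j, R (x *+ p ^ j) -> R (y *+ p ^ j)) -> R (phi y - y *~ c).
Proof.
move=> Sx Rxl Rx; elim=> [|k IH] y Sy Rk le.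
  have Ry : R y by rewrite -[y]mulr1n.
  apply: subgB => //; last exact: subgMz.
  by have [r Rr [_ [e _ <-] <-]] := hphi Sy; apply: subgD => //; exact: subgMz.
have [|nRk] := pselect (R (y *+ p ^ k)); first by move=> h; apply: IH.
have [r Rr [_ [e0 _ <-] e0E]] := hphi Sy.
set e := e0 - c; have eE : phi y - y *~ c = r + y *~ e.
  by rewrite -e0E mulrzBr addrA.
have Rpe : R (y *+ (`|e| * p)).
  have h : R (phi (y *+ p) - (y *+ p) *~ c).
    apply: IH; [exact: subgMn | by rewrite -mulrnA -expnS|].
    by move=> j /le h; rewrite mulrnAC; exact: subgMn.
  have e1 : phi (y *+ p) - (y *+ p) *~ c = r *+ p + y *~ e *+ p.
    by rewrite -mulrnDl -eE mulrnBl endoMn !pmulrn -!mulrzA mulrC.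
  rewrite mulnC mulrnA; apply/(subg_abs (y *+ p) e sR).
  have -> : y *+ p *~ e = (phi (y *+ p) - (y *+ p) *~ c) - r *+ p.
    by rewrite e1 [RHS]addrC addKr !pmulrn -!mulrzA mulrC.
  by apply: subgB => //; exact: subgMn.
have /dvdnP[e' e'E] : (p ^ k %| `|e|)%N.
  apply: contrapT => /negP ndv; apply: nRk; apply: (subg_pdiv pp sR Rk Rpe).
  by rewrite expnSr dvdn_pmul2r ?prime_gt0.
have [/dvdnP[e'' e''E]|pe'] := boolP (p %| e')%N.
  rewrite eE; apply: subgD => //; apply/subg_abs => //.
  by rewrite e'E e''E -mulnA -expnS mulnC mulrnA; exact: subgMn.
have nRe : ~ R (y *~ e).
  move=> /(subg_abs _ _ sR); rewrite e'E => h; apply: nRk.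
  apply: (subg_pdiv pp sR Rk h).
  by rewrite expnS dvdn_pmul2r ?expn_gt0 ?prime_gt0.
have [r2 Rr2 [_ [d0 _ <-] d0E]] := hphi (subgD sS Sx Sy).
set d := d0 - c.
have rel : R ((x + y) *~ d - y *~ e).
  have -> : (x + y) *~ d - y *~ e = (phi x - x *~ c) + r - r2.
    have e1 : phi (x + y) = r2 + (x + y) *~ d + (x + y) *~ c.
      by rewrite -d0E mulrzBr -addrA subrK.
    have -> : r = phi y - y *~ c - y *~ e by rewrite eE addrK.
    have -> : phi x = phi (x + y) - phi y by rewrite endoD addrK.
    rewrite e1 !mulrzDl; abel.
  by apply: subgB => //; apply: subgD.
have nRx : ~ R (x *~ d).
  move=> /(subg_abs _ _ sR) h.
  have := subg_gcd sR Rxl h.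
  have /(dvdn_pfactor _ _ pp)[i _ ei] := dvdn_gcdl (p ^ l) `|d|.
  rewrite ei => /le hy.
  have Ryd : R (y *~ d).
    apply/subg_abs => //; have /dvdnP[t ->] : (p ^ i %| `|d|)%N by rewrite -ei dvdn_gcdr.
    by rewrite mulnC mulrnA; exact: subgMn.
  apply: nRe; have -> : y *~ e = (x + y) *~ d - ((x + y) *~ d - y *~ e) by rewrite subKr.
  by apply: subgB => //; rewrite mulrzDl; apply: subgD => //; apply/subg_abs.
pose K := sumset R (cyc (x *~ d)).
have sK : subgroup K by apply: subg_sumset => //; exact: subg_cyc.
have RK : R `<=` K by apply: sumset_subl; exact: subg0 (subg_cyc _).
have Kd : K (x *~ d) by apply: sumset_subr; [exact: subg0 | exact: cyc_id].
have relK : K (y *~ (e - d)).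
  have -> : y *~ (e - d) = x *~ d - ((x + y) *~ d - y *~ e).
    by rewrite mulrzBr mulrzDl; abel.
  by apply: subgB => //; exact: RK.
have [R' R'R [_ [t _ <-] tE]] : K (y *+ p ^ k).
  move/(subg_abs _ _ sK): relK => relK'; apply: (subg_pdiv pp sK (RK _ Rk) relK').
  apply/negP => /dvdnP[u uE]; apply: nRx.
  have Red : R (y *~ (e - d)).
    by apply/subg_abs => //; rewrite uE mulnC mulrnA; exact: subgMn.
  have -> : x *~ d = y *~ (e - d) + ((x + y) *~ d - y *~ e).
    by rewrite mulrzBr mulrzDl; abel.
  exact: subgD.
rewrite -mulrzA in tE; set T := d * t in tE.
have nRxk : ~ R (x *+ p ^ k) by move=> /le.
have /dvdnP[T' T'E] : (p ^ k %| `|T|)%N.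
  apply: contrapT => /negP ndv; apply: nRxk; apply: (subg_pdiv (c := `|T| * p) pp sR Rxl); last first.
    by rewrite expnSr dvdn_pmul2r ?prime_gt0.
  rewrite mulnC mulrnA; apply/(subg_abs (x *+ p) T sR).
  have -> : x *+ p *~ T = y *+ p ^ k.+1 - R' *+ p.
    by rewrite expnSr mulrnA -tE mulrnDl addrAC subrr add0r !pmulrn -!mulrzA mulrC.
  by apply: subgB => //; exact: subgMn.
have [T1 T1E] : exists T1 : int, T = T1 *+ p ^ k.
  exists (sgz T * T'%:Z); rewrite [LHS]intEsg T'E PoszM mulrA -mulr_natr.
  by rewrite natz.
have Ry1 : R ((y - x *~ T1) *+ p ^ k).
  suff -> : (y - x *~ T1) *+ p ^ k = R' by [].
  by rewrite mulrnBl -tE T1E -mulr_natr natz mulrzA -pmulrn addrK.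
have := IH (y - x *~ T1) _ Ry1 _.
have Rx1 : R ((phi x - x *~ c) *~ T1) by exact: subgMz.
move=> h; have -> : phi y - y *~ c = (phi (y - x *~ T1) - (y - x *~ T1) *~ c)
    + (phi x - x *~ c) *~ T1.
  rewrite endoB endoMz !mulrzBl [x *~ c *~ T1]mulrzAC; abel.
apply: subgD => //; apply: h.
  by apply: subgB => //; exact: subgMz.
move=> j Rj; rewrite mulrnBl; apply: subgB => //; first exact: le.
by rewrite pmulrn -mulrzA mulrC mulrzA -pmulrn; exact: subgMz.
Qed.

End Scalars.

Lemma cyc_nat (V : zmodType) (x y : V) : periodic [set: V] -> cyc x y -> exists n, y = x *+ n.
Proof.
move=> perV [c _ <-]; have [m [m0 xm]] := ord_ex perV x.
case: c => n; first by exists n.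
exists (n.+1 * m.-1)%N; rewrite NegzE mulrNz -pmulrn; apply/esym/eqP.
by rewrite -addr_eq0 -mulrnDr addnC -mulnS prednK // mulnC mulrnA xm mul0rn.
Qed.

(** The integer by which phi multiplies an element of order p^k modulo R works for all elements
    of at most this order, by the transfer lemma. For k = 1, 2, ... these integers form a
    coherent sequence of residues, unless the orders are bounded. *)
Lemma scalar_padic (V : zmodType) (perV : periodic [set: V]) (p : primeT) (phi : endo V)
    (R S : set V) : subgroup R -> subgroup S ->
  (forall y, S y -> exists k, y *+ p ^ k = 0) ->
  (forall y, S y -> sumset R (cyc y) (phi y)) ->
  exists alpha, forall y, S y -> R (phi y - jact perV alpha y).
Proof.
move=> sR sS Sp hphi; have pp := prime_primeT p.
have hc y : S y -> exists c : nat, R (phi y - y *+ c).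
  move=> Sy; have [r Rr [z /(cyc_nat perV)[c ->] e]] := hphi y Sy.
  by exists c; rewrite -e addrK.
have RSk y k m : (k <= m)%N -> R (y *+ p ^ k) -> R (y *+ p ^ m).
  by move=> km Rk; rewrite -(subnKC km) expnD mulrnA; exact: subgMn.
have Rk y : S y -> exists k, R (y *+ p ^ k).
  by move=> /Sp[k e]; exists k; rewrite e; exact: subg0.
have [[M hM]|nb] := pselect (exists M, forall y, S y -> R (y *+ p ^ M)).
  elim: M hM => [|M IH] hM.
    exists 0 => y Sy; rewrite jact0 subr0.
    have [r Rr [z [c _ <-] <-]] := hphi y Sy; apply: subgD => //; apply: subgMz => //.
    by rewrite -[y]mulr1n; exact: hM.
  have [/IH //|nM] := pselect (forall y, S y -> R (y *+ p ^ M)).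
  have [x Sx nx] : exists2 x, S x & ~ R (x *+ p ^ M).
    by apply: contrapT => h; apply: nM => y Sy; apply: contrapT => ny; apply: h; exists y.
  have [c Rc] := hc x Sx; exists c%:R => y Sy; rewrite jact_natr.
  have := scalar_transfer (c := c) pp sR sS hphi Sx (hM _ Sx) Rc Sy (hM _ Sy).
  rewrite -pmulrn; apply.
  move=> j Rj; apply: (RSk _ M.+1); last exact: hM.
  by rewrite ltnNge; apply/negP => jM; apply: nx; exact: RSk Rj.
have hx k : exists x, [/\ S x, R (x *+ p ^ k.+1) & ~ R (x *+ p ^ k)].
  have [y Sy ny] : exists2 y, S y & ~ R (y *+ p ^ k).
    by apply: contrapT => h; apply: nb; exists k => y Sy; apply: contrapT => ny; apply: h; exists y.
  have [n Rn] := Rk y Sy.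
  elim: n Rn => [|n IH] Rn.
    by exfalso; apply: ny; exact: RSk Rn.
  have [/IH //|nn] := pselect (R (y *+ p ^ n)).
  have kn : (k <= n)%N.
    by rewrite leqNgt; apply/negP => nk; apply: ny; exact: RSk Rn.
  exists (y *+ p ^ (n - k)); split; first exact: subgMn.
    by rewrite -mulrnA -expnD addnS subnK.
  by rewrite -mulrnA -expnD subnK.
have hck k : exists c : nat, forall y, S y -> R (y *+ p ^ k.+1) -> R (phi y - y *+ c).
  have [x [Sx Rx nx]] := hx k; have [c Rc] := hc x Sx; exists c => y Sy Ry.
  rewrite pmulrn; have := scalar_transfer (c := c) pp sR sS hphi Sx Rx Rc Sy Ry.
  rewrite -pmulrn; apply.
  move=> j Rj; apply: (RSk _ k.+1) => //.
  by rewrite ltnNge; apply/negP => jM; apply: nx; exact: RSk Rj.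
have [c c_scale] := choice hck.
have coh k : c k.+1 = c k %[mod p ^ k.+1].
  have [x [Sx Rx nx]] := hx k.
  have R1 := c_scale k x Sx Rx.
  have R2 : R (phi x - x *+ c k.+1) by apply: c_scale => //; exact: RSk Rx.
  have dv a b : (a <= b)%N -> R (phi x - x *+ a) -> R (phi x - x *+ b) -> (p ^ k.+1 %| b - a)%N.
    move=> ab Ra Rb; apply: contrapT => /negP ndv; apply: nx; apply: (subg_pdiv pp sR Rx _ ndv).
    rewrite mulrnBr //; have -> : x *+ b - x *+ a = (phi x - x *+ a) - (phi x - x *+ b).
      by abel.
    exact: subgB.
  have [le|/ltnW le] := leqP (c k) (c k.+1).
    by apply/eqP; rewrite eqn_mod_dvd //; exact: dv.
  by apply/esym/eqP; rewrite eqn_mod_dvd //; exact: dv.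
have [|alpha halpha] := mk_padics (c := fun q k => if q == p then c k else 0%N).
  by move=> q k; case: eqP => // ->.
exists alpha => y Sy; have [k yk] := Sp y Sy.
have yk1 : y *+ p ^ k.+1 = 0 by rewrite expnSr mulrnA yk mul0rn.
rewrite (jact_pprim perV alpha yk1) (mulrn_eqmod yk1 (halpha p k)) eqxx.
by apply: c_scale => //; rewrite yk1; exact: subg0.
Qed.

(** * Divisibility and finiteness in p-groups *)

Definition multiples (V : zmodType) (S : set V) n : set V := [set y *+ n | y in S].

Lemma fin_mod_exponent (V : zmodType) (perV : periodic [set: V]) (K S : set V) : subgroup K -> fin_mod K S ->
  exists2 n, (0 < n)%N & forall x, S x -> K (x *+ n).
Proof.
move=> sK [X /finite_seqP[s ->] h].
have [n n0 hn] : exists2 n, (0 < n)%N & forall r, r \in s -> r *+ n = 0.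
  elim: s {h} => [|r s [n n0 hn]]; first by exists 1%N.
  have [m [m0 rm]] := ord_ex perV r; exists (m * n)%N; first by rewrite muln_gt0 m0.
  move=> t; rewrite in_cons => /predU1P[->|/hn e]; first by rewrite mulrnA rm mul0rn.
  by rewrite mulnC mulrnA e mul0rn.
exists n => // x /h[r rs Kr]; rewrite -(subrK r x) mulrnDl (hn r rs) addr0.
exact: subgMn.
Qed.

Section PGroups.
Variables (V : zmodType) (p : nat).
Hypothesis pp : prime p.
Implicit Types (R S K : set V).

Lemma subg_multiples S n : subgroup S -> subgroup (multiples S n).
Proof.
move=> sS; split; first by exists 0; rewrite ?mul0rn //; exact: subg0.
by move=> _ _ [a Sa <-] [b Sb <-]; exists (a - b); [exact: subgB | rewrite mulrnBl].
Qed.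

Lemma multiples_sub S n : subgroup S -> multiples S n `<=` S.
Proof. by move=> sS _ [y Sy <-]; exact: subgMn. Qed.

Lemma multiples_endo (phi : endo V) S n : (forall x, S x -> S (phi x)) ->
  forall x, multiples S n x -> multiples S n (phi x).
Proof. by move=> h _ [y Sy <-]; exists (phi y); [exact: h | rewrite endoMn]. Qed.

Lemma multiples_le S m n : subgroup S -> (m <= n)%N ->
  multiples S (p ^ n) `<=` multiples S (p ^ m).
Proof.
move=> sS mn _ [y Sy <-]; exists (y *+ p ^ (n - m)); first exact: subgMn.
by rewrite -mulrnA -expnD subnK.
Qed.

Lemma fin_mod_multiples S R K n : fin_mod K S -> (forall x, K x -> R (x *+ n)) ->
  fin_mod R (multiples S n).
Proof.
move=> fK h.
have E x : (1 *+ n : endo V) x = x *+ n by rewrite endoMnE.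
suff: fin_mod R ((1 *+ n : endo V) @` S).
  by apply: fin_mod_subr => _ [y Sy <-]; exists y => //; rewrite E.
by apply: fin_mod_imageW fK _ => x Kx; rewrite /= E; exact: h.
Qed.

(** By induction on the order p^(k+1) of x: if p^k x = p^(k+1) y then x - p y has smaller
    order. *)
Lemma divisible_of_socle S : subgroup S -> (forall x, S x -> exists k, x *+ p ^ k = 0) ->
  (forall x n, S x -> x *+ p = 0 -> multiples S (p ^ n) x) ->
  forall x, S x -> multiples S p x.
Proof.
move=> sS Sp soc x Sx; have [k] := Sp x Sx.
elim: k x Sx => [|k IH] x Sx xk.
  by exists 0; rewrite ?mul0rn -?xk ?mulr1n //; exact: subg0.
have [|y Sy ey] := soc (x *+ p ^ k) k.+1 (subgMn _ sS Sx); first by rewrite -mulrnA -expnSr.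
have [||z Sz ez] := IH (x - y *+ p); first by apply: subgB => //; exact: subgMn.
  by rewrite mulrnBl -ey -mulrnA -expnS subrr.
by exists (z + y); [exact: subgD | rewrite mulrnDl ez subrK].
Qed.

Lemma pdivisible_pow S : (forall x, S x -> multiples S p x) ->
  forall n x, S x -> multiples S (p ^ n) x.
Proof.
move=> h; elim=> [|n IH] x Sx; first by exists x.
have [y Sy <-] := IH x Sx; have [z Sz <-] := h y Sy.
by exists z => //; rewrite -mulrnA -expnS.
Qed.

Lemma pdivisible_divisible S : subgroup S -> (forall x, S x -> exists k, x *+ p ^ k = 0) ->
  (forall x, S x -> multiples S p x) -> forall n x, (0 < n)%N -> S x -> multiples S n x.
Proof.
move=> sS Sp h n x n0 Sx; have [k xk] := Sp x Sx.
have [y Sy ey] := pdivisible_pow h (logn p n) Sx.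
have [l yl] := Sp y Sy.
have cop : coprime (p ^ l) n`_p^'.
  by apply: coprimeXl; rewrite (@pnat_coprime p) ?pnat_id // part_pnat.
pose c := chinese (p ^ l) n`_p^' 1 0.
have /dvdnP[u uE] : (n`_p^' %| c)%N by apply/eqP; rewrite chinese_modr // mod0n.
exists (y *+ u); first exact: subgMn.
have nE : (u * n = c * p ^ logn p n)%N by rewrite uE -p_part -mulnA [(_`_p^' * _)%N]mulnC partnC.
rewrite -mulrnA nE mulrnA -ey; congr (_ *+ _).
by rewrite -[RHS]mulr1n; apply: (mulrn_eqmod yl); rewrite chinese_modl.
Qed.

(** Zorn's lemma; the last clause is what maximality is used for. *)
Lemma max_avoiding R S (X : set V) : subgroup R -> subgroup S -> R `<=` S ->
  (forall x, R x -> ~ X x) ->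
  exists K, [/\ subgroup K, R `<=` K /\ K `<=` S, forall x, K x -> ~ X x
    & forall y, S y -> ~ K y -> exists2 z, X z & sumset K (cyc y) z].
Proof.
move=> sR sS RS RX.
pose P K := [/\ subgroup (K `|` R), K `<=` S & forall x, K x -> ~ X x].
have [C CP tot|K [[sK KS KX] maxK]] := @Zorn_bigcup V P.
  split.
  - split; first by right; exact: subg0.
    have CR K x : C K -> (K `|` R) x -> (\bigcup_(X in C) X `|` R) x.
      by move=> CK [Kx|Rx]; [left; exists K | right].
    move=> x y [[K CK Kx]|Rx] [[L CL Ly]|Ry].
    + have [KL|LK] := tot _ _ CK CL.
        apply: (CR L) => //; have [sL _ _] := CP _ CL.
        by apply: subgB => //; left=> //; exact: KL.
      apply: (CR K) => //; have [sK _ _] := CP _ CK.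
      by apply: subgB => //; left=> //; exact: LK.
    + by apply: (CR K) => //; have [sK _ _] := CP _ CK; apply: subgB => //; [left | right].
    + by apply: (CR L) => //; have [sL _ _] := CP _ CL; apply: subgB => //; [right | left].
    + by right; exact: subgB.
  - by move=> x [K CK Kx]; have [_ KS _] := CP _ CK; exact: KS.
  - by move=> x [K CK Kx]; have [_ _ KX] := CP _ CK; exact: KX.
exists (K `|` R); split=> //.
- by split=> x; [right | move=> [/KS|/RS]].
- by move=> x [/KX|/RX].
- move=> y Sy nKy; apply: contrapT => h.
  pose L := sumset (K `|` R) (cyc y).
  have sL : subgroup L by apply: subg_sumset => //; exact: subg_cyc.
  have KL : K `|` R `<=` L by apply: sumset_subl; exact: subg0 (subg_cyc y).
  apply: (maxK L).
    split; first by move=> x Kx; apply: KL; left.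
    move=> LK; apply: nKy; left; apply: LK; apply: sumset_subr; first exact: subg0.
    exact: cyc_id.
  split.
  - suff -> : L `|` R = L by [].
    by apply/seteqP; split=> x; [case=> // Rx; apply: KL; right | left].
  - apply: sumset_min => //; last by apply: cyc_min.
    by move=> x [/KS|/RS].
  - by move=> x Lx Xx; apply: h; exists x.
Qed.

Lemma fin_mod_socle K S : subgroup K -> subgroup S ->
  fin_mod K [set y | S y /\ K (y *+ p)] ->
  forall j, fin_mod K [set y | S y /\ K (y *+ p ^ j)].
Proof.
move=> sK sS f1; elim=> [|j IH].
  by apply: fin_mod_self => // y [_]; rewrite mulr1n.
apply: (@fin_mod_refine V V K (fun y => y *+ p)) => //.
  have [X fX h] := IH; exists X => // y [Sy Ky]; apply: h; split; first exact: subgMn.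
  by rewrite -mulrnA -expnS.
apply: fin_mod_subr f1 => _ [x [y [[Sx _] [Sy _] Kxy ->]]].
by split; [exact: subgB | rewrite mulrnBl].
Qed.

(** If K is maximal among the subgroups not containing x, the socle of the quotient by K is
    generated by a multiple of x, and a bounded p-group with finite socle is finite. *)
Lemma bounded_resid_finite k R S x : subgroup R -> subgroup S -> R `<=` S ->
  (forall y, S y -> R (y *+ p ^ k)) -> S x -> ~ R x ->
  exists K, [/\ subgroup K, R `<=` K, fin_mod K S & ~ K x].
Proof.
move=> sR sS RS Sk Sx nRx.
have [|K [sK [RK KS] KX maxK]] := @max_avoiding R S [set x] sR sS RS.
  by move=> y Ry /= e; apply: nRx; rewrite -e.
exists K; split=> //; last by move=> /KX; apply.
suff f1 : fin_mod K [set y | S y /\ K (y *+ p)].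
  apply: fin_mod_subr (fin_mod_socle sK sS f1 k) => y Sy; split=> //.
  exact/RK/Sk.
have sL : subgroup (sumset K (cyc x)) by apply: subg_sumset => //; exact: subg_cyc.
have KL : K `<=` sumset K (cyc x) by apply: sumset_subl; exact: subg0 (subg_cyc x).
have fL : fin_mod K (sumset K (cyc x)).
  by apply: (@fin_mod_cyc _ _ x (p ^ k)) => //; [rewrite expn_gt0 prime_gt0 | exact/RK/Sk].
apply: fin_mod_subr fL => y [Sy Kpy].
have [/KL //|nKy] := pselect (K y).
have [_ -> [r Kr [_ [c _ <-] e]]] := maxK y Sy nKy.
have nc : ~~ (p ^ 1 %| `|c|)%N.
  apply/negP => /dvdnP[u uE]; apply: (KX x) => //; rewrite -e; apply: subgD => //.
  by apply/subg_abs => //; rewrite uE mulnC mulrnA; exact: subgMn.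
have Lc : sumset K (cyc x) (y *+ `|c|).
  apply/(subg_abs y c sL); have -> : y *~ c = x - r by rewrite -e addrC addKr.
  apply: subgB => //; last exact: KL.
  by apply: sumset_subr; [exact: subg0 | exact: cyc_id].
rewrite -[y]mulr1n -(expn0 p); apply: (subg_pdiv (M := 1) pp sL _ Lc nc).
by rewrite expn1; exact: KL.
Qed.

End PGroups.

(** A divisible p-group is the union of its quasicyclic subgroups U. As phi(U) is divisible and
    U has finite index in U + phi(U), phi(U) is contained in U, and in U an element phi x whose
    order divides that of x is a multiple of x. *)
Lemma inertial_divisible (V : zmodType) (perV : periodic [set: V]) (p : nat) (phi : endo V)
    (D : set V) : prime p -> inertial phi -> subgroup D ->
  (forall x, D x -> exists k, x *+ p ^ k = 0) -> (forall x, D x -> multiples D p x) ->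
  forall x, D x -> cyc x (phi x).
Proof.
move=> pp hp sD Dp Ddiv x Dx.
have hg y : exists z, D y -> D z /\ z *+ p = y.
  have [Dy|] := pselect (D y); last by exists 0.
  by have [z Dz ez] := Ddiv y Dy; exists z.
have [g gE] := choice hg.
pose u i := iter i g x.
have Du i : D (u i) by elim: i => //= i /gE[].
have uS i : u i.+1 *+ p = u i by have [] := gE _ (Du i).
have uk i j : u (i + j)%N *+ p ^ j = u i.
  elim: j => [|j IH]; first by rewrite addn0.
  by rewrite addnS expnS mulrnA uS.
pose U := [set z | exists i c, z = u i *~ c].
have sU : subgroup U.
  split; first by exists 0%N, 0.
  move=> _ _ [i [c ->]] [j [d ->]]; exists (i + j)%N, (c *+ p ^ j - d *+ p ^ i).
  rewrite mulrzBr -[c *+ _]mulr_natl -[d *+ _]mulr_natl !natz !mulrzA -!pmulrn.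
  by rewrite uk addnC uk.
have UD : U `<=` D by move=> _ [i [c ->]]; exact: subgMz.
have Up z : U z -> exists k, z *+ p ^ k = 0 by move=> /UD/Dp.
have Udiv z : U z -> multiples U p z.
  move=> [i [c ->]]; exists (u i.+1 *~ c); first by exists i.+1, c.
  by rewrite pmulrn mulrzAC -pmulrn uS.
have fU : fin_mod U (phi @` U) by move/inertialP: hp; apply.
have [n n0 hn] := fin_mod_exponent perV sU fU.
have phiU z : U z -> U (phi z).
  move=> Uz; have [y Uy <-] := pdivisible_divisible pp sU Up Udiv n0 Uz.
  by rewrite endoMn; apply: hn; exists y.
have [i [c ec]] : U (phi x) by apply: phiU; exists 0%N, 1.
have [k] := Dp x Dx; elim: k => [|k IH] xk.
  by move: xk; rewrite mulr1n => ->; rewrite endo0; exact: subg0 (subg_cyc 0).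
have [/IH //|xk'] := pselect (x *+ p ^ k = 0).
have /dvdnP[c' c'E] : (p ^ i %| `|c|)%N.
  apply: contrapT => /negP ndv; apply: xk'.
  suff : [set 0] (u i *+ p ^ (i + k)) by rewrite expnD mulrnA -{1}[i]add0n uk.
  apply: (subg_pdiv (M := i + k.+1) (c := `|c| * p ^ k.+1) pp (@subg_set0 V)).
  - by rewrite /= expnD mulrnA -{1}[i]add0n uk.
  - rewrite /= mulrnA; have : phi x *+ p ^ k.+1 = 0 by rewrite -endoMn xk endo0.
    rewrite ec; case: c {ec ndv} => m //; rewrite NegzE mulrNz mulNrn => /eqP.
    by rewrite oppr_eq0 => /eqP.
  - by rewrite -addnS expnD dvdn_pmul2r // expn_gt0 prime_gt0.
rewrite ec; have cx : cyc (x) (u i *+ `|c|).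
  rewrite c'E mulnC mulrnA -{1}[i]add0n uk.
  by exists c'.
by have /(subg_abs _ _ (subg_cyc x)) := cx.
Qed.

(** * Inertial endomorphisms of periodic groups *)

Section PComponent.
Variables (V : zmodType) (p : primeT).
Hypothesis perV : periodic [set: V].
Implicit Types (phi : endo V).

Let pp : prime p := prime_primeT p.
Let p0 k : (0 < p ^ k)%N. Proof. by rewrite expn_gt0 prime_gt0. Qed.

Definition pprim : set V := [set` pipart V p].

Lemma pprimP x : pprim x <-> exists k, x *+ p ^ k = 0.
Proof. exact: pipartP. Qed.

Lemma subg_pprim : subgroup pprim. Proof. exact: subg_zmod. Qed.

Lemma pprim_endo phi x : pprim x -> pprim (phi x).
Proof. by move=> /pprimP[k xk]; apply/pprimP; exists k; rewrite -endoMn xk endo0. Qed.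

Definition infheight : set V := [set x | forall n, multiples pprim (p ^ n) x].

Lemma subg_infheight : subgroup infheight.
Proof.
have sM n := subg_multiples (p ^ n) subg_pprim.
split=> [n|x y hx hy n]; first exact: subg0 (sM n).
exact: subgB (sM n) (hx n) (hy n).
Qed.

Lemma infheight_sub : infheight `<=` pprim.
Proof. by move=> x /(_ 0%N); apply: multiples_sub; exact: subg_pprim. Qed.

Lemma infheight_endo phi x : infheight x -> infheight (phi x).
Proof. by move=> hx n; apply: multiples_endo (hx n) => y; exact: pprim_endo. Qed.

Definition torsion_layer k : set V := [set x | pprim x /\ x *+ p ^ k = 0].

Lemma subg_layer k : subgroup (torsion_layer k).
Proof.
split; first by split; [exact: subg0 subg_pprim | rewrite mul0rn].
move=> x y [Sx xk] [Sy yk]; split; first exact: subgB subg_pprim Sx Sy.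
by rewrite mulrnBl xk yk subrr.
Qed.

Lemma layer_pprim k : torsion_layer k `<=` pprim. Proof. by move=> x []. Qed.

Lemma layer_endo phi k x : torsion_layer k x -> torsion_layer k (phi x).
Proof. by case=> Sx xk; split; [exact: pprim_endo | rewrite -endoMn xk endo0]. Qed.

Lemma fin_mod_fin (phi : endo V) (K S : set V) :
  fin_mod K S -> (forall x, K x -> phi x = 0) -> finite_set (phi @` S).
Proof. by move=> fK h; apply/fin_mod0; apply: fin_mod_imageW fK _ => x /h. Qed.

(** Bounded p-groups are residually finite, so that phi preserves the cyclic subgroups of a
    subgroup of finite index of the layer and is a scalar there. *)
Lemma inertial_layer phi k : inertial phi -> exists L (c : nat),
  [/\ subgroup L, L `<=` torsion_layer k, fin_mod L (torsion_layer k)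
    & forall x, L x -> phi x = x *+ c].
Proof.
move=> hp; have sS := subg_layer k; have s0 := @subg_set0 V.
have [||||L [sL [_ LS] fL hL]] := inertial_resid_finite hp perV s0 sS.
- by move=> _ ->; exact: subg0.
- by move=> x; exact: layer_endo.
- by move=> _ ->; rewrite endo0.
- move=> x Sx nx; apply: (@bounded_resid_finite V p pp k) Sx nx => //.
    by move=> _ ->; exact: subg0.
  by move=> y [].
have [|alpha halpha] := scalar_padic perV (p := p) s0 sL _ hL.
  by move=> y /LS[_ yk]; exists k.
exists L, (jrep alpha (p ^ k)); split=> // x Lx.
have [_ xk] := LS x Lx.
by have /subr0_eq -> := halpha x Lx; rewrite (jactE _ _ _ xk).
Qed.

Definition socle_of_multiples e : set V := [set x | multiples pprim (p ^ e) x /\ x *+ p = 0].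

Lemma socle_layer e : socle_of_multiples e = multiples (torsion_layer e.+1) (p ^ e).
Proof.
apply/seteqP; split=> x.
  by move=> [[y Sy <-] e1]; exists y => //; split=> //; rewrite expnSr mulrnA.
by move=> [y [Sy ye] <-]; split; [exists y | rewrite -mulrnA -expnSr].
Qed.

(** If the socle of p^e S were finite modulo the elements of infinite height, then the socle
    of some p^n S would consist of elements of infinite height, and p^n S would be divisible. *)
Lemma unbounded_socle e : (forall n, ~ multiples pprim (p ^ n) `<=` infheight) ->
  ~ fin_mod infheight (socle_of_multiples e).
Proof.
move=> unb [X /finite_seqP[s ->] hX].
have hn r : exists n, ~ infheight r -> ~ multiples pprim (p ^ n) r.
  have [h|/existsNP[n hn]] := pselect (infheight r); first by exists 0%N.
  by exists n.
have [f fE] := choice hn.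
pose n := (e + \max_(r <- s) f r)%N.
have sub m1 m2 : (m1 <= m2)%N -> multiples pprim (p ^ m2) `<=` multiples pprim (p ^ m1).
  by apply: multiples_le; exact: subg_pprim.
have key x : multiples pprim (p ^ n) x -> x *+ p = 0 -> infheight x.
  move=> nx xp; have [|r rs hr] := hX x.
    by split=> //; apply: sub nx; exact: leq_addr.
  apply: (subg_sub subg_infheight hr).
  apply: contrapT => nr; apply: (fE r nr).
  have le : (f r <= n)%N.
    by apply: leq_trans (leq_addl _ _); apply: leq_bigmax_seq.
  apply: (sub _ _ le).
  have sM := subg_multiples (p ^ n) subg_pprim.
  apply: (subg_sub sM (subg_subC sM (hr n))) => //.
apply: (unb n); have sM := subg_multiples (p ^ n) subg_pprim.
have div : forall x, multiples pprim (p ^ n) x -> multiples (multiples pprim (p ^ n)) p x.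
  apply: (divisible_of_socle sM).
    by move=> x /(multiples_sub subg_pprim)/pprimP.
  move=> x m nx xp; have [y Sy <-] := key x nx xp (n + m)%N.
  by exists (y *+ p ^ n); [exists y | rewrite -mulrnA -expnD].
move=> x nx m; have [y ny <-] := pdivisible_pow div m nx.
by exists y => //; exact: multiples_sub subg_pprim _ ny.
Qed.

(** When S/R is unbounded, elements of S can be shifted by elements of large order in the
    kernel of theta so as to become independent modulo R. *)
Lemma unbounded_inertial_finite theta S' :
  (forall n, ~ multiples pprim (p ^ n) `<=` infheight) ->
  inertial theta -> subgroup S' -> infheight `<=` S' -> S' `<=` pprim -> fin_mod S' pprim ->
  (forall x, S' x -> infheight (theta x)) -> finite_set (theta @` pprim).
Proof.
move=> unb ht sS' RS' S'S fS' S'R; have sR := subg_infheight; have sS := subg_pprim.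
have kerL e : exists L, [/\ subgroup L, L `<=` torsion_layer e.+1,
    fin_mod L (torsion_layer e.+1) & forall x, L x -> theta x = 0].
  have [L [c [sL LS fL hL]]] := inertial_layer e.+1 ht.
  have [/dvdnP[u uE]|ndv] := boolP (p ^ e.+1 %| c)%N.
    exists L; split=> // x Lx; have [_ xe] := LS x Lx.
    by rewrite hL // uE mulnC mulrnA xe mul0rn.
  case: (unbounded_socle unb (e := e)); rewrite socle_layer.
  apply: fin_mod_multiples (fin_modI sL sS' (subg_layer _) fL _) _.
    by apply: fin_mod_subr fS'; exact: layer_pprim.
  move=> x [[Sx xe] [Lx S'x]]; apply: (subg_pdiv (M := e.+1) pp sR _ _ ndv).
    by rewrite xe; exact: subg0.
  by rewrite -hL //; exact: S'R.
apply/fin_mod0; apply: fin_mod_trans (fin_mod_image theta fS').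
apply/fin_mod0; apply: (inertial_disjoint_finite ht sR (subg0 sS') S'R) => s x sS1 S'x.
have /pprimP[e xe] := S'S x S'x.
have [L [sL LS fL hL]] := kerL e.
pose X := gens infheight (x :: s).
have sX : subgroup X by exact: subg_gens.
have fX : fin_mod infheight X.
  apply: fin_mod_subr (fin_mod_gens_torsion (x :: s) sR) => y Xy; split=> //.
  by have [n [n0 yn]] := ord_ex perV y; exists n => //; rewrite yn; exact: subg0.
have [y [Ly S'y] ny] : exists2 y, (L `&` S') y & ~ X (y *+ p ^ e).
  apply: contrapT => h; apply: (unbounded_socle unb (e := e)); rewrite socle_layer.
  apply: fin_mod_trans fX _.
  apply: fin_mod_multiples (fin_modI sL sS' (subg_layer _) fL _) _.
    by apply: fin_mod_subr fS'; exact: layer_pprim.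
  move=> y [_ LSy]; apply: contrapT => ny; apply: h; exists y => //.
have [_ ye] := LS y Ly.
have xe1 : x *+ p ^ e.+1 = 0 by rewrite expnSr mulrnA xe mul0rn.
exists (x + y); split; first exact: subgD.
  by rewrite endoD (hL y Ly) addr0.
move=> g c Gg hR.
have Xx : X x by apply: gens_mem => //; rewrite mem_head.
have Xg : X g.
  apply: gens_subseq Gg => //; first by move=> _ ->; exact: subg0.
  by move=> z zs; rewrite in_cons zs orbT.
have Xyc : X (y *~ c).
  have -> : y *~ c = (g + (x + y) *~ c) - g - x *~ c by rewrite mulrzDl; abel.
  apply: subgB => //; last exact: subgMz.
  by apply: subgB => //; apply: gens_sub.
have /dvdnP[u uE] : (p ^ e.+1 %| `|c|)%N.
  apply: contrapT => /negP ndv; apply: ny; move/(subg_abs _ _ sX): Xyc => Xyc.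
  by apply: (subg_pdiv (M := e.+1) pp sX _ Xyc ndv); rewrite ye; exact: subg0.
apply/(subg_abs (x + y) c (@subg_set0 V)).
by rewrite /= uE mulnC mulrnA mulrnDl xe1 ye addr0 mul0rn.
Qed.

(** Let R be the group of the elements of infinite height of the p-component S. Since S/R is
    residually finite, phi is a scalar beta modulo R on a subgroup of finite index. If S/R is
    unbounded, phi - beta is finite. Otherwise R = p^n S is divisible and phi is a scalar alpha
    on it. If R has infinite socle, alpha and the scalar on the layer of the elements killed by
    p^n must agree, since they agree on the infinite intersection of this layer with R. In the
    remaining case S is the sum of R, of finite rank, and of a bounded group, and if the latter
    is infinite, phi may be two different scalars on the two summands. *)
Theorem pprim_structure phi : inertial phi ->
  exists alpha,
    finite_set ((phi - jact perV alpha) @` pprim) \/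
    exists k, let D := multiples pprim (p ^ k) in
      [/\ forall x, D x -> multiples D p x, finite_set [set x | D x /\ x *+ p = 0],
          exists2 x, D x & x <> 0, ~ fin_mod D pprim
        & (forall x, D x -> phi x = jact perV alpha x) /\
          exists beta, fin_mod D ((phi - jact perV beta) @` pprim)].
Proof.
move=> hp; have sR := subg_infheight; have sS := subg_pprim; have s0 := @subg_set0 V.
have inertial_jact alpha : inertial (jact perV alpha).
  apply: inertial_stable => H sH x Hx; have [c ->] := jact_nat perV alpha x; exact: subgMn.
have inertial_sub alpha : inertial (phi - jact perV alpha) by exact: inertialB.
have [|||S' [sS' [RS' S'S] fS' hS']] := inertial_resid_finite hp perV sR sS infheight_sub.
- by move=> x; exact: pprim_endo.
- by move=> x; exact: infheight_endo.
- move=> x Sx /existsNP[n nx].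
  have [||K [sK nK fK Kx]] := bounded_resid_finite (k := n) pp
      (subg_multiples (p ^ n) sS) sS _ _ Sx nx.
  + exact: multiples_sub.
  + by move=> y Sy; exists y.
  by exists K; split=> // y hy; apply: nK; exact: hy.
have [|beta hbeta] := scalar_padic perV (p := p) sR sS' _ hS'.
  by move=> y /S'S/pprimP.
have [[n nR]|unb] := pselect (exists n, multiples pprim (p ^ n) `<=` infheight); last first.
  exists beta; left; apply: (unbounded_inertial_finite _ _ sS') => //.
  by move=> n h; apply: unb; exists n.
set D := multiples pprim (p ^ n) in nR.
have sD : subgroup D by exact: subg_multiples.
have DS : D `<=` pprim by exact: multiples_sub.
have RD : infheight `<=` D by move=> x; apply.
have Ddiv x : D x -> multiples D p x.
  move=> /nR /(_ n.+1)[y Sy <-]; exists (y *+ p ^ n); first by exists y.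
  by rewrite -mulrnA -expnSr.
have Dp x : D x -> exists k, x *+ p ^ k = 0 by move=> /DS/pprimP.
have [|alpha halpha] := scalar_padic perV (p := p) (phi := phi) s0 sD Dp.
  move=> y Dy; apply: sumset_subr => //; exact: (inertial_divisible perV pp hp sD).
have phiD x : D x -> phi x = jact perV alpha x by move=> /halpha/subr0_eq.
have fDbeta : fin_mod D ((phi - jact perV beta) @` pprim).
  by apply: fin_mod_imageW fS' _ => x S'x; apply/RD/hbeta.
have [fsoc|infsoc] := pselect (finite_set [set x | D x /\ x *+ p = 0]).
  have [fDS|nfDS] := pselect (fin_mod D pprim).
    exists alpha; left; apply: fin_mod_fin fDS _ => x Dx.
    by rewrite endoBE phiD // subrr.
  have [[x Dx x0]|D0] := pselect (exists2 x, D x & x <> 0); last first.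
    exists beta; left; apply/fin_mod0; apply: fin_mod_subl fDbeta => x Dx.
    by apply: contrapT => x0; apply: D0; exists x.
  exists alpha; right; exists n; split=> //; first by exists x.
  by split=> //; exists beta.
exists alpha; left.
have [L [c [sL LS fL hL]]] := inertial_layer n hp.
have scal x : torsion_layer n x -> jact perV alpha x = x *+ jrep alpha (p ^ n).
  by move=> [_ xn]; rewrite (jactE _ _ _ xn).
have cE : c = jrep alpha (p ^ n) %[mod p ^ n].
  case en : n => [|m]; first by rewrite !modn1.
  apply: contrapT => ne; apply: infsoc; apply/fin_mod0.
  pose K := (torsion_layer n `&` D) `&` (L `&` (torsion_layer n `&` D)).
  have sI : subgroup (torsion_layer n `&` D) by apply: subgI => //; exact: subg_layer.
  have fK : fin_mod K (torsion_layer n `&` D).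
    by apply: fin_modI => //; [apply: fin_mod_subr fL => x [] | exact: fin_mod_self].
  have Km x : K x -> x *+ p ^ m = 0.
    move=> [[Tx Dx] [Lx _]]; have [_ xn] := Tx.
    have e : x *+ c = x *+ jrep alpha (p ^ n) by rewrite -hL // phiD // scal.
    have dif a b : (a <= b)%N -> x *+ a = x *+ b -> b <> a %[mod p ^ m.+1] -> x *+ p ^ m = 0.
      move=> ab eab nab; apply: (subg_pdiv (M := n) (c := b - a) pp s0 xn).
        by rewrite /= mulrnBr // eab subrr.
      by apply/negP; rewrite -eqn_mod_dvd // => /eqP.
    have [le|/ltnW le] := leqP c (jrep alpha (p ^ n)).
      by apply: (dif _ _ le e); rewrite en => /esym.
    by apply: (dif _ _ le (esym e)); rewrite en.
  apply: fin_mod_subr (fin_mod_multiples fK Km) => x [Dx xp].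
  have [y Dy ey] := pdivisible_pow Ddiv m Dx; exists y => //; split=> //; split; first exact: DS.
  by rewrite en expnSr mulrnA ey.
have Lc x : L x -> phi x = jact perV alpha x.
  move=> Lx; have [_ xn] := LS x Lx.
  by rewrite hL // scal; [exact: mulrn_eqmod xn cE | exact: LS].
have fT : finite_set ((phi - jact perV alpha) @` torsion_layer n).
  by apply: fin_mod_fin fL _ => x Lx; rewrite endoBE Lc // subrr.
apply: sub_finite_set fT => _ [x Sx <-].
have [d Dd ed] : multiples D (p ^ n) (x *+ p ^ n) by apply: pdivisible_pow => //; exists x.
exists (x - d).
  split; first exact: subgB sS Sx (DS _ Dd).
  by rewrite mulrnBl ed subrr.
by rewrite endoB [X in _ - X]endoBE phiD // subrr subr0.
Qed.

End PComponent.
Arguments pprim : clear implicits.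

Section PeriodicGroup.
Variable V : zmodType.
Hypothesis perV : periodic [set: V].
Implicit Types (phi : endo V).

Lemma jact_comm alpha phi x : phi (jact perV alpha x) = jact perV alpha (phi x).
Proof.
have [n [n0 xn]] := ord_ex perV x; rewrite (jactE _ _ n0 xn) endoMn.
by rewrite (jactE _ _ n0) // -endoMn xn endo0.
Qed.

Lemma inertial_jact alpha : inertial (jact perV alpha).
Proof.
by apply: inertial_stable => H sH x Hx; have [c ->] := jact_nat perV alpha x; exact: subgMn.
Qed.

Lemma almost_all_primes phi : inertial phi ->
  finite_set [set q : primeT | exists2 x, pprim V q x & ~ cyc x (phi x)].
Proof.
move=> hp; apply: contrapT => inf; set bad := [set q | _] in inf.
have step (s : seq primeT) : exists q, bad q /\ q \notin s.
  apply: contrapT => h; apply: inf; apply: sub_finite_set (finite_seq s) => q bq.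
  by apply: contrapT => /negP nq; apply: h; exists q.
have [q hq] := seq_choice step.
have qinj i j : (i < j)%N -> q i <> q j.
  move=> ij e; have [_ /negP] := hq j; apply; rewrite -e; apply: map_f.
  by rewrite mem_iota.
have [x hx] := choice (fun i => let: conj (ex_intro2 x a b) _ := hq i in
  ex_intro (fun x => pprim V (q i) x /\ ~ cyc x (phi x)) x (conj a b)).
have [i [j [N [ij hN]]]] := inertial_seq x hp (@subg_set0 V).
pose e : padics := fun r => if r == q j then 1 else 0.
have ex k : jact perV e (x k) = if q k == q j then x k else 0.
  have [/pprimP[m xm] _] := hx k; case: eqP => [eq|ne].
    rewrite -[RHS](jact1 perV); apply: (@jact_pprim_eq _ perV _ _ (q k) _ m _ xm).
    by rewrite /e eq eqxx.
  rewrite -[RHS](jact0 perV (x k)); apply: (@jact_pprim_eq _ perV _ _ (q k) _ m _ xm).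
  by rewrite /e; case: eqP.
have sub : gens [set 0] (mkseq x N) `<=` jact perV e @^-1` cyc (x j).
  apply: gens_min.
  - exact/subg_preim/subg_cyc.
  - by move=> _ ->; rewrite /preimage /mkset endo0; exact: subg0 (subg_cyc _).
  - move=> y /mapP[k _ ->]; rewrite /preimage /mkset ex.
    case: eqP => [eq|_]; last exact: subg0 (subg_cyc _).
    have [->|kj] := eqVneq k j; first exact: cyc_id.
    by move: kj; rewrite neq_ltn => /orP[] /qinj; rewrite eq.
have [_] := hx j; apply; have := sub _ hN.
rewrite /preimage /mkset endoB -!jact_comm !ex eqxx.
by case: eqP => [/(qinj _ _ ij)//|_]; rewrite endo0 subr0.
Qed.

(** At all but finitely many primes phi preserves every cyclic subgroup of the component, and
    the scalars found there are the components of one alpha. *)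
Lemma almost_all_scalar phi : inertial phi -> exists alpha,
  finite_set [set q : primeT | exists2 x, pprim V q x & phi x <> jact perV alpha x].
Proof.
move=> hp; have h (q : primeT) : exists alpha : padics,
    (forall x, pprim V q x -> cyc x (phi x)) ->
    forall x, pprim V q x -> phi x = jact perV alpha x.
  have [g|] := pselect (forall x, pprim V q x -> cyc x (phi x)); last by exists 0.
  have [||alpha ha] := scalar_padic perV (p := q) (phi := phi) (@subg_set0 V) (subg_pprim V q).
  - by move=> y /pprimP.
  - by move=> y /g; apply: sumset_subr.
  - by exists alpha => _ x /ha/subr0_eq.
have [f fE] := choice h.
exists (fun q => f q q); apply: sub_finite_set (almost_all_primes hp) => q [x Sx ne].
apply: contrapT => g; apply: ne.
have /pprimP[k xk] := Sx; rewrite (fE q) //.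
  exact: jact_pprim_eq xk.
by move=> y Sy; apply: contrapT => ny; apply: g; exists y.
Qed.

End PeriodicGroup.

(** * Torsion-free rank *)

Section Rank.
Variable A : zmodType.
Implicit Types (phi : endo A) (x y : A) (s : seq A) (F : set A).

Definition tors : set A := [set` torsion A].

Lemma subg_tors : subgroup tors. Proof. exact: subg_zmod. Qed.

Lemma torsP x : tors x <-> exists2 n, (0 < n)%N & x *+ n = 0.
Proof. exact: torsionP. Qed.

Lemma tors_div x n : (0 < n)%N -> tors (x *+ n) -> tors x.
Proof.
move=> n0 /torsP[m m0 e]; apply/torsP; exists (n * m)%N; first by rewrite muln_gt0 n0.
by rewrite mulrnA.
Qed.

Lemma tors_divz x (c : int) : c != 0 -> tors (x *~ c) -> tors x.
Proof. by move=> c0 /(subg_abs _ _ subg_tors); apply: tors_div; rewrite absz_gt0. Qed.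

Lemma tors_endo phi x : tors x -> tors (phi x).
Proof. by move=> /torsP[n n0 e]; apply/torsP; exists n => //; rewrite -endoMn e endo0. Qed.

(** The pure closure of the subgroup generated by s. *)
Definition isolator s : set A := [set x | exists2 n, (0 < n)%N & gens tors s (x *+ n)].

Lemma isolator_divz s x (c : int) : c != 0 -> gens tors s (x *~ c) -> isolator s x.
Proof.
move=> c0 /(subg_abs _ _ (subg_gens s subg_tors)) h.
by exists `|c|%N => //; rewrite absz_gt0.
Qed.

Lemma subg_isolator s : subgroup (isolator s).
Proof.
have sG := subg_gens s subg_tors; split.
  by exists 1%N => //; rewrite mul0rn; exact: subg0.
move=> x y [n n0 xn] [m m0 ym]; exists (n * m)%N; first by rewrite muln_gt0 n0.
rewrite mulrnBl; apply: subgB => //; first by rewrite mulrnA; exact: subgMn.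
by rewrite mulnC mulrnA; exact: subgMn.
Qed.

Lemma inertial_multiple phi x : inertial phi ->
  exists (n : nat) (m : int), (0 < n)%N /\ phi x *+ n = x *~ m.
Proof.
move=> hp; have [i [j [N [ij h]]]] := inertial_seq (fun k => x *+ k) hp (@subg_set0 A).
have [|||m _ e] := @gens_min _ [set 0] (mkseq (fun k => x *+ k) N) (cyc x) _ _ _ _ h.
- exact: subg_cyc.
- by move=> _ ->; exact: subg0 (subg_cyc x).
- by move=> y /mapP[k _ ->]; exists k.
exists (j - i)%N, m; split; first by rewrite subn_gt0.
by rewrite e !endoMn mulrnBr // ltnW.
Qed.

(** An inertial endomorphism acts on A/T(A) as a rational number: proportionality factors of
    independent elements are equal since their sum has one. *)
Lemma inertial_proportional phi : inertial phi ->
  exists (n : nat) (m : int), (0 < n)%N /\ forall y, tors (phi y *+ n - y *~ m).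
Proof.
move=> hp; have sT := subg_tors.
have [perA|/existsNP[x0 nx0]] := pselect (forall x, tors x).
  by exists 1%N, 0; split=> // y; exact: perA.
have [n0 [m0 [n0_gt0 e0]]] := inertial_multiple x0 hp.
exists n0, m0; split=> // y.
have [[a [b [b0 h]]]|ind] := pselect (exists a b : int, b != 0 /\ tors (x0 *~ a - y *~ b)).
  apply: (tors_divz b0).
  have -> : (phi y *+ n0 - y *~ m0) *~ b =
      (x0 *~ a - y *~ b) *~ m0 - phi (x0 *~ a - y *~ b) *+ n0.
    rewrite endoB !endoMz mulrnBl !mulrzBl [x0 *~ a *~ m0]mulrzAC -e0.
    rewrite !pmulrn [y *~ m0 *~ b]mulrzAC [phi x0 *~ n0 *~ a]mulrzAC [phi y *~ n0 *~ b]mulrzAC.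
    abel.
  by apply: subgB => //; [exact: subgMz | apply: subgMn => //; apply: tors_endo].
have ind' (a b : int) : tors (x0 *~ a - y *~ b) -> a = 0 /\ b = 0.
  move=> h; have b0 : b = 0 by apply/eqP; apply: contrapT => b0; apply: ind; exists a, b; split=> //; exact/negP.
  split=> //; apply/eqP; apply: contrapT => /negP a0; apply: nx0; apply: (tors_divz a0).
  by move: h; rewrite b0 mulr0z subr0.
have [n1 [m1 [n1_gt0 e1]]] := inertial_multiple y hp.
have [n [m [n_gt0 e]]] := inertial_multiple (x0 + y) hp.
have [] := ind' (m0 * (n * n1)%N%:Z - m * (n0 * n1)%N%:Z) (m * (n0 * n1)%N%:Z - m1 * (n * n0)%N%:Z).
  have -> : x0 *~ (m0 * (n * n1)%N%:Z - m * (n0 * n1)%N%:Z) -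
      y *~ (m * (n0 * n1)%N%:Z - m1 * (n * n0)%N%:Z) = 0.
    rewrite !mulrzBr !mulrzA -e0 -e1.
    have := congr1 (fun z => z *+ (n0 * n1)) e.
    rewrite endoD mulrzDl !mulrnDl -!pmulrn -!mulrnA.
    have -> : (n0 * (n * n1) = n * (n0 * n1))%N by lia.
    have -> : (n1 * (n * n0) = n * (n0 * n1))%N by lia.
    set a := phi x0 *+ _; set b := phi y *+ _; set c := x0 *~ m *+ _; set d := y *~ m *+ _.
    move=> e2; have -> : a - c - (d - b) = (a + b) - (c + d) by abel.
    by rewrite e2 subrr.
  exact: subg0.
move=> h1 h2.
have nn : ((n * n1)%N%:Z : int) != 0 by rewrite eqz_nat; lia.
apply: (tors_divz nn); apply/torsP; exists 1%N => //.
rewrite mulr1n mulrzBl pmulrn -!mulrzA.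
have -> : phi y *~ (n0%:Z * (n * n1)%N%:Z) = y *~ (m1 * (n * n0)%N%:Z).
  rewrite [n0%:Z * _]mulrC.
  have -> : ((n * n1)%N%:Z * n0%:Z = n1%:Z * (n * n0)%N%:Z)%R by rewrite !PoszM; lia.
  have e1' : phi y *~ n1%:Z = y *~ m1 by rewrite -pmulrn.
  by rewrite mulrzA e1' -mulrzA.
rewrite -mulrzBr; suff -> : m1 * (n * n0)%N%:Z - m0 * (n * n1)%N%:Z = 0 by [].
by move/subr0_eq: h1 => ->; move/subr0_eq: h2 => ->; rewrite subrr.
Qed.

Lemma gens_sumP s K x : subgroup K -> gens K s x <->
  exists c : nat -> int, K (x - \sum_(i < size s) s`_i *~ c i).
Proof.
move=> sK; split; last first.
  move=> [c h]; have sG := subg_gens s sK.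
  apply: (subg_sub sG (gens_sub s h)).
  apply: (big_ind (gens K s)); [exact: subg0 | move=> u v; exact: subgD|].
  by move=> i _; apply: subgMz => //; apply: gens_mem => //; exact: mem_nth.
elim/last_ind: s x => [|s y IH] x; first by move=> h; exists (fun=> 0); rewrite big_ord0 subr0.
rewrite gens_rcons => -[g Gg [_ [d _ <-] <-]]; have [c hc] := IH g Gg.
exists (fun i => if i == size s then d else c i).
rewrite size_rcons big_ord_recr /= eqxx nth_rcons ltnn eqxx.
have -> : \sum_(i < size s) (rcons s y)`_i *~ (if (i : nat) == size s then d else c i) =
    \sum_(i < size s) s`_i *~ c i.
  by apply: eq_bigr => i _; rewrite nth_rcons ltn_ord ltn_eqF.
by rewrite opprD addrACA subrr addr0.
Qed.

(** A rational matrix with more rows than columns has a nonzero left kernel vector, whose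
    denominators can be cleared. *)
Lemma int_left_kernel k l (c : nat -> nat -> int) : (l < k)%N ->
  exists2 m : nat -> int, exists2 j, (j < k)%N & m j != 0 &
    forall i, (i < l)%N -> \sum_(j < k) m j * c j i = 0.
Proof.
move=> lk; pose M : 'M[rat]_(k, l) := \matrix_(i, j) (c i j)%:~R.
have : kermx M != 0.
  rewrite -mxrank_eq0 mxrank_ker subn_eq0 -ltnNge.
  exact: leq_ltn_trans (rank_leq_col M) lk.
move=> /rowV0Pn[v /sub_kermxP vM v0].
have [j0 vj0] : exists j, v 0 j != 0.
  apply/existsP; apply: contraNT v0 => /existsPn h; apply/eqP/rowP => j; rewrite mxE.
  by apply/eqP; rewrite -[_ == _]negbK h.
pose d : int := \prod_(j < k) denq (v 0 j).
have hd j : exists z : int, z%:~R = v 0 j * d%:~R.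
  exists (numq (v 0 j) * \prod_(j' < k | j' != j) denq (v 0 j')).
  have -> : d = denq (v 0 j) * \prod_(j' < k | j' != j) denq (v 0 j') by rewrite /d (bigD1 j).
  by rewrite !intrM mulrA numqE.
have [z zE] := choice hd.
have insubE (i : 'I_k) : insub (i : nat) = Some i by exact: valK.
exists (fun j => if insub j is Some i then z i else 0).
  exists (nat_of_ord j0) => //; rewrite insubE -(intr_eq0 rat) zE mulf_neq0 //.
  by rewrite intr_eq0 /d; apply/prodf_neq0 => j _; exact: denq_neq0.
move=> i il; apply/eqP; rewrite -(intr_eq0 rat); apply/eqP.
rewrite rmorph_sum /=.
have := congr1 (fun w : 'rV_l => w 0 (Ordinal il) * d%:~R) vM; rewrite !mxE mul0r => e; rewrite -[RHS]e.
rewrite mulr_suml; apply: eq_bigr => j _.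
by rewrite insubE mxE intrM zE mulrAC.
Qed.

Lemma tf_quot_mulz (z : {quot torsion A}) (c : int) : z *~ c = 0 -> z != 0 -> c = 0.
Proof.
have [x ->] := quot_surj z; rewrite -raddfMz => /quot_eq0 h nz.
apply/eqP; apply: contrapT => /negP c0; case/eqP: nz; apply/quot_eq0.
exact: tors_divz c0 h.
Qed.

Lemma infinite_rank_isolator s : ~ finite_tf_rank A -> exists x, ~ isolator s x.
Proof.
move=> inf; apply: contrapT => h; apply: inf; exists (size s) => t _ [t0 ind].
rewrite leqNgt; apply/negP => lt.
have hc j : exists nc : nat * (nat -> int), (0 < nc.1)%N /\
    t`_j *+ nc.1 = \sum_(i < size s) \pi_({quot torsion A})%qT s`_i *~ nc.2 i.
  have [x ->] := quot_surj t`_j.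
  have [n n0 /(gens_sumP _ _ subg_tors)[c hc]] : isolator s x.
    by apply: contrapT => nx; apply: h; exists x.
  exists (n, c); split=> //=; rewrite -raddfMn /=.
  have := hc => /quot_eq ->; rewrite raddf_sum /=.
  by apply: eq_bigr => i _; rewrite raddfMz.
have [nc hnc] := choice hc.
have [m [j jt mj] hm] := @int_left_kernel (size t) (size s) (fun j => (nc j).2) lt.
have sum0 : \sum_(j < size t) t`_j *~ (m j * (nc j).1%:Z) = 0.
  transitivity (\sum_(j < size t) \sum_(i < size s)
      \pi_({quot torsion A})%qT s`_i *~ (m j * (nc j).2 i)).
    apply: eq_bigr => i _; have [_ e] := hnc i.
    rewrite [m i * _]mulrC mulrzA -pmulrn e mulrz_suml.
    by apply: eq_bigr => i' _; rewrite [m i * _]mulrC mulrzA.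
  rewrite exchange_big big1 // => i _; rewrite -mulrz_sumr hm //.
have tj : t`_j != 0 by apply: contraNneq t0 => <-; exact: mem_nth.
have [n0 _] := hnc j; move/eqP: mj; apply.
have /eqP := tf_quot_mulz (ind (fun j => m j * (nc j).1%:Z) sum0 j jt) tj.
by rewrite mulf_eq0 => /orP[/eqP //|]; rewrite eqz_nat; lia.
Qed.

Definition tf_independent s : Prop := forall c : nat -> int,
  tors (\sum_(i < size s) s`_i *~ c i) -> forall i, (i < size s)%N -> c i = 0.

(** A maximal independent family in A/T(A), lifted to A. *)
Lemma finite_rank_basis : finite_tf_rank A ->
  exists2 s, tf_independent s & forall x, isolator s x.
Proof.
move=> [r hr].
pose P n := `[< exists t : seq {quot torsion A}, size t = n /\ independent t >].
have [|n Pn|n /asboolP[t [tn it]] maxn] := @ex_maxnP P r.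
- by exists 0%N; apply/asboolP; exists [::]; split=> //; split.
- by move: Pn => /asboolP[t [<- it]]; apply: hr.
pose s := map repr t.
have sz : size s = size t by rewrite size_map.
have nths i : (i < size t)%N -> \pi_({quot torsion A})%qT s`_i = t`_i.
  by move=> it'; rewrite (nth_map 0) // reprK.
have pisum (c : nat -> int) : \pi_({quot torsion A})%qT (\sum_(i < size s) s`_i *~ c i) =
    \sum_(i < size t) t`_i *~ c i.
  rewrite raddf_sum /= sz; apply: eq_bigr => i _; rewrite raddfMz /= nths //.
have [t0 ind] := it.
exists s => [c /quot_eq0|x].
  rewrite pisum => /ind h i; rewrite sz => lt.
  apply: (tf_quot_mulz (h i lt)); apply: contraNneq t0 => <-; exact: mem_nth.
have [Tx|nTx] := pselect (tors x).
  by exists 1%N => //; exact: gens_sub.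
have nind : ~ independent (\pi_({quot torsion A})%qT x :: t).
  move=> it'; have : P n.+1 by apply/asboolP; eexists; split; last exact: it'; rewrite /= tn.
  by move/maxn; rewrite ltnn.
apply: contrapT => nx; apply: nind; split.
  rewrite in_cons negb_or t0 andbT; apply/eqP => /esym/quot_eq0; exact: nTx.
move=> m; rewrite big_ord_recl /= => e.
have m0 : m 0%N = 0.
  apply/eqP; apply: contrapT => /negP m0; apply: nx; apply: (isolator_divz m0).
  apply/gens_sumP; first exact: subg_tors.
  exists (fun i => - m i.+1).
  apply/quot_eq0; rewrite raddfB /= (pisum (fun i => - m i.+1)) raddfMz /=.
  have -> : \sum_(i < size t) t`_i *~ (- m i.+1) = - \sum_(i < size t) t`_i *~ m i.+1.
    by rewrite -sumrN; apply: eq_bigr => i _; rewrite mulrNz.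
  by rewrite opprK -[RHS]e.
move: e; rewrite m0 mulr0z add0r => e [|i] /=; first by rewrite m0.
exact: (ind (fun i => m i.+1)).
Qed.

(** * Full lattices *)

(** These subgroups are free; what is used is that they are finitely generated, so that any two
    of them are commensurable. *)
Definition full_lattice F : Prop :=
  [/\ subgroup F, exists s, F = gens [set 0] s, forall x, F x -> tors x -> x = 0
    & forall x, exists2 n, (0 < n)%N & F (x *+ n)].

Lemma sum_seq_nth (G : A -> A) s : \sum_(x <- s) G x = \sum_(i < size s) G s`_i.
Proof. by rewrite (big_nth 0) big_mkord. Qed.

Lemma tf_independent_uniq s : tf_independent s -> uniq s.
Proof.
move=> ind; apply: contrapT => /negP/(uniqPn 0)[i [j [ij js e]]].
pose c k : int := (k == i)%:R - (k == j)%:R.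
have : c i = 0.
  apply: ind; last exact: ltn_trans js.
  suff -> : \sum_(k < size s) s`_k *~ c k = 0 by exact: subg0 subg_tors.
  have one l : (l < size s)%N -> \sum_(k < size s) s`_k *~ ((k : nat) == l)%:R = s`_l.
    move=> ls; rewrite (bigD1 (Ordinal ls)) //= eqxx big1 ?addr0 // => k.
    by rewrite -val_eqE /= => /negPf ->.
  under eq_bigr => k _ do rewrite mulrzBr.
  by rewrite big_split /= sumrN !one // ?e ?subrr // (ltn_trans ij).
by rewrite /c eqxx (ltn_eqF ij).
Qed.

Lemma tf_independent_size : finite_tf_rank A ->
  exists r, forall s, tf_independent s -> (size s <= r)%N.
Proof.
move=> [r hr]; exists r => s inds; have us := tf_independent_uniq inds.
rewrite -(size_map \pi_({quot torsion A})%qT); apply: hr => //; split.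
  apply/mapP => -[x xs /esym/quot_eq0 Tx].
  have : ((index x s == index x s)%:R : int) = 0.
    apply: (inds (fun i => (i == index x s)%:R)); last by rewrite index_mem.
    suff -> : \sum_(i < size s) s`_i *~ ((i : nat) == index x s)%:R = x by [].
    have xi : (index x s < size s)%N by rewrite index_mem.
    rewrite (bigD1 (Ordinal xi)) //= eqxx nth_index // big1 ?addr0 // => k.
    by rewrite -val_eqE /= => /negPf ->.
  by rewrite eqxx.
move=> m; rewrite size_map => e i lt; rewrite (inds m) ?mulr0z //.
apply/quot_eq0; rewrite raddf_sum -[RHS]e; apply: eq_bigr => j _.
by rewrite (nth_map 0) // raddfMz.
Qed.

Lemma tf_independent_mul s k : (0 < k)%N -> tf_independent s ->
  tf_independent [seq x *+ k | x <- s].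
Proof.
move=> k0 ind c; rewrite size_map => h i lt.
have : c i * k%:Z = 0.
  apply: (ind (fun i => c i * k%:Z)) => //.
  move: h; congr tors; apply: eq_bigr => j _; rewrite (nth_map 0) //.
  by rewrite pmulrn -mulrzA mulrC.
by move=> /eqP; rewrite mulf_eq0 eqz_nat (gtn_eqF k0) orbF => /eqP.
Qed.

Lemma isolator_mul s k x : (0 < k)%N -> isolator s x -> isolator [seq y *+ k | y <- s] x.
Proof.
move=> k0 [n n0 h]; exists (n * k)%N; first by rewrite muln_gt0 n0.
have sG := subg_gens [seq y *+ k | y <- s] subg_tors.
have : ((1 *+ k : endo A) @^-1` gens tors [seq y *+ k | y <- s]) (x *+ n).
  apply: gens_min h; first exact: subg_preim.
  - by move=> y Ty; rewrite /preimage /mkset endoMnE; apply: gens_sub; apply: subgMn => //; exact: subg_tors.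
  - move=> y ys; rewrite /preimage /mkset endoMnE; apply: gens_mem; first exact: subg_tors.
    exact: map_f.
by rewrite /preimage /mkset endoMnE mulrnA.
Qed.

Section Basis.
Variable s : seq A.
Hypotheses (ind : tf_independent s) (iso : forall x, isolator s x).

Lemma basis_full_lattice : full_lattice (gens [set 0] s).
Proof.
have s0 := @subg_set0 A; split; first exact: subg_gens.
- by exists s.
- move=> x /(gens_sumP _ _ s0)[c /subr0_eq ->] h.
  by rewrite big1 // => i _; rewrite ind ?mulr0z.
- move=> x; have [n n0 /(gens_sumP _ _ subg_tors)[c /torsP[N N0 e]]] := iso x.
  exists (n * N)%N; first by rewrite muln_gt0 n0.
  apply/gens_sumP => //; exists (fun i => c i * N%:Z).
  rewrite /= mulrnA -[RHS]e mulrnBl; congr (_ - _).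
  by rewrite -sumrMnl; apply: eq_bigr => i _; rewrite pmulrn -mulrzA.
Qed.

Lemma basis_free : free_abelian (gens [set 0] s).
Proof.
have s0 := @subg_set0 A; have us := tf_independent_uniq ind.
exists [set` s]; split.
- by move=> x xs; apply: gens_mem.
- move=> a /(gens_sumP _ _ s0)[c /subr0_eq ->]; exists s, (fun x => c (index x s)); split=> //.
  rewrite (sum_seq_nth (fun x => x *~ c (index x s))).
  by apply: eq_bigr => i _; rewrite index_uniq.
- move=> t m ut ts e x xt.
  have pe : perm_eq t [seq y <- s | y \in t].
    apply: uniq_perm => //; first exact: filter_uniq.
    by move=> y; rewrite mem_filter; case yt: (y \in t) => //=; apply/esym/ts.
  have xs : x \in s by exact: ts.
  pose c i := if s`_i \in t then m s`_i else 0.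
  have : c (index x s) = 0.
    apply: ind; last by rewrite index_mem.
    suff -> : \sum_(i < size s) s`_i *~ c i = 0 by exact: subg0 subg_tors.
    rewrite -[RHS]e (perm_big _ pe) big_filter [RHS]big_mkcond /=.
    rewrite (sum_seq_nth (fun x => if x \in t then x *~ m x else 0)).
    by apply: eq_bigr => i _; rewrite /c; case: ifP => // _; rewrite mulr0z.
  by rewrite /c nth_index // xt.
Qed.

End Basis.

Lemma free_full_lattice F : finite_tf_rank A -> subgroup F -> free_abelian F ->
  (forall x, exists2 n, (0 < n)%N & F (x *+ n)) -> full_lattice F.
Proof.
move=> /tf_independent_size[r hr] sF [X [XF gX indX]] per.
have ind s : uniq s -> (forall x, x \in s -> X x) -> tf_independent s.
  move=> us sX c /torsP[n n0 e] i lt.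
  have : c (index s`_i s) * n%:Z = 0.
    apply: (indX s (fun x => c (index x s) * n%:Z)) => //; last exact: mem_nth.
    rewrite (sum_seq_nth (fun x => x *~ (c (index x s) * n%:Z))) -[RHS]e -sumrMnl.
    by apply: eq_bigr => j _; rewrite index_uniq // pmulrn mulrzA.
  by rewrite index_uniq // => /eqP; rewrite mulf_eq0 eqz_nat (gtn_eqF n0) orbF => /eqP.
have bound s (us : uniq s) (sX : forall x, x \in s -> X x) := hr s (ind s us sX).
pose P n := `[< exists s, [/\ size s = n, uniq s & forall x, x \in s -> X x] >].
have [|n Pn|n /asboolP[s [sn us sX]] maxn] := @ex_maxnP P r.
- by exists 0%N; apply/asboolP; exists [::].
- by move: Pn => /asboolP[s [<- us sX]]; apply: bound.
have Xs x : X x -> x \in s.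
  move=> Xx; apply: contrapT => /negP nx.
  have : P n.+1.
    apply/asboolP; exists (x :: s); split; rewrite /= ?sn ?nx //.
    by move=> y; rewrite in_cons => /predU1P[->|/sX].
  by move/maxn; rewrite ltnn.
have s0 := @subg_set0 A.
have FE : F = gens [set 0] s.
  apply/seteqP; split=> [a /gX[t [m [tX ->]]]|].
    have sG := subg_gens s s0.
    rewrite big_seq; apply: (big_ind (gens [set 0] s)); [exact: subg0 | move=> u v; exact: subgD|].
    by move=> x /tX/Xs xs; apply: subgMz => //; exact: gens_mem.
  apply: gens_min => //; first by move=> _ ->; exact: subg0.
  by move=> x /sX/XF.
split=> //; first by exists s.
move=> x; rewrite FE => /(gens_sumP _ _ s0)[c /subr0_eq ->] h.
by rewrite big1 // => i _; rewrite (ind s us sX c) ?mulr0z.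
Qed.

Lemma full_lattice_fin_mod F F' : full_lattice F -> full_lattice F' -> fin_mod F' F.
Proof.
move=> [sF [s FE] _ _] [sF' _ _ per].
apply: fin_mod_subr (fin_mod_gens_torsion s sF') => x Fx; split=> //.
by move: Fx; rewrite FE; apply: gens_subseq => // _ ->; exact: subg0.
Qed.

(** The finitely many torsion elements phi x, for x in a basis, have a common annihilator k; the
    multiples k x form the required basis. *)
Lemma kernel_basis phi : finite_tf_rank A -> periodic (range phi) ->
  exists s, [/\ tf_independent s, forall x, isolator s x & forall x, x \in s -> phi x = 0].
Proof.
move=> /finite_rank_basis[s ind iso] per.
have [k k0 hk] : exists2 k, (0 < k)%N & forall x, x \in s -> phi x *+ k = 0.
  elim: s {ind iso} => [|x s [k k0 hk]]; first by exists 1%N.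
  have /torsP[n n0 xn] : tors (phi x) by apply: per; exists x.
  exists (n * k)%N; first by rewrite muln_gt0 n0.
  move=> y; rewrite in_cons => /predU1P[->|/hk e]; first by rewrite mulrnA xn mul0rn.
  by rewrite mulnC mulrnA e mul0rn.
exists [seq x *+ k | x <- s]; split; first exact: tf_independent_mul.
- by move=> x; exact: isolator_mul.
- by move=> _ /mapP[y ys ->]; rewrite endoMn; exact: hk.
Qed.

Lemma gens_kernel phi s : (forall x, x \in s -> phi x = 0) ->
  forall x, gens [set 0] s x -> phi x = 0.
Proof.
move=> hs x h; have : (phi @^-1` [set 0]) x by
  apply: gens_min h; [exact/subg_preim/subg_set0 |
    by move=> _ ->; rewrite /preimage /mkset /= endo0 | by move=> y /hs].
by [].
Qed.

Lemma lattice_in_kernel phi : finite_tf_rank A -> periodic (range phi) ->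
  exists F, [/\ full_lattice F, free_abelian F & forall x, F x -> phi x = 0].
Proof.
move=> fr per; have [s [ind iso hs]] := kernel_basis fr per.
exists (gens [set 0] s); split; [exact: basis_full_lattice | exact: basis_free |].
exact: gens_kernel.
Qed.

End Rank.
Arguments tors : clear implicits.

(** * Uniform endomorphisms *)

Lemma subg_eqmod (V : zmodType) (F : set V) a n x y : subgroup F -> F (a *+ n) ->
  x = y %[mod n] -> F (a *+ x - a *+ y).
Proof.
move=> sF Fn e; rewrite (divn_eq x n) (divn_eq y n) e !mulrnDr opprD addrACA subrr addr0.
by rewrite ![(_ * n)%N]mulnC !mulrnA; apply: subgB => //; exact: subgMn.
Qed.

Lemma fin_mod_multiple (V : zmodType) (K S : set V) x : subgroup K -> subgroup S ->
  fin_mod K S -> S x -> exists2 n, (0 < n)%N & K (x *+ n).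
Proof.
move=> sK sS [X fX h] Sx.
have [r hr] := choice (fun n => let: ex_intro2 r a b := h _ (subgMn n sS Sx) in
  ex_intro (fun r => X r /\ K (x *+ n - r)) r (conj a b)).
have [i [j [ij e]]] := pigeonhole_nat fX (fun n => (hr n).1).
exists (j - i)%N; first by rewrite subn_gt0.
rewrite mulrnBr ?(ltnW ij) //; apply: (subg_trans sK (hr j).2).
by rewrite -e; apply: subg_subC => //; exact: (hr i).2.
Qed.

Section Agree.
Variables (A : zmodType) (F : set A).
Hypotheses (sF : subgroup F) (perF : forall x, exists2 n, (0 < n)%N & F (x *+ n)).
Implicit Types (phi psi : endo A) (alpha beta : padics).

(** If a has order n modulo F, alpha multiplies a + F by its residue modulo n; letting n range
    over all annihilators avoids the choice of the order. *)
Definition agree phi alpha : set A :=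
  [set a | forall n, (0 < n)%N -> F (a *+ n) -> F (phi a - a *+ jrep alpha n)].

Lemma agree1 phi alpha a n : (0 < n)%N -> F (a *+ n) ->
  F (phi a - a *+ jrep alpha n) -> agree phi alpha a.
Proof.
move=> n0 Fn h m m0 Fm; have nm0 : (0 < n * m)%N by rewrite muln_gt0 n0.
apply: (subg_trans sF h).
apply: (@subg_trans _ _ _ (a *+ jrep alpha (n * m)) _ sF).
  by apply: subg_eqmod Fn _ => //; apply/esym/jrep_dvd => //; exact: dvdn_mulr.
by apply: subg_eqmod Fm _ => //; apply/jrep_dvd => //; exact: dvdn_mull.
Qed.

Lemma agreeB phi psi alpha beta a : agree phi alpha a -> agree psi beta a ->
  agree (phi - psi) (alpha - beta) a.
Proof.
move=> h1 h2 n n0 Fn.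
have e : F (a *+ (jrep (alpha - beta) n + jrep beta n) - a *+ jrep alpha n).
  by apply: subg_eqmod Fn _ => //; rewrite jrepD // subrK.
have -> : (phi - psi) a - a *+ jrep (alpha - beta) n =
    (phi a - a *+ jrep alpha n) - (psi a - a *+ jrep beta n)
    - (a *+ (jrep (alpha - beta) n + jrep beta n) - a *+ jrep alpha n).
  by rewrite endoBE mulrnDr; abel.
apply: subgB => //; apply: subgB => //; [exact: h1 | exact: h2].
Qed.

Lemma agreeM phi psi alpha beta a : agree psi beta a -> agree phi alpha (psi a) ->
  agree (phi * psi) (alpha * beta) a.
Proof.
move=> h2 h1 n n0 Fn; have e2 := h2 n n0 Fn.
have Fpn : F (psi a *+ n).
  rewrite -(subrK (a *+ jrep beta n) (psi a)) mulrnDl; apply: subgD => //; first exact: subgMn.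
  by rewrite mulrnAC; exact: subgMn.
have e1 := h1 n n0 Fpn.
rewrite endoME; apply: (subg_trans sF e1).
apply: (@subg_trans _ _ _ (a *+ jrep beta n *+ jrep alpha n) _ sF).
  by rewrite -mulrnBl; exact: subgMn.
rewrite -mulrnA; apply: subg_eqmod Fn _ => //; rewrite mulnC; exact: jrepM.
Qed.

Lemma subg_agree phi alpha : subgroup (agree phi alpha).
Proof.
split.
  move=> n n0 _; rewrite endo0 mul0rn subrr; exact: subg0.
move=> x y hx hy; have [n n0 Fn] := perF x; have [m m0 Fm] := perF y.
have nm0 : (0 < n * m)%N by rewrite muln_gt0 n0.
have Fx : F (x *+ (n * m)) by rewrite mulrnA; exact: subgMn.
have Fy : F (y *+ (n * m)) by rewrite mulnC mulrnA; exact: subgMn.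
apply: (agree1 nm0); first by rewrite mulrnBl; exact: subgB.
have -> : phi (x - y) - (x - y) *+ jrep alpha (n * m) =
  (phi x - x *+ jrep alpha (n * m)) - (phi y - y *+ jrep alpha (n * m)).
  by rewrite endoB mulrnBl; abel.
by apply: subgB => //; [exact: hx | exact: hy].
Qed.

Lemma agree_sub phi alpha : (forall x, F x -> phi x = 0) -> F `<=` agree phi alpha.
Proof.
move=> h x Fx; apply: (agree1 (n := 1)) => //.
by apply: subgB => //; [rewrite h //; exact: subg0 | exact: subgMn].
Qed.

Definition unif phi alpha : Prop := fin_mod (agree phi alpha) [set: A].

Lemma unifB phi psi alpha beta : unif phi alpha -> unif psi beta ->
  unif (phi - psi) (alpha - beta).
Proof.
move=> h1 h2; have := fin_modI (subg_agree _ _) (subg_agree _ _) (@subgT A) h1 h2.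
by apply: fin_mod_subl => x [_ [a1 a2]]; exact: agreeB.
Qed.

Lemma unifM phi psi alpha beta : unif phi alpha -> unif psi beta ->
  unif (phi * psi) (alpha * beta).
Proof.
move=> h1 h2.
have h1' : fin_mod ([set: A] `&` psi @^-1` agree phi alpha) [set: A].
  apply: fin_mod_preim => //; first exact: subg_agree.
  exact: fin_mod_subr h1.
have sP : subgroup ([set: A] `&` psi @^-1` agree phi alpha).
  by apply: subgI => //; apply: subg_preim; exact: subg_agree.
have := fin_modI sP (subg_agree _ _) (@subgT A) h1' h2.
by apply: fin_mod_subl => x [_ [[_ a1] a2]]; exact: agreeM.
Qed.

Lemma unif_fin phi : finite_set (range phi) -> unif phi 0.
Proof.
move=> fp; have : fin_mod ([set: A] `&` phi @^-1` [set 0]) [set: A].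
  apply: fin_mod_preim => //; first exact: subg_set0.
  exact/fin_mod0.
apply: fin_mod_subl => a [_ /= e] n n0 Fn; rewrite e sub0r; apply: subgN => //.
have := subg_eqmod sF Fn (jrepD 0 0 n0); rewrite addr0 mulrnDr addrK.
by [].
Qed.

Lemma fin_unif phi : (forall x, F x -> tors A x -> x = 0) -> periodic (range phi) ->
  unif phi 0 -> finite_set (range phi).
Proof.
move=> FT per h; apply/fin_mod0; apply: fin_mod_imageW h _ => a ha /=.
apply: FT; last by apply: per; exists a.
have [n n0 Fn] := perF a; apply: (subg_sub sF (ha n n0 Fn)).
have := subg_eqmod sF Fn (jrepD 0 0 n0); rewrite addr0 mulrnDr addrK.
by [].
Qed.

End Agree.

Lemma unif_change (A : zmodType) (F F' : set A) phi alpha : full_lattice F -> full_lattice F' ->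
  unif F phi alpha -> unif F' phi alpha.
Proof.
move=> lF lF' h; have [sF _ _ perF] := lF; have [sF' _ _ perF'] := lF'.
have hn a : exists n, [/\ (0 < n)%N, F (a *+ n) & F' (a *+ n)].
  have [n n0 Fn] := perF a; have [m m0 Fm] := perF' a.
  exists (n * m)%N; rewrite muln_gt0 n0 m0; split=> //; first by rewrite mulrnA; exact: subgMn.
  by rewrite mulnC mulrnA; exact: subgMn.
have [f fE] := choice hn; pose g a := phi a - a *+ jrep alpha (f a).
apply: fin_mod_trans h; apply: (@fin_mod_refine _ _ F' g) => //.
  have [X fX hX] := full_lattice_fin_mod lF lF'; exists X => // x Kx; apply: hX.
  by have [n0 Fn _] := fE x; exact: Kx.
apply: fin_mod_self; first exact: subg_agree.
move=> _ [x [y [_ _ e ->]]].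
have [n0 _ Fn] := fE x; have [m0 _ Fm] := fE y.
have nm0 : (0 < f x * f y)%N by rewrite muln_gt0 n0.
apply: (agree1 sF' nm0).
  rewrite mulrnBl; apply: subgB => //; first by rewrite mulrnA; exact: subgMn.
  by rewrite mulnC mulrnA; exact: subgMn.
have e1 : F' (x *+ jrep alpha (f x * f y) - x *+ jrep alpha (f x)).
  by apply: subg_eqmod Fn _ => //; apply/jrep_dvd => //; exact: dvdn_mulr.
have e2 : F' (y *+ jrep alpha (f x * f y) - y *+ jrep alpha (f y)).
  by apply: subg_eqmod Fm _ => //; apply/jrep_dvd => //; exact: dvdn_mull.
have -> : phi (x - y) - (x - y) *+ jrep alpha (f x * f y) = (g x - g y)
    - (x *+ jrep alpha (f x * f y) - x *+ jrep alpha (f x))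
    + (y *+ jrep alpha (f x * f y) - y *+ jrep alpha (f y)).
  by rewrite endoB mulrnBl /g; abel.
by apply: subgD => //; apply: subgB.
Qed.

Section QuotientAction.
Variables (A : zmodType) (F : zmodClosed A).
Implicit Types (phi : endo A).
Local Notation pi := (\pi_({quot F})%qT).

Lemma quot_periodic : periodic [set: {quot F}] <->
  forall x, exists2 n, (0 < n)%N & [set` F] (x *+ n).
Proof.
split=> [per x|h z _].
  have /torsionP[n n0 e] := per (pi x) I.
  by exists n => //; apply/quot_eq0; rewrite raddfMn.
have [x ->] := quot_surj z; have [n n0 Fn] := h x.
by apply/torsionP; exists n => //; rewrite -raddfMn; apply/quot_eq0.
Qed.

Lemma quot_endo phi : (forall x, x \in F -> phi x \in F) ->
  exists psi : endo {quot F}, forall x, psi (pi x) = pi (phi x).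
Proof.
move=> h; pose f (z : {quot F}) : {quot F} := pi (phi (repr z)).
have fE x : f (pi x) = pi (phi x).
  apply/quot_eq; rewrite -endoB; apply: h; apply/quot_eq; exact: reprK.
have f_endo : is_endo f.
  apply/asboolP => z t; have [x ->] := quot_surj z; have [y ->] := quot_surj t.
  by rewrite -raddfD !fE endoD raddfD.
by exists (Endo f_endo).
Qed.

Lemma quot_inertial phi (psi : endo {quot F}) : (forall x, psi (pi x) = pi (phi x)) ->
  inertial phi -> inertial psi.
Proof.
move=> h /inertialP hp; apply/inertialP => H sH.
have sP : subgroup (pi @^-1` H) by exact: subg_preim.
have := fin_mod_image pi (hp _ sP).
move=> /(fin_mod_subl (K' := H)) h1; have {}h1 : fin_mod H (pi @` (phi @` (pi @^-1` H))).
  by apply: h1 => _ [x Hx <-].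
apply: fin_mod_subr h1 => _ [z Hz <-]; have [x e] := quot_surj z; exists (phi x); last by rewrite e h.
by exists x => //; rewrite /preimage /mkset /= -e.
Qed.

Hypothesis perP : periodic [set: {quot F}].

Let perF : forall x, exists2 n, (0 < n)%N & [set` F] (x *+ n).
Proof. exact/quot_periodic. Qed.

Lemma agree_quotP phi alpha a : agree [set` F] phi alpha a <->
  pi (phi a) = jact perP alpha (pi a).
Proof.
have E n : (0 < n)%N -> [set` F] (a *+ n) -> jact perP alpha (pi a) = pi (a *+ jrep alpha n).
  move=> n0 Fn; rewrite (jactE perP _ n0) ?raddfMn //.
  by rewrite -raddfMn; apply/quot_eq0.
split=> [h|e n n0 Fn].
  have [n n0 Fn] := perF a; rewrite (E n n0 Fn); apply/quot_eq; exact: h.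
by apply/quot_eq; rewrite e (E n).
Qed.

Lemma unif_quotP phi alpha : unif [set` F] phi alpha <->
  finite_set (range (fun a => pi (phi a) - jact perP alpha (pi a))).
Proof.
set d := (fun a : A => pi (phi a) - _).
have dB (x y : A) : d (x - y) = d x - d y.
  have ej : jact perP alpha (pi (x - y)) = jact perP alpha (pi x) - jact perP alpha (pi y).
    by rewrite -endoB; congr (jact perP alpha _); exact: (raddfB pi).
  have ep : pi (phi x - phi y) = pi (phi x) - pi (phi y) by exact: (raddfB pi).
  by rewrite /d endoB ej ep; abel.
have sA := subg_agree (subg_zmod F) perF phi alpha.
split=> [[X fX h]|fd].
  apply: sub_finite_set (finite_image d fX) => _ [a _ <-].
  have [r Xr /agree_quotP e] := h a I; exists r => //.
  by apply/esym/eqP; rewrite -subr_eq0 -dB /d e subrr.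
apply: (@fin_mod_refine _ _ [set 0] d); first exact: subg_set0.
  by exists (range d) => // x _; exists (d x); [exists x | rewrite /= subrr].
apply: fin_mod_self => // _ [x [y [_ _ /= e ->]]]; apply/agree_quotP.
by apply/eqP; rewrite -subr_eq0 -[X in X == _]/(d (x - y)) dB e.
Qed.

End QuotientAction.

(** All lattices are equally good for testing whether an inertial endomorphism is uniform,
    and any lattice can be shrunk into the kernel. *)
Lemma uniformP (A : zmodType) (F : set A) (phi : endo A) : finite_tf_rank A -> full_lattice F ->
  uniform phi <-> [/\ inertial phi, periodic (range phi) & exists alpha, unif F phi alpha].
Proof.
move=> fr lF; split=> [[ip [F1 [A0 [alpha [FA0 [stF stA] fA0 [perA0 sc] [freeF F0]]]]]]|].
  have sF1 := subg_zmod F1.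
  have perF1 x : exists2 n, (0 < n)%N & [set` F1] (x *+ n).
    have [n n0 An] := fin_mod_multiple (subg_zmod A0) (@subgT A) ((fin_mod_quotT A0).1 fA0) (I : [set: A] x).
    have /torsionP[m m0 e] := perA0 _ (ex_intro2 _ _ (x *+ n) An erefl : mod_sub F1 [set` A0] _).
    exists (n * m)%N; first by rewrite muln_gt0 n0.
    by apply/quot_eq0; rewrite mulrnA raddfMn.
  have lF1 : full_lattice [set` F1] by exact: free_full_lattice.
  have perP : periodic [set: {quot F1}] by exact/quot_periodic.
  split=> //.
    move=> _ [x _ <-]; have [n n0 Fn] := perF1 x; apply/torsionP; exists n => //.
    by rewrite -endoMn; have := F0 _ Fn; rewrite mulr0z.
  exists alpha; apply: (unif_change lF1 lF).
  apply: fin_mod_subl ((fin_mod_quotT A0).1 fA0) => a A0a.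
  apply/(agree_quotP perP).
  move/(padics_scaleP perP (\pi_({quot F1})%qT) (\pi_({quot F1})%qT \o phi)): sc.
  by apply; first exact: subg_zmod.
move=> [ip per [alpha h]].
have [F1 [lF1 freeF1 F10]] := lattice_in_kernel fr per.
have [sF1 _ _ perF1] := lF1; have hu := unif_change lF lF1 h.
have [F2 eF2] := zmod_of_subg sF1; have [A0 eA0] := zmod_of_subg (subg_agree sF1 perF1 phi alpha).
rewrite -eF2 in lF1 freeF1 F10 sF1 perF1 hu.
have perP : periodic [set: {quot F2}] by exact/quot_periodic.
have FA : {subset F2 <= A0}.
  move=> x Fx; suff : [set` A0] x by []; rewrite eA0 -eF2; exact: agree_sub.
split=> //; exists F2, A0, alpha; split=> //.
- split=> x hx; first by rewrite F10 // rpred0.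
  have : [set` A0] x by []; rewrite eA0 -eF2 => ha; have [n n0 Fn] := perF1 x.
  rewrite -(subrK (x *+ jrep alpha n) (phi x)) rpredD ?rpredMn //.
  by apply: FA; exact: ha.
- by apply/fin_mod_quotT; rewrite eA0 -eF2.
- split; first by move=> z _; exact: perP.
  apply/(padics_scaleP perP (\pi_({quot F2})%qT) (\pi_({quot F2})%qT \o phi)).
    exact: subg_zmod.
  move=> x; rewrite eA0 -eF2 => /(agree_quotP perP); exact.
Qed.

(** * Decompositions with a finite socle *)

Section FiniteSocle.
Variables (V : zmodType) (p : nat).
Hypothesis pp : prime p.
Implicit Types (X : set V).

Lemma finite_layer X k : subgroup X -> finite_set [set x | X x /\ x *+ p = 0] ->
  finite_set [set x | X x /\ x *+ p ^ k = 0].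
Proof.
move=> sX f; apply/fin_mod0.
apply: (fin_mod_socle (p := p) (@subg_set0 V) sX _ k).
exact/fin_mod0.
Qed.

(** In a p-group with finite socle, the socles of the p^n X become stationary, so that some
    p^n X is divisible. *)
Lemma finite_socle_fin_mod X c : subgroup X -> (forall x, X x -> exists k, x *+ p ^ k = 0) ->
  finite_set [set x | X x /\ x *+ p = 0] -> fin_mod (multiples X (p ^ c)) X.
Proof.
move=> sX Xp fsoc; have [s sE] := (finite_seqP _).1 fsoc.
have hn r : exists n, forall m, ~ multiples X (p ^ m) r -> ~ multiples X (p ^ n) r.
  have [h|/existsNP[n hn]] := pselect (forall n, multiples X (p ^ n) r).
    by exists 0%N => m nm; case: nm.
  by exists n.
have [f fE] := choice hn; pose n := \max_(r <- s) f r.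
have sM k : subgroup (multiples X (p ^ k)) by exact: subg_multiples.
have div x : multiples X (p ^ n) x -> multiples (multiples X (p ^ n)) p x.
  apply: (divisible_of_socle (sM n)) => [y /(multiples_sub sX)/Xp //|y m ny yp].
  have ys : y \in s.
    suff : [set` s] y by [].
    by rewrite -sE; split=> //; exact: multiples_sub ny.
  have [z Xz <-] : multiples X (p ^ (n + m)) y.
    apply: contrapT => /fE; apply; apply: multiples_le ny => //.
    by apply: leq_bigmax_seq.
  by exists (z *+ p ^ n); [exists z | rewrite -mulrnA -expnD].
have sub : multiples X (p ^ n) `<=` multiples X (p ^ c).
  move=> x /(pdivisible_pow div c)[y ny <-]; exists y => //; exact: multiples_sub ny.
apply: fin_mod_subl sub _.
have fl := finite_layer n sX fsoc.
exists [set x | X x /\ x *+ p ^ n = 0] => // x Xx.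
have [|d nd ed] := pdivisible_pow div n (x := x *+ p ^ n); first by exists x.
exists (x - d); last by rewrite subKr.
split; first by apply: subgB => //; exact: multiples_sub nd.
by rewrite mulrnBl ed subrr.
Qed.

Lemma finite_socle_rank X : (forall x, X x -> exists k, x *+ p ^ k = 0) -> subgroup X ->
  finite_set [set x | X x /\ x *+ p = 0] -> finite_rank X.
Proof.
move=> Xp sX fsoc; have [Y YE] := (finite_seqP _).1 fsoc; exists (size Y) => s sX1 [s0 ind].
have hk x : exists k, X x -> x != 0 -> x *+ p ^ k != 0 /\ x *+ p ^ k.+1 = 0.
  have [Xx|] := pselect (X x); last by exists 0%N.
  have [k] := Xp x Xx; elim: k => [|k IH] xk; first by exists 0%N => _; rewrite -[x]mulr1n xk eqxx.
  by have [/IH //|/eqP nk] := pselect (x *+ p ^ k = 0); exists k.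
have [k kE] := choice hk.
pose y i := s`_i *+ p ^ k s`_i.
have yE i : (i < size s)%N -> y i != 0 /\ y i *+ p = 0.
  move=> lt; have si := mem_nth 0 lt.
  have [|a b] := kE s`_i (sX1 _ si); first by apply: contraNneq s0 => <-.
  by split=> //; rewrite /y -mulrnA -expnSr.
rewrite -(size_iota 0 (size s)) -(size_map y); apply: uniq_leq_size.
  rewrite map_inj_in_uniq ?iota_uniq // => i j; rewrite !mem_iota /= => il jl e.
  apply: contrapT => /eqP ij.
  pose m l : int := if l == i then Posz (p ^ k (s`_i)%R) else if l == j then - Posz (p ^ k (s`_j)%R) else 0.
  have [ny _] := yE i il; case/eqP: ny.
  have := ind m _ i il; rewrite /m eqxx -pmulrn; apply.
  rewrite (bigD1 (Ordinal il)) //= eqxx (bigD1 (Ordinal jl)) /=; last by rewrite -val_eqE /= eq_sym.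
  rewrite eq_sym (negPf ij) eqxx big1.
    by rewrite mulrNz -!pmulrn -/(y i) -/(y j) e addr0 subrr.
  by move=> l /andP[]; rewrite -!val_eqE /= => /negPf -> /negPf ->.
move=> _ /mapP[i + ->]; rewrite mem_iota /= => il.
have [_ yp] := yE i il; suff : [set` Y] (y i) by [].
by rewrite -YE; split=> //; apply: subgMn => //; apply: sX1; exact: mem_nth.
Qed.

Lemma finite_rank_socle X : subgroup X -> finite_rank X ->
  finite_set [set x | X x /\ x *+ p = 0].
Proof.
move=> sX [r hr]; apply: contrapT => inf; have s0 := @subg_set0 V.
pose ok s x := [/\ X x, x *+ p = 0 & ~ gens [set 0] s x].
have step (s : seq V) : exists x, (forall y, y \in s -> y *+ p = 0) -> ok s x.
  have [sp|] := pselect (forall y, y \in s -> y *+ p = 0); last by exists 0.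
  have fg : finite_set (gens [set 0] s).
    apply/fin_mod0; apply: fin_mod_subr (fin_mod_gens_torsion s s0) => y gy; split=> //.
    exists p; first exact: prime_gt0.
    have : ((1 *+ p : endo V) @^-1` [set 0]) y.
      apply: gens_min gy; first exact: subg_preim.
      + by move=> _ ->; rewrite /preimage /mkset endo0.
      + by move=> z zs; rewrite /preimage /mkset endoMnE; exact: sp.
    by rewrite /preimage /mkset endoMnE.
  apply: contrapT => h; apply: inf; apply: sub_finite_set fg => x [Xx xp].
  by apply: contrapT => nx; apply: h; exists x.
have [x hx] := seq_choice step.
have xp n : x n *+ p = 0.
  have [m] := ubnP n; elim: m n => // m IH n nm.
  have [] // := hx n; move=> y /mapP[k + ->]; rewrite mem_iota /= => kn.
  by apply: IH; lia.
have okx n : ok (mkseq x n) (x n) by apply: hx => y /mapP[k _ ->].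
have ind n (c : nat -> int) : \sum_(i < n) x i *~ c i = 0 -> forall i, (i < n)%N -> x i *~ c i = 0.
  elim: n => // n IH; rewrite big_ord_recr /= => e.
  have [_ _ nx] := okx n.
  have sG := subg_gens (mkseq x n) s0.
  have Gc : gens [set 0] (mkseq x n) (x n *~ c n).
    apply/(gens_sumP (mkseq x n) (x n *~ c n) s0); exists (fun i => - c i).
    rewrite /= size_mkseq -[RHS]e addrC -sumrN; congr (_ + _).
    by apply: eq_bigr => i _; rewrite nth_mkseq // mulrNz opprK.
  have dv : (p %| `|c n|)%N.
    apply: contrapT => /negP ndv; apply: nx; rewrite -[x n]mulr1n.
    move/(subg_abs _ _ sG): Gc => Gc.
    apply: (subg_pdiv (M := 1) (j := 0) pp sG _ Gc); rewrite ?expn1 //.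
    by rewrite xp; exact: subg0.
  have c0 : x n *~ c n = 0.
    apply/(subg_abs (x n) (c n) s0); have /dvdnP[u ->] := dv.
    by rewrite /= mulnC mulrnA xp mul0rn.
  move=> i; rewrite ltnS leq_eqVlt => /predU1P[->//|lt]; apply: IH => //.
  by rewrite -[RHS]e c0 addr0.
have := hr (mkseq x r.+1) _; rewrite size_mkseq ltnn => h; suff: false by [].
apply: h => [y /mapP[k _ ->]|]; first by have [] := okx k.
split.
  apply/mapP => -[k _ /esym e]; have [_ _] := okx k; apply; rewrite e.
  exact: subg0 (subg_gens _ s0).
rewrite size_mkseq => m e i lt; rewrite nth_mkseq //.
apply: ind lt; rewrite -[RHS]e; apply: eq_bigr => j _; by rewrite nth_mkseq.
Qed.

End FiniteSocle.

Lemma direct_sum_proj (A : zmodType) (B E : set A) : subgroup B -> subgroup E ->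
  direct_sum [set: A] B E -> exists rho : endo A,
  [/\ forall x, B (rho x), forall x, E (x - rho x), forall x, B x -> rho x = x
    & forall x, E x -> rho x = 0].
Proof.
move=> sB sE [TE dis].
have uniqBE x b b' : B b -> E (x - b) -> B b' -> E (x - b') -> b = b'.
  move=> Bb Eb Bb' Eb'; apply/eqP; rewrite -subr_eq0; apply/eqP.
  have : (B `&` E) (b - b').
    split; first exact: subgB.
    have -> : b - b' = (x - b') - (x - b) by abel.
    exact: subgB.
  by rewrite dis.
have hb x : exists b, B b /\ E (x - b).
  have : [set: A] x by []; rewrite TE => -[b Bb [e Ee <-]]; exists b; split=> //.
  by rewrite addrC addKr.
have [f fE] := choice hb.
have fu x b : B b -> E (x - b) -> f x = b.
  by move=> Bb Eb; have [h1 h2] := fE x; exact: uniqBE h1 h2 Bb Eb.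
have f_endo : is_endo f.
  apply/asboolP => x y; have [B1 E1] := fE x; have [B2 E2] := fE y.
  apply: fu; first exact: subgD.
  have -> : x + y - (f x + f y) = (x - f x) + (y - f y) by abel.
  exact: subgD.
exists (Endo f_endo); split=> /= x; [by case: (fE x)|by case: (fE x)| |] => hx.
- by apply: fu => //; rewrite subrr; exact: subg0.
- by apply: fu; rewrite ?subr0 //; exact: subg0.
Qed.

(** Adding the finitely many elements of s to H contributes finitely many cosets only, because
    the image of phi is periodic. *)
Lemma inertial_lift (A : zmodType) (s : seq A) (phi : endo A) : periodic (range phi) ->
  (forall H, subgroup H -> gens [set 0] s `<=` H -> fin_mod H (phi @` H)) -> inertial phi.
Proof.
move=> per h; apply/inertialP => H sH; have sG := subg_gens s sH.
have HG : H `<=` gens H s by exact: gens_sub.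
have f : fin_mod (gens H s) (phi @` H).
  apply: fin_mod_subr (h _ sG _); first by move=> _ [x Hx <-]; exists x => //; exact: HG.
  by apply: gens_subseq => // _ ->; exact: subg0.
apply: (fin_mod_sub_refine sG f).
apply: fin_mod_subr (fin_mod_gens_torsion s sH) => _ [_ [_ [[x Hx <-] [y Hy <-] G ->]]]; split=> //.
have /torsionP[n n0 e] : phi (x - y) \in torsion A by apply: per; exists (x - y).
by exists n => //; rewrite -endoB e; exact: subg0.
Qed.

Section PrimarySummand.
Variables (A : zmodType) (p : primeT) (B E : set A) (c : nat) (rho : endo A).
Hypotheses (fr : finite_tf_rank A) (sB : subgroup B) (sE : subgroup E).
Hypothesis Bc : forall x, B x -> x *+ p ^ c = 0.
Hypothesis Esoc : finite_set [set x | E x /\ x *+ p = 0].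
Hypotheses (rhoB : forall x, B (rho x)) (rhoE : forall x, E (x - rho x)).
Hypotheses (rho1 : forall x, B x -> rho x = x) (rho0 : forall x, E x -> rho x = 0).

Let pp : prime p := prime_primeT p.
Let pc0 k : (0 < p ^ k)%N. Proof. by rewrite expn_gt0 prime_gt0. Qed.

Lemma summand_mul x : E (x *+ p ^ c).
Proof.
have -> : x *+ p ^ c = (x - rho x) *+ p ^ c by rewrite mulrnBl (Bc (rhoB x)) subr0.
exact: subgMn.
Qed.

(** Multiplication by p maps these elements into F, which is finite modulo p^(c+1) F, and two of
    them with the same class there differ by an element of F plus one of the socle of E. *)
Lemma summand_socle F : full_lattice F -> fin_mod F [set x | E x /\ F (x *+ p)].
Proof.
move=> [sF [s FE] _ _].
have sM : subgroup (multiples F (p ^ c.+1)) by exact: subg_multiples.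
have fM : fin_mod (multiples F (p ^ c.+1)) F.
  apply: fin_mod_subr (fin_mod_gens_torsion s sM) => x Fx; split.
    by move: Fx; rewrite {1}FE; apply: gens_subseq => // _ ->; exact: subg0.
  by exists (p ^ c.+1)%N => //; exists x.
apply: (@fin_mod_refine _ _ (multiples F (p ^ c.+1)) (fun x => x *+ p)) => //.
  by have [X fX hX] := fM; exists X => // x [_ Fx]; exact: hX.
apply: fin_mod_subr (fin_mod_sumset sF (fin_mod_self sF (@subset_refl _ F))
  (fin_mod_finite sF Esoc)) => _ [x [y [[Ex _] [Ey _] [f Ff ef] ->]]].
exists (f *+ p ^ c); first exact: subgMn.
exists (x - y - f *+ p ^ c); last by rewrite addrC subrK.
split; first by apply: subgB; [|exact: subgB|exact: summand_mul].
by rewrite mulrnBl mulrnBl -ef expnSr mulrnA subrr.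
Qed.

(** Modulo a lattice F contained in both H and E, let G be the p-part of H. Its projection X
    to E has finite socle, so that p^c X has finite index in X. An element of G whose projection
    to E is congruent modulo F to p^c times that of some h in G has both components in H, because
    p^c annihilates the component of h in B. The elements of H that are prime to p modulo F are
    killed by the projection to B. *)
Lemma proj_inertial n : inertial (rho *+ n).
Proof.
have [s ind iso] := finite_rank_basis fr.
have k0 : (0 < p ^ c)%N by [].
have lF : full_lattice (gens [set 0] [seq x *+ p ^ c | x <- s]).
  apply: basis_full_lattice; first exact: tf_independent_mul.
  by move=> x; exact: isolator_mul.
set s' := [seq x *+ p ^ c | x <- s] in lF.
apply: (inertial_lift (s := s')).
  move=> _ [x _ <-]; apply/torsionP; exists (p ^ c)%N => //.
  by rewrite endoMnE mulrnAC (Bc (rhoB x)) mul0rn.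
set F := gens [set 0] s' in lF *; have [sF _ _ perF] := lF.
move=> H sH FH.
have FE : F `<=` E.
  apply: gens_min => //; first by move=> _ ->; exact: subg0.
  by move=> _ /mapP[x _ ->]; exact: summand_mul.
have [Z eZ] := zmod_of_subg sF.
pose pi := (\pi_({quot Z}))%qT.
have piF x : pi x = 0 <-> F x.
  by rewrite -eZ; exact: quot_eq0.
pose G := [set h | H h /\ exists k, F (h *+ p ^ k)].
have sG : subgroup G.
  split; first by split; [exact: subg0 | exists 0%N; rewrite mul0rn; exact: subg0].
  move=> x y [Hx [k Fx]] [Hy [l Fy]]; split; first exact: subgB.
  exists (k + l)%N; rewrite mulrnBl; apply: subgB => //; first by rewrite expnD mulrnA; exact: subgMn.
  by rewrite addnC expnD mulrnA; exact: subgMn.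
pose rho' : endo A := 1 - rho.
have rho'E x : rho' x = x - rho x by rewrite endoBE.
pose X := pi @` (rho' @` G).
have sX : subgroup X by apply: subg_image; exact: subg_image.
have Xp x : X x -> exists k, x *+ p ^ k = 0.
  move=> [_ [h [Hh [k Fk]] <-] <-]; exists (k + c)%N; rewrite -raddfMn; apply/piF.
  have -> : rho' h *+ p ^ (k + c) = h *+ p ^ k *+ p ^ c.
    rewrite rho'E mulrnBl -[h *+ _ *+ _]mulrnA -expnD.
    have -> : rho h *+ p ^ (k + c) = 0 by rewrite addnC expnD mulrnA (Bc (rhoB h)) mul0rn.
    by rewrite subr0.
  exact: subgMn.
have fX : fin_mod (multiples X (p ^ c)) X.
  apply: finite_socle_fin_mod => //; apply/fin_mod0.
  have f1 : fin_mod [set 0] (pi @` [set x | E x /\ F (x *+ p)]).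
    by apply: fin_mod_imageW (summand_socle lF) _ => x /piF.
  apply: fin_mod_subr f1 => _ [[_ [h Gh <-] <-] e]; exists (rho' h) => //.
  by split; [rewrite rho'E | apply/piF; rewrite /pi raddfMn].
pose G' := [set h | H h /\ exists2 m, coprime p m & F (h *+ m)].
have HGG : H `<=` sumset G G'.
  move=> h Hh; have [m m0 Fm] := perF h.
  have [u uE cop] : exists2 u, m = (p ^ logn p m * u)%N & coprime p u.
    by have [u cop e] := pfactor_coprime pp m0; exists u; rewrite // mulnC.
  have cop' : coprime (p ^ logn p m) u by exact: coprimeXl.
  pose a := chinese (p ^ logn p m) u 1 0; pose b := chinese (p ^ logn p m) u 0 1.
  have /dvdnP[a' a'E] : (u %| a)%N by apply/eqP; rewrite chinese_modr // mod0n.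
  have /dvdnP[b' b'E] : (p ^ logn p m %| b)%N by apply/eqP; rewrite chinese_modl // mod0n.
  have e : F (h - h *+ (a + b)).
    rewrite -[X in X - _]mulr1n; apply: (subg_eqmod sF Fm); rewrite uE; apply/eqP.
    rewrite chinese_remainder //; apply/andP; split; apply/eqP.
      by rewrite b'E addnC modnMDl chinese_modl.
    by rewrite a'E modnMDl chinese_modr.
  exists (h - h *+ (a + b) + h *+ a).
    split; first by apply: subgD => //; [exact: FH | exact: subgMn].
    exists (logn p m); rewrite mulrnDl; apply: subgD => //; first exact: subgMn.
    by rewrite -mulrnA a'E -mulnA [(u * _)%N]mulnC -uE mulnC mulrnA; exact: subgMn.
  exists (h *+ b); last by rewrite mulrnDr; abel.
  split; first exact: subgMn.
  exists u => //; by rewrite -mulrnA b'E -mulnA -uE mulnC mulrnA; exact: subgMn.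
have fG' : fin_mod H ((rho *+ n) @` G').
  apply: fin_mod_self => // _ [h [Hh [m cop Fm]] <-].
  suff -> : (rho *+ n) h = 0 by exact: subg0.
  have e1 : rho h *+ m = 0 by rewrite -endoMn rho0 //; exact: FE.
  have := subg_gcd (@subg_set0 A) (Bc (rhoB h)) e1.
  by rewrite (eqP (coprimeXl c cop)) mulr1n endoMnE /= => ->; rewrite mul0rn.
pose f : {additive A -> {quot Z}} := pi \o rho'.
have fG : fin_mod H ((rho *+ n) @` G).
  have fP : fin_mod (G `&` f @^-1` multiples X (p ^ c)) G.
    apply: fin_mod_preim => //; first exact: subg_multiples.
    by apply: fin_mod_subr fX => _ [h Gh <-]; exists (rho' h) => //; exists h.
  apply: fin_mod_imageW fP _ => x [[Hx _] [_ [_ [h [Hh _] <-] <-] e]].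
  have Fd : F (rho' h *+ p ^ c - rho' x).
    by apply/piF; rewrite /pi raddfB raddfMn /=; apply/eqP; rewrite subr_eq0; apply/eqP.
  have Hd : H (rho' h *+ p ^ c).
    by rewrite rho'E mulrnBl (Bc (rhoB h)) subr0; exact: subgMn.
  have Hx' : H (rho' x) by apply: (subg_sub sH _ Hd); apply: subg_subC => //; exact: FH.
  rewrite /= endoMnE; apply: subgMn => //.
  by have -> : rho x = x - rho' x; [rewrite rho'E subKr | exact: subgB].
apply: fin_mod_subr (fin_mod_sumset sH fG fG') => _ [h /HGG[g Gg [g' Gg' <-]] <-].
exists ((rho *+ n) g); first by exists g.
by exists ((rho *+ n) g'); [exists g' | rewrite endoD].
Qed.

End PrimarySummand.

(** * Critical primes *)

(** A subgroup maximal among those meeting D trivially is a complement. *)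
Lemma divisible_complement (V : zmodType) (p : nat) (S D : set V) : prime p ->
  subgroup S -> subgroup D -> D `<=` S -> (forall x, S x -> exists k, x *+ p ^ k = 0) ->
  (forall x, D x -> multiples D p x) ->
  exists K, [/\ subgroup K, K `<=` S & direct_sum S K D].
Proof.
move=> pp sS sD DS Sp div.
have [||K [sK [_ KS] KD maxK]] := @max_avoiding _ [set 0] S
  [set x | D x /\ x <> 0] (@subg_set0 _) sS.
- by move=> _ ->; exact: subg0.
- by move=> _ -> [].
exists K; split=> //.
have sKD : subgroup (sumset K D) by exact: subg_sumset.
have KKD : K `<=` sumset K D by apply: sumset_subl; exact: subg0.
have DKD : D `<=` sumset K D by apply: sumset_subr; exact: subg0.
have step y : S y -> sumset K D (y *+ p) -> sumset K D y.
  move=> Sy [a Ka [b Db e]]; have [d Dd ed] := div b Db.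
  have Kp : K ((y - d) *+ p) by rewrite mulrnBl ed -e addrK.
  have Sd : S (y - d) by apply: subgB => //; exact: DS.
  suff : sumset K D (y - d) by move=> h; rewrite -(subrK d y); apply: subgD => //; exact: DKD.
  apply: contrapT => ny; have [/KKD //|nK] := pselect (K (y - d)).
  have [z [Dz z0] [r Kr [_ [c _ <-] ec]]] := maxK _ Sd nK.
  have KDc : sumset K D ((y - d) *~ c).
    have -> : (y - d) *~ c = z - r by rewrite -ec; abel.
    by apply: subgB => //; [exact: DKD | exact: KKD].
  move/(subg_abs _ _ sKD): KDc => KDc.
  have dv : (p %| `|c|)%N.
    apply: contrapT => /negP ndv; apply: ny; rewrite -[y - d]mulr1n.
    by apply: (subg_pdiv (M := 1) (j := 0) pp sKD _ KDc); rewrite expn1 //; exact: KKD.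
  apply: (KD z) => //; rewrite -ec; apply: subgD => //; apply/subg_abs => //.
  by have /dvdnP[u ->] := dv; rewrite mulnC mulrnA; exact: subgMn.
split; apply/seteqP; split=> x.
- move=> Sx; have [k xk] := Sp x Sx.
  elim: k x Sx xk => [|k IH] x Sx xk.
    by move: xk; rewrite mulr1n => ->; exact: subg0.
  apply: step => //; apply: IH; first exact: subgMn.
  by rewrite -mulrnA -expnS.
- by apply: sumset_min => //; exact: DS.
- by move=> [Kx Dx]; apply: contrapT => x0; exact: (KD x).
- by move=> ->; split; exact: subg0.
Qed.

(** A complement of the divisible part witnesses that p is critical. *)
Lemma pi_c_witness (A : zmodType) (F : zmodClosed A) (p : primeT) k :
  free_periodic_quot F -> let D := multiples (pprim {quot F} p) (p ^ k) in
  (forall x, D x -> multiples D p x) -> finite_set [set x | D x /\ x *+ p = 0] ->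
  (exists2 x, D x & x <> 0) -> ~ fin_mod D (pprim {quot F} p) -> (p : nat) \in pi_c A.
Proof.
move=> fpq D div fsoc [z0 Dz0 z0n] nfin; have pp := prime_primeT p.
have sS := @subg_pprim {quot F} p; have sD : subgroup D by exact: subg_multiples.
have DS : D `<=` pprim {quot F} p by exact: multiples_sub.
have Sp x : pprim {quot F} p x -> exists k, x *+ p ^ k = 0 by move/pprimP.
have Dp x : D x -> exists k, x *+ p ^ k = 0 by move=> /DS/Sp.
have [K [sK KS dKD]] := divisible_complement pp sS sD DS Sp div.
have [ZK eK] := zmod_of_subg sK; have [ZD eD] := zmod_of_subg sD.
rewrite inE /= pp /=; apply/asboolP; exists F, ZK, ZD; rewrite eK eD; split=> //.
- split.
    move=> fK; apply: nfin; have [SKD _] := dKD; rewrite SKD.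
    apply: fin_mod_sumset => //; last exact: fin_mod_self.
    exact: fin_mod_finite.
  exists (p ^ k)%N; split; first by rewrite expn_gt0 prime_gt0.
  move=> x Kx; have [_ KD0] := dKD.
  have : (K `&` D) (x *+ p ^ k) by split; [exact: subgMn | exists x => //; exact: KS].
  by rewrite KD0.
- split.
  + by move=> e; apply: z0n; move: Dz0; rewrite e.
  + move=> n x n0 Dx; exact: (pdivisible_divisible pp sD Dp div).
  + exact: (finite_socle_rank Dp sD fsoc).
Qed.

Lemma bounded_pprim (V : zmodType) (p : nat) (S : set V) : prime p -> bounded S ->
  (forall x, S x -> exists k, x *+ p ^ k = 0) -> exists c, forall x, S x -> x *+ p ^ c = 0.
Proof.
move=> pp [n [n0 hn]] Sp; exists (logn p n) => x Sx; have [k xk] := Sp x Sx.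
have s0 := @subg_set0 V; apply: (subg_pdiv pp s0 xk (hn x Sx)).
by rewrite pfactor_dvdn // ltnn.
Qed.

Lemma int_to_nat (M : nat) (n : int) : (0 < M)%N ->
  exists k : nat, forall (V : zmodType) (x : V), x *+ M = 0 -> x *~ n = x *+ k.
Proof.
move=> M0; case: n => n; first by exists n.
exists (n.+1 * M.-1)%N => V x xM; rewrite NegzE mulrNz -pmulrn; apply/esym/eqP.
by rewrite -addr_eq0 -mulrnDr addnC -mulnS prednK // mulnC mulrnA xM mul0rn.
Qed.

Section CriticalSequence.
Variables (A : zmodType) (len : option nat) (p : nat -> nat) (B C : nat -> zmodClosed A).
Hypotheses (fr : finite_tf_rank A) (cs : critical_sequence len p B C).
Implicit Types (phi : endo A).

Lemma le_len_trans i j : (i <= j)%N -> le_len j len -> le_len i len.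
Proof. by case: len => //= l ij; exact: leq_trans. Qed.

Lemma le_len_max i j : le_len i len -> le_len j len -> le_len (maxn i j) len.
Proof. by rewrite /maxn; case: ifP. Qed.

Lemma crit_prime i : le_len i.+1 len -> prime (p i).
Proof.
move=> il; have : p i \in pi_c A by apply/(crit_enum cs); exists i.
by rewrite inE => /andP[].
Qed.

Lemma subg_sum_first i : subgroup (sum_first B i).
Proof.
split.
  by exists (fun=> 0); [move=> j _; exact: rpred0 | rewrite big1].
move=> _ _ [b hb ->] [b' hb' ->]; exists (fun j => b j - b' j).
  by move=> j ji; rewrite rpredB ?hb ?hb'.
by rewrite -sumrB.
Qed.

Lemma sum_first_mem i j x : (j < i)%N -> x \in B j -> sum_first B i x.
Proof.
move=> ji xB; exists (fun k => if k == j then x else 0).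
  by move=> k _; case: eqP => [->//|_]; exact: rpred0.
rewrite (bigD1 (Ordinal ji)) //= eqxx big1 ?addr0 // => k.
by rewrite -val_eqE /= => /negPf ->.
Qed.

Lemma sum_first_min i (L : set A) : subgroup L -> (forall j x, (j < i)%N -> x \in B j -> L x) ->
  sum_first B i `<=` L.
Proof.
move=> sL h _ [b hb ->]; apply: (big_ind L); [exact: subg0 | move=> x y; exact: subgD|].
by move=> j _; apply: (h j) => //; exact: hb.
Qed.

Lemma sum_first_le i j : (i <= j)%N -> sum_first B i `<=` sum_first B j.
Proof.
move=> ij; apply: sum_first_min => [|k x ki]; first exact: subg_sum_first.
by apply: sum_first_mem; exact: leq_trans ij.
Qed.

Lemma sum_firstS i : sum_first B i.+1 = sumset (sum_first B i) [set` B i].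
Proof.
apply/seteqP; split=> x.
  move=> [b hb ->]; rewrite big_ord_recr /=; exists (\sum_(j < i) b j).
    by exists b => // j ji; apply: hb; exact: ltnW.
  by exists (b i) => //; exact: hb.
apply: sumset_min; first exact: subg_sum_first.
  by apply: sum_first_le.
by move=> y yB; apply: sum_first_mem yB.
Qed.

Lemma crit_C_sub i : le_len i.+1 len -> {subset C i.+1 <= C i} /\ {subset B i <= C i}.
Proof.
move=> il; have [e _] := crit_split cs il; split=> x hx.
  suff : [set` C i] x by []; rewrite e; exists 0; first exact: rpred0.
  by exists x => //; rewrite add0r.
suff : [set` C i] x by []; rewrite e; exists x => //; exists 0; first exact: rpred0.
by rewrite addr0.
Qed.

Lemma crit_C_le i j : (i <= j)%N -> le_len j len -> {subset C j <= C i}.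
Proof.
elim: j => [|j IH]; first by rewrite leqn0 => /eqP -> _ x.
rewrite leq_eqVlt => /predU1P[<- _ x //|ij] jl x /(crit_C_sub jl).1; apply: IH => //.
exact: le_len_trans jl.
Qed.

Lemma crit_B_C i j : (i <= j)%N -> le_len j.+1 len -> {subset B j <= C i}.
Proof.
move=> ij jl x /(crit_C_sub jl).2; apply: crit_C_le => //; exact: le_len_trans jl.
Qed.

Lemma crit_exponent : exists c : nat -> nat, forall j, le_len j.+1 len ->
  forall x, x \in B j -> x *+ p j ^ c j = 0.
Proof.
suff h j : exists c, le_len j.+1 len -> forall x, x \in B j -> x *+ p j ^ c = 0.
  by have [c hc] := choice h; exists c.
have [jl|] := pselect (le_len j.+1 len); last by exists 0%N.
have [bd sub] := crit_bounded cs jl; have pp := crit_prime jl.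
have [c hc] := bounded_pprim pp bd (fun x xB => (pipartP x pp).1 (sub x xB)).
by exists c.
Qed.

Lemma proj_first i : le_len i len -> exists rho : endo A,
  [/\ forall x, sum_first B i (rho x), forall x, x - rho x \in C i,
      forall x, sum_first B i x -> rho x = x & forall x, x \in C i -> rho x = 0].
Proof.
move=> il; have [_ ds _ _ _] := crit_oplus cs il.
exact: direct_sum_proj (subg_sum_first i) (subg_zmod (C i)) ds.
Qed.

Lemma crit_C0 x : x \in C 0%N.
Proof.
have il : le_len 0 len by case: len.
have [_ [e _] _ _ _] := crit_oplus cs il.
have : [set: A] x by []; rewrite e => -[a [b _ ->] [c hc <-]].
by rewrite big_ord0 add0r.
Qed.

(** The other summand of the decomposition of A that splits off B i. *)
Definition crit_rest i : set A := sumset (sum_first B i) [set` C i.+1].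

Lemma subg_crit_rest i : subgroup (crit_rest i).
Proof. by apply: subg_sumset; [exact: subg_sum_first | exact: subg_zmod]. Qed.

Lemma crit_rest_sum i : sum_first B i `<=` crit_rest i.
Proof. by apply: sumset_subl; exact: subg0 (subg_zmod _). Qed.

Lemma crit_rest_C i : [set` C i.+1] `<=` crit_rest i.
Proof. by apply: sumset_subr; exact: subg0 (subg_sum_first _). Qed.

Lemma crit_rest_direct i : le_len i.+1 len -> direct_sum [set: A] [set` B i] (crit_rest i).
Proof.
move=> il; have [_ [e dis] _ _ _] := crit_oplus cs il; split; apply/seteqP; split=> x //.
- rewrite e sum_firstS => -[_ [s Ss [b Bb <-]] [c Cc <-]].
  by exists b => //; exists (s + c); [exists s => //; exists c | abel].
- move=> [Bx [s Ss [c Cc ec]]].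
  have c0 : c = 0.
    have : (sum_first B i.+1 `&` [set` C i.+1]) c.
      split=> //; have -> : c = x - s by rewrite -ec; abel.
      apply: subgB (subg_sum_first _) _ _; first exact: sum_first_mem Bx.
      exact: sum_first_le Ss.
    by rewrite dis.
  have [b hb eb] := Ss.
  have := crit_direct cs (b := fun j => if j == i then - x else b j) il _ _ (j := i) (ltnSn i).
  rewrite eqxx => h; apply/eqP; rewrite -oppr_eq0; apply/eqP; apply: h.
    move=> j; rewrite ltnS leq_eqVlt => /predU1P[->|ji].
      by rewrite eqxx rpredN.
    by rewrite ltn_eqF // hb.
  rewrite big_ord_recr /= eqxx -ec c0 addr0 eb.
  under eq_bigr => j _ do rewrite ltn_eqF //.
  exact: subrr.
- move=> ->; split; first exact: rpred0.
  exact: subg0 (subg_crit_rest i).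
Qed.

(** The primes of the earlier groups differ from p i. *)
Lemma crit_rest_primary i x k : le_len i.+1 len -> crit_rest i x -> x *+ p i ^ k = 0 ->
  x \in C i.+1.
Proof.
move=> il [s [b hb es] [c Cc <-]] xk.
have [_ [e dis] _ _ _] := crit_oplus cs il.
have sk : s *+ p i ^ k = 0.
  have : (sum_first B i.+1 `&` [set` C i.+1]) (s *+ p i ^ k).
    split.
      apply: subgMn (subg_sum_first _) _; apply: (sum_first_le (leqnSn i)).
      by exists b.
    have -> : s *+ p i ^ k = - (c *+ p i ^ k) by apply/eqP; rewrite -addr_eq0 -mulrnDl xk.
    by rewrite /= rpredN rpredMn.
  by rewrite dis.
suff -> : s = 0 by rewrite add0r.
rewrite es big1 // => j _.
have il' := le_len_trans (leqnSn i) il.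
have jl : le_len j.+1 len by apply: le_len_trans il'.
have bk : b j *+ p i ^ k = 0.
  apply: (crit_direct cs (b := fun j => b j *+ p i ^ k) il') => //.
    by move=> l li; rewrite rpredMn // hb.
  by rewrite sumrMnl -es.
have [c' hc'] := crit_exponent; have bc := hc' j jl _ (hb j (ltn_ord j)).
have := subg_gcd (@subg_set0 A) bk bc.
rewrite (eqP (_ : coprime _ _)) ?mulr1n //.
apply/coprimeXl/coprimeXr; rewrite prime_coprime ?crit_prime // dvdn_prime2 ?crit_prime //.
apply/eqP => e'; have := crit_inj cs il jl e' => ij.
by have := ltn_ord j; rewrite -ij ltnn.
Qed.

Lemma crit_rest_socle i : le_len i.+1 len ->
  finite_set [set x | crit_rest i x /\ x *+ p i = 0].
Proof.
move=> il; have pp := crit_prime il.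
have [_ _ _ _ [_ frk]] := crit_oplus cs il.
set S := (S in finite_rank S) in frk.
have sS : subgroup S by apply: subgI; exact: subg_zmod.
have := finite_rank_socle pp sS frk; apply: sub_finite_set => x [Ex xp]; split=> //; split.
  by apply: (crit_rest_primary (k := 1) il) => //; rewrite expn1.
apply/asboolP; exists (p i); last by [].
suff: p i \in [seq p j | j <- iota 0 i.+1] by rewrite pnatE.
by apply: map_f; rewrite mem_iota; lia.
Qed.

(** An element of N is determined by the integers by which it acts on finitely many of the
    groups B j. *)
Definition acts_as J (r : nat -> nat) phi : Prop :=
  (forall j, (j < J)%N -> forall x, x \in B j -> phi x = x *+ r j) /\
  (forall x, x \in C J -> phi x = 0).

Lemma acts_as_exists J r : le_len J len -> exists2 phi,
  acts_as J r phi & exists n : int, int_scale n (sum_first B J) phi /\ int_scale 0 [set` C J] phi.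
Proof.
move=> Jl; have [c hc] := crit_exponent; have [rho [r1 r2 r3 r4]] := proj_first Jl.
have inj i j : (i < J)%N -> (j < J)%N -> p i = p j -> i = j.
  by move=> iJ jJ; apply: (crit_inj cs); apply: le_len_trans Jl.
pose s := map p (iota 0 J); pose idx q := index q s.
have us : uniq s.
  rewrite map_inj_in_uniq ?iota_uniq // => i j; rewrite !mem_iota /= => iJ jJ.
  exact: inj.
have idxE j : (j < J)%N -> idx (p j) = j.
  move=> jJ; have js : (j < size s)%N by rewrite size_map size_iota.
  have e : p j = nth 0%N s j by rewrite (nth_map 0%N) ?size_iota // nth_iota.
  by rewrite /idx e index_uniq.
have [|n hn] := crt_primes (fun q => c (idx q)) (fun q => r (idx q)) us.
  apply/allP => _ /mapP[j + ->]; rewrite mem_iota /= => jJ.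
  by apply: crit_prime; exact: le_len_trans Jl.
exists (rho *+ n); last first.
  exists n%:Z; split=> x hx; rewrite endoMnE -pmulrn; first by rewrite r3.
  by rewrite r4 // mul0rn.
split=> [j jJ x xB|x xC]; last by rewrite endoMnE r4 // mul0rn.
rewrite endoMnE r3; last exact: sum_first_mem xB.
have jl : le_len j.+1 len by apply: le_len_trans Jl.
apply: (mulrn_eqmod (hc j jl x xB)).
by have := hn (p j); rewrite idxE //; apply; apply: map_f; rewrite mem_iota.
Qed.

Lemma acts_as_ext J r phi psi : le_len J len -> acts_as J r phi -> acts_as J r psi -> phi = psi.
Proof.
move=> Jl [h1 h2] [h3 h4]; apply: endo_ext => x.
have [rho [r1 r2 _ _]] := proj_first Jl.
have -> : phi x = phi (rho x) by rewrite -[in LHS](subrK (rho x) x) endoD (h2 _ (r2 x)) add0r.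
have -> : psi x = psi (rho x) by rewrite -[in LHS](subrK (rho x) x) endoD (h4 _ (r2 x)) add0r.
have [b hb ->] := r1 x; rewrite !raddf_sum; apply: eq_bigr => j _ /=.
by rewrite (h1 _ (ltn_ord j) _ (hb _ (ltn_ord j))) (h3 _ (ltn_ord j) _ (hb _ (ltn_ord j))).
Qed.

Lemma NringP phi : Nring len B C phi <-> exists J r, le_len J len /\ acts_as J r phi.
Proof.
split=> [[J [n [Jl hB hC]]]|[J [r [Jl h]]]].
  have [c hc] := crit_exponent.
  have hk j : exists k : nat, le_len j.+1 len -> forall x, x \in B j -> x *~ n = x *+ k.
    have [jl|] := pselect (le_len j.+1 len); last by exists 0%N.
    have [|k hk] := @int_to_nat (p j ^ c j) n; first by rewrite expn_gt0 prime_gt0 // crit_prime.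
    by exists k => _ x xB; apply: hk; exact: hc.
  have [r hr] := choice hk; exists J, r; split=> //; split=> [j jJ x xB|x xC].
    rewrite hB; last exact: sum_first_mem xB.
    by apply: hr => //; exact: le_len_trans Jl.
  by rewrite hC // mulr0z.
have [psi h' [n [hB hC]]] := acts_as_exists r Jl.
by rewrite (acts_as_ext Jl h h'); exists J, n.
Qed.

Lemma acts_as_extend J K r phi : (J <= K)%N -> le_len K len -> acts_as J r phi ->
  acts_as K (fun j => if (j < J)%N then r j else 0%N) phi.
Proof.
move=> JK Kl [hB hC]; split=> [j jK x xB|x xC]; last by apply: hC; exact: crit_C_le xC.
case: ltnP => [jJ|Jj]; first exact: hB.
rewrite mulr0n hC //; apply: crit_B_C xB => //; exact: le_len_trans Kl.
Qed.

Lemma acts_as_common phi psi : Nring len B C phi -> Nring len B C psi ->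
  exists J r s, [/\ le_len J len, acts_as J r phi & acts_as J s psi].
Proof.
move=> /NringP[J [r [Jl hr]]] /NringP[K [s [Kl hs]]].
have Ml := le_len_max Jl Kl.
by do 3!eexists; split; [exact: Ml | exact: acts_as_extend (leq_maxl _ _) Ml hr
  | exact: acts_as_extend (leq_maxr _ _) Ml hs].
Qed.

Lemma Nring_subring : is_subring (Nring len B C).
Proof.
split.
- apply/NringP; exists 0%N, (fun=> 0%N); split; first by case: len.
  by split.
- move=> phi psi h1 h2; have [J [r [s [Jl hr hs]]]] := acts_as_common h1 h2.
  have [c hc] := crit_exponent.
  apply/NringP; exists J, (fun j => r j + s j * (p j ^ c j).-1)%N; split=> //.
  have [r1 r2] := hr; have [s1 s2] := hs; split=> [j jJ x xB|x xC]; last first.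
    by rewrite endoBE r2 // s2 // subrr.
  have jl : le_len j.+1 len by apply: le_len_trans Jl.
  have xc := hc j jl x xB.
  rewrite endoBE (r1 _ jJ _ xB) (s1 _ jJ _ xB) mulrnDr; congr (_ + _); apply/esym/eqP; rewrite -addr_eq0 -mulrnDr.
  rewrite addnC -mulnS prednK ?expn_gt0 ?prime_gt0 ?crit_prime //.
  by rewrite mulnC mulrnA xc mul0rn.
- move=> phi psi h1 h2; have [J [r [s [Jl hr hs]]]] := acts_as_common h1 h2.
  apply/NringP; exists J, (fun j => s j * r j)%N; split=> //.
  have [r1 r2] := hr; have [s1 s2] := hs; split=> [j jJ x xB|x xC]; last first.
    by rewrite endoME s2 // endo0.
  by rewrite endoME (s1 _ jJ _ xB) endoMn (r1 _ jJ _ xB) -mulrnA mulnC.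
Qed.

Lemma crit_proj i : le_len i.+1 len -> exists rho : endo A,
  [/\ forall x, x \in B i -> rho x = x, forall x, crit_rest i x -> rho x = 0,
      forall x, rho x \in B i, forall x, crit_rest i (x - rho x)
    & forall n, inertial (rho *+ n)].
Proof.
move=> il; have [c hc] := crit_exponent.
have sB := subg_zmod (B i); have sE := subg_crit_rest i.
have [rho [r1 r2 r3 r4]] := direct_sum_proj sB sE (crit_rest_direct il).
exists rho; split=> // n.
pose q : primeT := Sub (p i) (crit_prime il).
by apply: (@proj_inertial A q [set` B i] (crit_rest i) (c i)) => //;
  [exact: hc | exact: crit_rest_socle].
Qed.

Lemma acts_as_inertial J r phi : le_len J len -> acts_as J r phi -> inertial phi.
Proof.
elim: J phi => [|J IH] phi Jl [hB hC].
  suff -> : phi = 0 by exact: inertial0.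
  by apply: endo_ext => x; apply: hC; exact: crit_C0.
have [rho [r1 r0 _ _ ip]] := crit_proj Jl.
rewrite -(subrK (rho *+ r J) phi); apply: inertialD; last exact: ip.
apply: IH; first exact: le_len_trans Jl.
split=> [j jJ x xB|x xC].
  rewrite endoBE (hB _ (ltnW (jJ : (j.+1 <= J)%N)) _ xB).
  rewrite endoMnE r0 ?mul0rn ?subr0 //.
  by apply: crit_rest_sum; exact: sum_first_mem xB.
have [e _] := crit_split cs Jl.
have : [set` C J] x by []; rewrite e => -[b Bb [c Cc <-]].
have -> : (phi - rho *+ r J) (b + c) =
    (phi b - (rho *+ r J) b) + (phi c - (rho *+ r J) c) by rewrite endoBE !endoD; abel.
rewrite (hB _ (ltnSn J) _ Bb) hC // !endoMnE r1 // r0 ?mul0rn ?subrr ?addr0 //.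
exact: crit_rest_C.
Qed.

Lemma Nring_inertial phi : Nring len B C phi -> inertial phi.
Proof. by move=> /NringP[J [r [Jl h]]]; exact: acts_as_inertial h. Qed.

Lemma Nring_mini phi : Nring len B C phi -> mini_mult phi.
Proof.
move=> [J [n [Jl hB hC]]]; have [Z eZ] := zmod_of_subg (subg_sum_first J).
exists [pred q | q \in [seq p j | j <- iota 0 J]], Z, (C J), n; rewrite eZ; split=> //.
exact: (crit_oplus cs Jl).
Qed.

(** By the Chinese remainder theorem, some integer acts as k on B i and as 0 on the earlier
    groups. *)
Lemma Nring_single i (k : nat) : le_len i.+1 len -> exists nu, [/\ Nring len B C nu,
  forall x, x \in B i -> nu x = x *+ k & forall x, crit_rest i x -> nu x = 0].
Proof.
move=> il; have [nu h [n hn]] := acts_as_exists (fun j => if j == i then k else 0%N) il.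
exists nu; split; first by apply/NringP; do 2!eexists; split; last exact: h.
- by move=> x xB; have [h1 _] := h; rewrite (h1 i) // eqxx.
- have [h1 h2] := h; move=> _ [s Ss [c Cc <-]]; rewrite endoD (h2 _ Cc) addr0.
  have sK : subgroup (nu @^-1` [set 0]) by apply: subg_preim; exact: subg_set0.
  apply: (sum_first_min sK) Ss => j x ji xB; rewrite /preimage /mkset (h1 j (leqW ji) x xB).
  by rewrite ltn_eqF.
Qed.

End CriticalSequence.

(** * Inertial endomorphisms with periodic image *)

Section FiniteImages.
Variables (T : Type) (V : zmodType) (S : set T).

Lemma finite_imageB (f g : T -> V) : finite_set (f @` S) -> finite_set (g @` S) ->
  finite_set ((fun a => f a - g a) @` S).
Proof. exact: (finite_image11 (fun a b => a - b)). Qed.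

Lemma finite_imageD (f g : T -> V) : finite_set (f @` S) -> finite_set (g @` S) ->
  finite_set ((fun a => f a + g a) @` S).
Proof. exact: (finite_image11 (fun a b => a + b)). Qed.

Lemma finite_image_sum (I : eqType) (s : seq I) (f : I -> T -> V) :
  (forall i, i \in s -> finite_set (f i @` S)) ->
  finite_set ((fun a => \sum_(i <- s) f i a) @` S).
Proof.
elim: s => [|i s IH] h.
  by apply: sub_finite_set (finite_set1 (0 : V)) => _ [a _ <-]; rewrite big_nil.
have fs : finite_set ((fun a => \sum_(i <- s) f i a) @` S).
  by apply: IH => j js; apply: h; rewrite in_cons js orbT.
apply: sub_finite_set (finite_imageD (h i (mem_head _ _)) fs) => _ [a Sa <-].
by exists a => //; rewrite big_cons.
Qed.

End FiniteImages.

(** If n is prime to q and n a is in F, then nu a is in the finite group nu(F), being killed by a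
    power of q and by n modulo nu(F). *)
Lemma finite_coprime_image (A : zmodType) (F : set A) (nu : endo A) q c : full_lattice F ->
  prime q -> (forall x, nu x *+ q ^ c = 0) ->
  finite_set (nu @` [set a | exists2 n, coprime q n & F (a *+ n)]).
Proof.
move=> [sF [s FE] _ _] qp hnu; have s0 := @subg_set0 A.
have fF : finite_set (nu @` F).
  apply/fin_mod0; apply: fin_mod_subr (fin_mod_gens_torsion (map nu s) s0) => _ [x Fx <-]; split.
    have sP : subgroup (nu @^-1` gens [set 0] (map nu s)) by apply: subg_preim; exact: subg_gens.
    move: Fx; rewrite FE; apply: (gens_min sP).
      by move=> _ ->; rewrite /preimage /mkset endo0; exact: subg0 (subg_gens _ s0).
    by move=> y ys; apply: gens_mem => //; exact: map_f.
  by exists (q ^ c)%N; [rewrite expn_gt0 prime_gt0 | exact: hnu].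
apply: sub_finite_set fF => _ [a [n cop Fn] <-].
have sN : subgroup (nu @` F) by exact: subg_image.
have h1 : (nu @` F) (nu a *+ n) by exists (a *+ n); rewrite ?endoMn.
have h2 : (nu @` F) (nu a *+ q ^ c) by rewrite hnu; exact: subg0 sN.
by have := subg_gcd sN h2 h1; rewrite (eqP (coprimeXl c cop)).
Qed.

Lemma subringD (R : pzRingType) (S : set R) x y : is_subring S -> S x -> S y -> S (x + y).
Proof.
by move=> [S0 SB _] Sx Sy; rewrite -[y]opprK -[- y]sub0r; apply: (SB) => //; exact: (SB).
Qed.

Lemma subring_sum (R : pzRingType) (S : set R) (I : Type) (r : seq I) (f : I -> R) :
  is_subring S -> (forall i, S (f i)) -> S (\sum_(i <- r) f i).
Proof.
move=> h Sf; elim: r => [|i r IH]; rewrite ?big_nil ?big_cons; first by case: h.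
exact: subringD.
Qed.

Section Decomposition.
Variables (A : zmodType) (len : option nat) (p : nat -> nat) (B C : nat -> zmodClosed A).
Hypotheses (fr : finite_tf_rank A) (cs : critical_sequence len p B C).
Variable F : zmodClosed A.
Hypotheses (lF : full_lattice [set` F]) (freeF : free_abelian [set` F]).
Hypothesis perP : periodic [set: {quot F}].
Local Notation pi := (\pi_({quot F})%qT).

(** On the p-component, an element of N makes up for the difference between the scalars on
    the bounded and on the divisible part. *)
Lemma component_correction (phi : endo A) (psi : endo {quot F}) (q : primeT) :
  inertial psi -> (forall x, psi (pi x) = pi (phi x)) ->
  exists nu alpha c, [/\ Nring len B C nu, forall x, nu x *+ q ^ c = 0
    & finite_set ((fun a => pi (phi a) - pi (nu a) - jact perP alpha (pi a)) @`
        [set a | pprim {quot F} q (pi a)])].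
Proof.
move=> ip psiE; have pp := prime_primeT q.
have [alpha [fin|[k [div fsoc nz nfin [scal [beta fbeta]]]]]] := pprim_structure q perP ip.
  exists 0, alpha, 0%N; split=> //; first by have [] := Nring_subring cs.
  apply: sub_finite_set fin => _ [a ha <-]; exists (pi a) => //.
  by rewrite endoBE psiE endo0E raddf0 subr0.
set D := multiples _ _ in div fsoc nz nfin scal fbeta.
have sD : subgroup D by apply: subg_multiples; exact: subg_pprim.
have DS : D `<=` pprim {quot F} q by apply: multiples_sub; exact: subg_pprim.
have qc : (q : nat) \in pi_c A by exact: (pi_c_witness _ div fsoc nz nfin).
have [i il qi] := (crit_enum cs q).1 qc.
have [c hc] := crit_exponent cs; have {hc} Bc := hc i il.
have [nu [nuN nuB nuE]] := Nring_single cs (jrep (beta - alpha) (q ^ c i)) il.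
have [rho [r1 r2 r3 r4 _]] := crit_proj fr cs il.
rewrite -qi in Bc.
have nurho x : nu x = rho x *+ jrep (beta - alpha) (q ^ c i).
  by rewrite -[in LHS](subrK (rho x) x) endoD nuE // add0r nuB.
have nuk x : nu x *+ q ^ c i = 0 by rewrite nurho mulrnAC Bc ?r3 // mul0rn.
exists nu, alpha, (c i); split=> //.
pose d a := pi (phi a) - pi (nu a) - jact perP alpha (pi a).
have dD x y : d (x + y) = d x + d y.
  have e1 : pi (phi x + phi y) = pi (phi x) + pi (phi y) by exact: (raddfD pi).
  have e2 : pi (nu x + nu y) = pi (nu x) + pi (nu y) by exact: (raddfD pi).
  have e3 : pi (x + y) = pi x + pi y by exact: (raddfD pi).
  by rewrite /d !endoD e1 e2 e3 endoD; abel.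
have d0 : d 0 = 0 by apply: (addrI (d 0)); rewrite -dD !addr0.
have dMn x n : d (x *+ n) = d x *+ n by elim: n => [|n IH]; rewrite ?mulr0n // !mulrSr dD IH.
have torsB x : rho x *+ q ^ c i = 0 by rewrite Bc.
have pcx x k' : pi x *+ q ^ k' = 0 -> pprim {quot F} q (pi x) by move=> e; apply/pprimP; exists k'.
have Sq a : pprim {quot F} q (pi a) ->
    pprim {quot F} q (pi (rho a)) /\ pprim {quot F} q (pi (a - rho a)).
  move=> Sa; have h : pprim {quot F} q (pi (rho a)).
    by apply: (pcx _ (c i)); rewrite -raddfMn torsB raddf0.
  by split=> //; rewrite raddfB; apply: subgB => //; exact: subg_pprim.
(* on B i the two scalars cancel, modulo the finite layer of D killed by q^c *)
have fB : finite_set ((d \o rho) @` [set: A]).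
  have fl : finite_set [set x | D x /\ x *+ q ^ c i = 0].
    by apply: finite_layer fsoc => //.
  apply/fin_mod0; apply: (fin_mod_sub_refine sD).
    apply: fin_mod_subr fbeta => _ [a _ <-]; exists (pi (rho a)).
      by apply: (pcx _ (c i)); rewrite -raddfMn torsB raddf0.
    have e : jact perP (beta - alpha) (pi (rho a)) = pi (nu (rho a)).
      have e0 : pi (rho a) *+ q ^ c i = 0 by rewrite -raddfMn torsB raddf0.
      have q0 : (0 < q ^ c i)%N by rewrite expn_gt0 prime_gt0.
      by rewrite nuB // raddfMn (jactE perP _ q0 e0).
    have -> : (d \o rho) a = d (rho a) by [].
    by rewrite endoBE psiE /d -e jactB; abel.
  apply/fin_mod0; apply: sub_finite_set fl => _ [_ [_ [[a _ <-] [b _ <-] Dab ->]]]; split=> //.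
  have dk x : d (rho x) *+ q ^ c i = 0 by rewrite -dMn torsB.
  by rewrite /= mulrnBl !dk subrr.
(* the other summand is, up to a finite group, mapped into D *)
pose X := pi @` [set e | crit_rest B C i e /\ pprim {quot F} q (pi e)].
have sX : subgroup X.
  have sE := subg_crit_rest B C i.
  exact: (subg_image pi (subgI sE (subg_preim pi (subg_pprim _ q)))).
have fXsoc : finite_set [set x | X x /\ x *+ q = 0].
  apply/fin_mod0.
  have soc : fin_mod [set` F] [set x | crit_rest B C i x /\ [set` F] (x *+ q)].
    apply: (@summand_socle A q [set` B i] (crit_rest B C i) (c i) rho) => //.
    - exact: subg_crit_rest.
    - by have := crit_rest_socle cs il; rewrite -qi.
  have f1 : fin_mod [set 0] (pi @` [set x | crit_rest B C i x /\ [set` F] (x *+ q)]).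
    by apply: fin_mod_imageW soc _ => x Fx; apply/quot_eq0.
  apply: fin_mod_subr f1 => _ [[e [Ee _] <-] e0]; exists e => //; split=> //.
  by apply/quot_eq0; rewrite raddfMn.
have DX : D `<=` X.
  move=> x Dx; have [y Dy <-] := pdivisible_pow div (c i) Dx.
  have [a ea] := quot_surj y; exists (a *+ q ^ c i); last by rewrite raddfMn /= -ea.
  split.
    have -> : a *+ q ^ c i = (a - rho a) *+ q ^ c i by rewrite mulrnBl torsB subr0.
    exact: subgMn (subg_crit_rest B C i) (r4 a).
  by rewrite raddfMn /= -ea; apply: subgMn; [exact: subg_pprim | exact: DS].
have fXD : fin_mod D X.
  exists [set x | X x /\ x *+ q ^ k = 0]; first exact: finite_layer fXsoc.
  move=> x Xx; have [e [_ Se] ex] := Xx.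
  have Dk : D (x *+ q ^ k) by exists x => //; rewrite -ex.
  have [y Dy ey] := pdivisible_pow div k Dk.
  exists (x - y); last by rewrite subKr.
  split; first by apply: subgB => //; exact: DX.
  by rewrite mulrnBl ey subrr.
have fE : finite_set ((psi - jact perP alpha) @` X).
  apply/fin_mod0; apply: fin_mod_imageW fXD _ => x Dx.
  by change ((psi - jact perP alpha) x = 0); rewrite endoBE scal // subrr.
have fsum := finite_image2 +%R fB fE.
apply: sub_finite_set fsum => _ [a Sa <-].
exists (d (rho a)); first by exists a.
exists (d (a - rho a)); last by rewrite -dD addrC subrK.
have [_ S2] := Sq a Sa; exists (pi (a - rho a)); first by exists (a - rho a).
by rewrite endoBE psiE /d nuE // raddf0 subr0.
Qed.

Lemma subg_coprime (G : set A) q : subgroup G ->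
  subgroup [set a | exists2 n, coprime q n & G (a *+ n)].
Proof.
move=> sG; split; first by exists 1%N; rewrite ?coprimen1 ?mul0rn //; exact: subg0.
move=> x y [n cn Gn] [m cm Gm]; exists (n * m)%N; first by rewrite coprimeMr cn.
rewrite mulrnBl; apply: subgB => //; first by rewrite mulrnA; exact: subgMn.
by rewrite mulnC mulrnA; exact: subgMn.
Qed.

Lemma subg_primary_preim (q : primeT) : subgroup [set a | pprim {quot F} q (pi a)].
Proof. exact: (subg_preim pi (subg_pprim _ q)). Qed.

Lemma decompose_over (phi : endo A) : inertial phi -> (forall x, x \in F -> phi x = 0) ->
  exists nu alpha, [/\ Nring len B C nu, periodic (range nu)
    & unif [set` F] (phi - nu) alpha].
Proof.
move=> ip hF.
have [psi psiE] : exists psi : endo {quot F}, forall x, psi (pi x) = pi (phi x).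
  by apply: quot_endo => x /hF ->; exact: rpred0.
have ips := quot_inertial psiE ip.
have [alpha0 fin0] := almost_all_scalar perP ips.
have [s sE] : exists s : seq primeT, [set q : primeT | exists2 x, pprim {quot F} q x &
    psi x <> jact perP alpha0 x] = [set` s] by apply/finite_seqP.
pose good (q : primeT) (t : endo A * padics * nat) :=
  [/\ Nring len B C t.1.1, forall x, t.1.1 x *+ q ^ t.2 = 0
    & finite_set ((fun a => pi (phi a) - pi (t.1.1 a) - jact perP t.1.2 (pi a)) @`
        [set a | pprim {quot F} q (pi a)])].
have /boolp.choice[T hT] q : exists t, good q t.
  have [nu [al [c h]]] := component_correction q ips psiE.
  by exists (nu, al, c).
pose nu q := (T q).1.1.
have nuN q : Nring len B C (nu q) by have [] := hT q.
have nuk q x : nu q x *+ q ^ (T q).2 = 0 by have [_ + _] := hT q; apply.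
pose us := undup s; pose Nu := \sum_(q <- us) nu q.
have NuE a : Nu a = \sum_(q <- us) nu q a.
  rewrite /Nu; elim: (us) => [|q r IH]; first by rewrite !big_nil endo0E.
  by rewrite !big_cons endoDE IH.
pose alpha : padics := fun q => if q \in s then (T q).1.2 q else alpha0 q.
exists Nu, alpha; split.
- exact: subring_sum (Nring_subring cs) nuN.
- move=> _ [a _ <-] /=; rewrite NuE; apply: rpred_sum => q _; apply/torsionP.
  by exists ((q : primeT) ^ (T q).2)%N => //; rewrite expn_gt0 prime_gt0 ?prime_primeT.
apply/(unif_quotP perP); set d := fun a => _.
have dE a : d a = psi (pi a) - \sum_(q <- us) pi (nu q a) - jact perP alpha (pi a).
  have e : pi ((phi - Nu) a) = psi (pi a) - pi (Nu a).
    by rewrite endoBE psiE; exact: (raddfB pi).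
  have e' : pi (Nu a) = \sum_(q <- us) pi (nu q a) by rewrite NuE; exact: (raddf_sum pi).
  by rewrite /d e e'.
have dD x y : d (x + y) = d x + d y.
  have e3 : pi (x + y) = pi x + pi y by exact: (raddfD pi).
  have e4 : pi ((phi - Nu) (x + y)) = pi ((phi - Nu) x) + pi ((phi - Nu) y).
    by rewrite endoD; exact: (raddfD pi).
  by rewrite /d e3 e4 endoD; abel.
have sF := subg_zmod F.
pose cop (q : primeT) := [set a | exists2 n, coprime q n & [set` F] (a *+ n)].
have fcop q : finite_set ((fun a => pi (nu q a)) @` cop q).
  have := finite_coprime_image lF (prime_primeT q) (nuk q) => /(finite_image pi).
  by rewrite image_comp.
have prcop (q q' : primeT) a : q != q' -> pprim {quot F} q (pi a) -> cop q' a.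
  move=> ne /pprimP[k e]; exists (q ^ k)%N; last by apply/quot_eq0; rewrite raddfMn.
  apply: coprimeXr; rewrite prime_coprime ?prime_primeT //.
  by rewrite dvdn_prime2 ?prime_primeT // eq_sym.
have jalpha q be x : alpha q = be q -> pprim {quot F} q x -> jact perP alpha x = jact perP be x.
  by move=> e /pprimP[k xk]; exact: jact_pprim_eq e xk.
(* the values of d on all components of the quotient lie in one finite group W *)
pose W0 q := d @` [set a | pprim {quot F} q (pi a)].
pose W1 q := (fun a => pi (nu q a)) @` cop q.
pose W := foldr (fun q X => sumset (sumset (W0 q) (W1 q)) X) [set 0] us.
have fW0 q : q \in us -> finite_set (W0 q).
  move=> qs; have [_ _ f1] := hT q.
  have f2 : finite_set ((fun a => \sum_(q' <- rem q us) pi (nu q' a)) @`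
      [set a | pprim {quot F} q (pi a)]).
    apply: finite_image_sum => q' q's; apply: sub_finite_set (fcop q') => _ [a ha <-].
    exists a => //; apply: prcop ha; rewrite eq_sym.
    by move: q's; rewrite mem_rem_uniq ?undup_uniq // => /andP[].
  apply: sub_finite_set (finite_imageB f1 f2) => _ [a ha <-]; exists a => //.
  have er : \sum_(q' <- us) pi (nu q' a) = pi (nu q a) + \sum_(q' <- rem q us) pi (nu q' a).
    by rewrite (big_rem q qs).
  have ej : jact perP alpha (pi a) = jact perP (T q).1.2 (pi a).
    by apply: jalpha ha; rewrite /alpha -mem_undup qs.
  by rewrite dE psiE er ej opprD addrA; exact: addrAC.
have fW : finite_set W.
  rewrite /W; move: (us) fW0; elim=> [|q r IH] fW0 /=; first exact: finite_set1.
  apply: finite_image2; last by apply: IH => q' q'r; apply: fW0; rewrite in_cons q'r orbT.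
  by apply: finite_image2; [apply: fW0; exact: mem_head | exact: fcop].
have sW0 q : subgroup (W0 q).
  have dB x y : d (x - y) = d x - d y by apply/eqP; rewrite -subr_eq0 -{2}(subrK y x) dD; apply/eqP; abel.
  have sp := subg_primary_preim q; split.
    by exists 0; [exact: subg0 sp | rewrite -(subrr 0) dB subrr].
  by move=> _ _ [x hx <-] [y hy <-]; exists (x - y); [exact: subgB sp hx hy | rewrite dB].
have sW1 q : subgroup (W1 q).
  have := subg_image pi (subg_image (nu q) (subg_coprime q sF)).
  by rewrite image_comp.
have sWr r : subgroup (foldr (fun q X => sumset (sumset (W0 q) (W1 q)) X) [set 0] r).
  by elim: r => [|q r IH] /=; [exact: subg_set0 | apply: subg_sumset => //; exact: subg_sumset].
have sW : subgroup W by exact: sWr.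
have inW q x : q \in us -> sumset (W0 q) (W1 q) x -> W x.
  rewrite /W; elim: (us) => [|q' r IH] //=; rewrite in_cons => /orP[/eqP <- | qr] h.
    exact: (sumset_subl (subg0 (sWr r))).
  exact: (sumset_subr (subg0 (subg_sumset (sW0 q') (sW1 q'))) (IH qr h)).
have W_sum a : (forall q, q \in us -> cop q a) -> W (\sum_(q <- us) pi (nu q a)).
  move=> h; rewrite big_seq; apply: (big_ind W); first exact: subg0.
    by move=> x y; exact: subgD.
  move=> q qs; apply: (inW q) => //; apply: sumset_subr; first exact: subg0 (sW0 q).
  by exists a => //; exact: h.
apply: sub_finite_set fW => _ [a _ <-].
have /torsionP[n n0 nx] := perP I : pi a \in torsion {quot F}.
pose K := [set x | forall b, pi b = x -> W (d b)].
suff : K (pi a) by apply.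
apply: (primary_ind n0 nx).
- move=> b b0; rewrite dE b0 !endo0 sub0r subr0; apply: subgN => //; apply: W_sum => q _.
  by exists 1%N; rewrite ?coprimen1 //; apply/quot_eq0.
- move=> y z Ky Kz b e; have [c ec] := quot_surj y.
  rewrite -(subrK c b) addrC dD; apply: subgD => //; first exact: Ky.
  apply: Kz; have -> : pi (b - c) = pi b - pi c by exact: (raddfB pi).
  by rewrite e ec; abel.
move=> q0 k j pq e b eb; pose q : primeT := exist _ q0 pq.
have qb : pprim {quot F} q (pi b) by apply/pprimP; exists k; rewrite eb.
have [qs|nqs] := boolP (q \in us).
  by apply: (inW q) => //; apply: sumset_subl; [exact: subg0 (sW1 q) | exists b].
have nqs' : q \notin s by rewrite -mem_undup.
have e1 : psi (pi b) = jact perP alpha0 (pi b).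
  apply: contrapT => ne; have : [set` s] q by rewrite -sE; exists (pi b).
  by move=> /= qs; rewrite qs in nqs'.
rewrite dE e1 (@jalpha q alpha0) //; last by rewrite /alpha (negbTE nqs').
rewrite addrAC subrr sub0r; apply: subgN => //; apply: W_sum => q' q's.
by apply: prcop qb; apply: contraNneq nqs => ->.
Qed.

End Decomposition.

(** On almost all components of the quotient by a lattice in its kernel, phi acts as one alpha;
    the remaining components are corrected by elements of N, one for each of these primes. *)
Theorem periodic_decomposition (A : zmodType) len p (B C : nat -> zmodClosed A) (phi : endo A) :
  finite_tf_rank A -> critical_sequence len p B C -> inertial phi -> periodic (range phi) ->
  exists2 nu, Nring len B C nu & uniform (phi - nu).
Proof.
move=> fr cs ip per; have [F [lF freeF F0]] := lattice_in_kernel fr per.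
have [Z ZF] := zmod_of_subg (let: And4 sF _ _ _ := lF in sF).
rewrite -ZF in lF freeF F0.
have perP : periodic [set: {quot Z}] by apply/quot_periodic; have [] := lF.
have [nu [al [nuN nuper u]]] := decompose_over fr cs lF freeF perP ip F0.
exists nu => //; apply/(uniformP _ fr lF); split; last by exists al.
  by apply: inertialB ip _; exact: (Nring_inertial fr cs).
move=> _ [a _ <-]; rewrite endoBE; apply: rpredB; [apply: per | apply: nuper]; by exists a.
Qed.

(** * The ring N *)

(** The least annihilator divides p^c. *)
Lemma power_bound (V : zmodType) (S : set V) p c : prime p ->
  (forall x, S x -> x *+ p ^ c = 0) -> exists e, is_bound S (p ^ e)%N.
Proof.
move=> pp Sc; have kc : killed_by S (p ^ c)%N by split; [rewrite expn_gt0 prime_gt0 | exact: Sc].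
have ex : exists n, `[< killed_by S n >] by exists (p ^ c)%N; apply/asboolP.
have [n /asboolP[n0 kn] minn] := ex_minnP ex.
have ndv : (n %| p ^ c)%N.
  have kg : killed_by S (gcdn n (p ^ c)).
    split; first by rewrite gcdn_gt0 n0.
    by move=> x Sx; apply: (subg_gcd (@subg_set0 V)); [exact: kn | exact: Sc].
  have e : gcdn n (p ^ c) = n.
    by apply/eqP; rewrite eqn_leq dvdn_leq ?dvdn_gcdl //= minn //; exact/asboolP.
  by rewrite -e dvdn_gcdr.
have /(dvdn_pfactor _ _ pp)[k _ nE] := ndv; exists k.
by rewrite -nE; split=> // m km; apply: minn; apply/asboolP.
Qed.

Section CriticalComponents.
Variables (A : zmodType) (len : option nat) (p : nat -> nat) (B C : nat -> zmodClosed A).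
Hypotheses (fr : finite_tf_rank A) (cs : critical_sequence len p B C).
Variable j : nat.
Hypothesis jl : le_len j.+1 len.
Let q : primeT := Sub (p j) (crit_prime cs jl).
Let pp : prime (p j) := crit_prime cs jl.

(** If B j vanished, the p-component of A/F would have finite socle, so that its bounded
    summands would be finite. *)
Lemma crit_B_neq0 : exists2 x, x \in B j & x <> 0.
Proof.
apply: contrapT => h; have B0 x : x \in B j -> x = 0.
  by move=> xB; apply: contrapT => x0; apply: h; exists x.
have : p j \in pi_c A by apply/(crit_enum cs); exists j.
rewrite inE => /andP[_ /asboolP[F [B' [D' [[freeF perF] [dAp _] [infB bdB] _]]]]].
have lF : full_lattice [set` F].
  by apply: free_full_lattice => //; [exact: subg_zmod | apply/quot_periodic].
have [c hc] := crit_exponent cs; have Bc := hc j jl.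
have [rho [r1 r2 r3 r4 _]] := crit_proj fr cs jl.
have soc : fin_mod [set` F] [set x | crit_rest B C j x /\ [set` F] (x *+ p j)].
  apply: (@summand_socle A q [set` B j] (crit_rest B C j) (c j) rho) => //.
  - exact: subg_crit_rest.
  - exact: (crit_rest_socle cs jl).
have restT x : crit_rest B C j x by have := r4 x; rewrite (B0 _ (r3 x)) subr0.
have f1 : finite_set [set y : {quot F} | [set: {quot F}] y /\ y *+ p j = 0].
  apply/fin_mod0; have h1 : fin_mod [set 0] (\pi_({quot F})%qT @` [set x | crit_rest B C j x /\ [set` F] (x *+ p j)]).
    by apply: fin_mod_imageW soc _ => x Fx; apply/quot_eq0.
  apply: fin_mod_subr h1 => y [_ yp]; have [x ex] := quot_surj y; exists x => //; split=> //.
  by apply/quot_eq0; rewrite raddfMn /= -ex.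
have B'Ap x : x \in B' -> exists k, x *+ p j ^ k = 0.
  move=> xB; apply/(pipartP _ pp); suff : [set` pipart {quot F} (p j)] x by [].
  by rewrite dAp; exists x => //; exists 0; rewrite ?addr0 //; exact: rpred0.
have [k hk] := bounded_pprim pp bdB B'Ap.
suff /infB : finite_set [set` B'] by [].
have f2 := finite_layer k (@subgT _) f1.
by apply: sub_finite_set f2 => x xB; split=> //; exact: hk.
Qed.

Lemma crit_comp x : x \in pipart A (p j) -> exists b e,
  [/\ x = b + e, b \in B j, e \in C j.+1 & e \in pipart A (p j)].
Proof.
move=> xA; have [bd sub] := crit_bounded cs jl; have [e _] := crit_rest_direct cs jl.
have : [set: A] x by []; rewrite e => -[b bB [f hf ef]].
have fA : f \in pipart A (p j).
  have -> : f = x - b by rewrite -ef; abel.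
  by rewrite rpredB //; exact: sub.
exists b, f; split=> //; have /(pipartP _ pp)[k fk] := fA.
exact: (crit_rest_primary cs jl hf fk).
Qed.

(** A divisible subgroup D of the p-component is in C j.+1, because D = p^c D and p^c kills B j;
    and the p-component of C j.+1 is divisible. *)
Lemma crit_maxdiv : exists2 D : zmodClosed A, is_maxdiv [set` pipart A (p j)] D &
  forall x, x \in D <-> x \in C j.+1 /\ x \in pipart A (p j).
Proof.
have [c hc] := crit_exponent cs; have Bc := hc j jl.
have [_ _ _ _ [divC _]] := crit_oplus cs jl.
have [D0 eD0] := zmod_of_subg (subgI (subg_zmod (C j.+1)) (subg_zmod (pipart A (p j)))).
have D0E x : x \in D0 <-> x \in C j.+1 /\ x \in pipart A (p j).
  have : [set` D0] x <-> ([set` C j.+1] `&` [set` pipart A (p j)]) x by rewrite eD0.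
  by [].
have D0p x : [set` D0] x -> exists k, x *+ p j ^ k = 0 by move=> /D0E[_ /(pipartP _ pp)].
have divD0 x : [set` D0] x -> multiples [set` D0] (p j) x.
  move=> xD; have [xC xA] := (D0E x).1 xD.
  have [||y [yC _] ey] := divC (p j) x; first exact: prime_gt0.
    split=> //; have /(pipartP _ pp)[k xk] := xA.
    apply/asboolP; exists (p j ^ k)%N => //.
    rewrite pnatX; apply/orP; left; rewrite pnatE //.
    change (p j \in [seq p i | i <- iota 0 j.+1]).
    by apply: map_f; rewrite mem_iota; lia.
  exists y => //; apply/D0E; split=> //; apply/(pipartP _ pp).
  have /(pipartP _ pp)[k xk] := xA; exists k.+1.
  by rewrite expnS mulrnA ey.
exists D0 => //; split; first by move=> x /D0E[].
  by move=> n x n0 xD; exact: (pdivisible_divisible pp (subg_zmod D0) D0p divD0).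
move=> D DA divD x xD; apply/D0E; have xA := DA x xD; split=> //.
have [|y yD ey] := divD (p j ^ c j)%N x _ xD; first by rewrite expn_gt0 prime_gt0.
have [b [e [ye bB eC _]]] := crit_comp (DA y yD).
by rewrite -ey ye mulrnDl Bc // add0r rpredMn.
Qed.

Lemma crit_bound (D : zmodClosed A) n : is_maxdiv [set` pipart A (p j)] D ->
  killed_by (mod_sub D [set` pipart A (p j)]) n <-> killed_by [set` B j] n.
Proof.
have [D0 [D0A div0 max0] D0E] := crit_maxdiv => -[DA divD maxD].
have {}D0E x : x \in D <-> x \in C j.+1 /\ x \in pipart A (p j).
  by rewrite -D0E; split=> [/(max0 _ DA divD)|/(maxD _ D0A div0)].
have [_ sub] := crit_bounded cs jl; have [_ dis] := crit_rest_direct cs jl.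
split=> -[n0 h]; split=> // x.
  move=> xB; have : ([set` B j] `&` crit_rest B C j) (x *+ n); last by rewrite dis.
  split; first exact: rpredMn.
  apply: crit_rest_C; suff : x *+ n \in D by case/D0E.
  by apply/quot_eq0; rewrite raddfMn; apply: h; exists x => //; exact: sub.
move=> [y yA <-]; rewrite -raddfMn; apply/quot_eq0.
have [b [e [-> bB eC eA]]] := crit_comp yA.
by rewrite mulrnDl h // add0r; apply/D0E; split; exact: rpredMn.
Qed.

Lemma crit_c_exp : (0 < c_exp A (p j))%N /\ is_bound [set` B j] (p j ^ c_exp A (p j))%N.
Proof.
have [c hc] := crit_exponent cs; have Bc := hc j jl.
have [k bk] := power_bound pp Bc.
have [D0 mD0 _] := crit_maxdiv.
have bound D m : is_maxdiv [set` pipart A (p j)] D ->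
    is_bound (mod_sub D [set` pipart A (p j)]) m <-> is_bound [set` B j] m.
  move=> mD; split=> -[km mm]; split; first exact/(crit_bound _ mD).
  - by move=> m' /(crit_bound _ mD); exact: mm.
  - exact/(crit_bound _ mD).
  - by move=> m' /(crit_bound _ mD); exact: mm.
have [|D mD bD] := @xgetPex _ 0%N [set c | exists2 D : zmodClosed A,
    is_maxdiv [set` pipart A (p j)] D
    & is_bound (mod_sub D [set` pipart A (p j)]) (p j ^ c)%N].
  by exists k, D0 => //; apply/bound.
have {}bD := (bound D _ mD).1 bD; split=> //.
rewrite lt0n; apply/eqP => e; have [x xB []] := crit_B_neq0.
have [[_ h] _] := bD; have := h x xB; move: e; rewrite /c_exp => ->.
by rewrite expn0 mulr1n.
Qed.

Lemma crit_annihilator n : (forall x, x \in B j -> x *+ n = 0) <-> (p j ^ c_exp A (p j) %| n)%N.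
Proof.
have [_ [[k0 kB] mB]] := crit_c_exp; set m := (p j ^ _)%N in k0 kB mB *.
split=> [h|/dvdnP[k ->] x xB]; last by rewrite mulnC mulrnA kB // mul0rn.
have kg : killed_by [set` B j] (gcdn m n).
  split; first by rewrite gcdn_gt0 k0.
  by move=> x xB; apply: (subg_gcd (@subg_set0 A)); [exact: kB | exact: h].
have e : gcdn m n = m.
  by apply/eqP; rewrite eqn_leq dvdn_leq ?dvdn_gcdl //= mB.
by rewrite -e dvdn_gcdr.
Qed.

End CriticalComponents.

Section NringIso.
Variables (A : zmodType) (len : option nat) (p : nat -> nat) (B C : nat -> zmodClosed A).
Hypotheses (fr : finite_tf_rank A) (cs : critical_sequence len p B C).
Implicit Types (phi psi : endo A) (q : primeT).
Local Notation c := (c_exp A).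

Definition acts_mod phi q (z : 'Z_(q ^ c q)) : Prop :=
  exists j, [/\ le_len j.+1 len, p j = q & forall x, x \in B j -> phi x = x *+ (z : nat)].

Let mod_gt1 j q : le_len j.+1 len -> p j = q -> (1 < q ^ c q)%N.
Proof.
move=> jl <-; have [c0 _] := crit_c_exp fr cs jl.
by rewrite -(exp1n (c (p j))) ltn_exp2r // prime_gt1 // (crit_prime cs jl).
Qed.

Lemma acts_mod_unique phi q (z z' : 'Z_(q ^ c q)) : acts_mod phi z -> acts_mod phi z' -> z = z'.
Proof.
move=> [j [jl pj h]] [i [il pi h']].
have ij : i = j by apply: (crit_inj cs); rewrite ?pi ?pj.
subst i; have m1 := mod_gt1 jl pj.
have e : (z : nat) = z' %[mod q ^ c q].
  wlog : z z' h h' / (z <= z')%N.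
    by move=> H; have [/H|/ltnW/H/esym] := leqP z z'; apply.
  move=> le; apply/esym/eqP; rewrite eqn_mod_dvd //.
  have := crit_annihilator fr cs jl (z' - z); rewrite pj => H; apply/H => x xB.
  by rewrite mulrnBr // -h // -h' // subrr.
by apply/val_inj; move: e; rewrite /= !modn_small // Zp_val_lt.
Qed.

Definition critical_residues phi : prodr (fun q : primeT => 'Z_(q ^ c q)) :=
  fun q => xget 0 [set z | acts_mod phi z].

Lemma critical_residuesE phi q (z : 'Z_(q ^ c q)) : acts_mod phi z -> critical_residues phi q = z.
Proof. by move=> h; apply: (xget_unique _ h) => z' h'; exact: (acts_mod_unique h' h). Qed.

Lemma critical_residues0 phi q : (q : nat) \notin pi_c A -> critical_residues phi q = 0.
Proof.
move=> nq; apply: xgetPN => z [j [jl pj _]]; move/negP: nq; apply.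
by apply/(crit_enum cs); exists j.
Qed.

Lemma acts_mod_exists phi j q : Nring len B C phi -> le_len j.+1 len -> p j = q ->
  exists z : 'Z_(q ^ c q), acts_mod phi z.
Proof.
move=> /(NringP cs)[J [r [Jl [hB hC]]]] jl pj; have m1 := mod_gt1 jl pj.
have [jJ|Jj] := ltnP j J; last first.
  exists 0, j; split=> // x xB; rewrite mulr0n; apply: hC; exact: (crit_B_C cs Jj jl xB).
exists (r j)%:R, j; split=> // x xB; rewrite (hB _ jJ _ xB) val_Zp_nat //.
have xc : x *+ q ^ c q = 0.
  by have := (crit_annihilator fr cs jl (q ^ c q)).2; rewrite pj => H; exact: H.
by apply: (mulrn_eqmod xc); rewrite modn_mod.
Qed.

Lemma critical_residues_spec phi j q : Nring len B C phi -> le_len j.+1 len -> p j = q ->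
  forall x, x \in B j -> phi x = x *+ (critical_residues phi q : nat).
Proof.
move=> hN jl pj x xB; have [z hz] := acts_mod_exists hN jl pj.
rewrite (critical_residuesE hz); have [i [il pi h]] := hz; apply: h.
by have -> : i = j by apply: (crit_inj cs); rewrite ?pi ?pj.
Qed.

Let crit_case q : (q : nat) \notin pi_c A \/ exists2 j, le_len j.+1 len & p j = q.
Proof.
have [|h] := boolP ((q : nat) \in pi_c A); last by left.
by move=> /(crit_enum cs)[j jl e]; right; exists j.
Qed.

Lemma common_bound (s : seq primeT) : (forall q, q \in s -> (q : nat) \in pi_c A) ->
  exists2 J, le_len J len & forall q, q \in s -> exists2 j, (j < J)%N & p j = q.
Proof.
elim: s => [|q s IH] h; first by exists 0%N; [case: len|].
have [|J Jl hJ] := IH; first by move=> r rs; apply: h; rewrite in_cons rs orbT.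
have /(crit_enum cs)[j jl e] := h q (mem_head _ _).
exists (maxn J j.+1); first exact: le_len_max.
move=> r; rewrite in_cons => /orP[/eqP ->|/hJ[i iJ <-]].
  by exists j; rewrite // leq_maxr.
by exists i; rewrite // leq_max iJ.
Qed.

(** An element of N is determined by the residues by which it acts on the groups B j, whose
    bounds are the p^(c_p), and finitely many of these residues can be prescribed. *)
Lemma Nring_iso : rng_iso (sub_rng (Nring len B C)) (sub_rng (sum_cyclic A)).
Proof.
exists critical_residues; split=> /=.
- split.
  + move=> phi hN; split; last by move=> q; exact: critical_residues0.
    have [J [r [Jl [hB hC]]]] := (NringP cs phi).1 hN.
    apply: sub_finite_set (finite_seq (pmap insub [seq p j | j <- iota 0 J])) => q /= nz.
    rewrite /= mem_pmap_sub /=; apply: contrapT => nq; move/eqP: nz; apply.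
    have [|[j jl pj]] := crit_case q; first exact: critical_residues0.
    apply: critical_residuesE; exists j; split=> // x xB; rewrite mulr0n; apply: hC.
    apply: (crit_B_C cs _ jl xB); rewrite leqNgt; apply/negP => jJ; apply: nq.
    by apply/mapP; exists j; rewrite // mem_iota.
  + move=> phi psi; rewrite !inE => h1 h2 e.
    have [J [r [s [Jl hr hs]]]] := acts_as_common cs h1 h2.
    apply: (acts_as_ext cs Jl hr); have [_ s2] := hs; split=> // j jJ x xB.
    have jl : le_len j.+1 len by exact: le_len_trans Jl.
    pose q : primeT := Sub (p j) (crit_prime cs jl).
    have pj : p j = q by [].
    have [r1 _] := hr; rewrite -(r1 _ jJ _ xB).
    by rewrite (critical_residues_spec h2 jl pj xB) -e -(critical_residues_spec h1 jl pj xB).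
  + move=> g [/finite_seqP[s sE] gc].
    have sP q : q \in s <-> g q != 0.
      by have : [set q | g q != 0] q <-> [set` s] q by [rewrite sE]; move=> /= ->.
    have [|J Jl hJ] := @common_bound s.
      move=> q /sP nz; apply: contraT => /gc e; by rewrite e eqxx in nz.
    pose r j := if insub (p j) is Some q then (g q : nat) else 0%N.
    have [phi h [n hn]] := acts_as_exists cs r Jl.
    have hN : Nring len B C phi by exists J, n; case: hn.
    exists phi => //; apply/functional_extensionality_dep => q.
    have [nq|[j jl pj]] := crit_case q; first by rewrite critical_residues0 // gc.
    apply: critical_residuesE; exists j; split=> // x xB; have [h1 h2] := h.
    have [jJ|Jj] := ltnP j J.
      by rewrite (h1 _ jJ _ xB) /r pj valK.
    rewrite h2; last exact: (crit_B_C cs Jj jl xB).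
    have [->|/sP/hJ[i iJ pi]] := eqVneq (g q) 0; first by rewrite mulr0n.
    have ij : i = j by apply: (crit_inj cs); rewrite ?pi ?pj //; exact: le_len_trans Jl.
    by move: iJ; rewrite ij ltnNge Jj.
- move=> phi psi h1 h2; apply/functional_extensionality_dep => q.
  rewrite -[RHS]/(critical_residues phi q + critical_residues psi q).
  have [nq|[j jl pj]] := crit_case q.
    by rewrite !critical_residues0 // addr0.
  apply: critical_residuesE; exists j; split=> // x xB; have m1 := mod_gt1 jl pj.
  rewrite endoDE (critical_residues_spec h1 jl pj xB) (critical_residues_spec h2 jl pj xB).
  rewrite -mulrnDr; have xc : x *+ q ^ c q = 0.
    by have := (crit_annihilator fr cs jl (q ^ c q)).2; rewrite pj => H; exact: H.
  by apply: (mulrn_eqmod xc); rewrite Zp_valD // modn_mod.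
- move=> phi psi h1 h2; apply/functional_extensionality_dep => q.
  rewrite -[RHS]/(critical_residues phi q * critical_residues psi q).
  have [nq|[j jl pj]] := crit_case q.
    by rewrite !critical_residues0 // mulr0.
  apply: critical_residuesE; exists j; split=> // x xB; have m1 := mod_gt1 jl pj.
  rewrite endoME (critical_residues_spec h2 jl pj xB) endoMn.
  rewrite (critical_residues_spec h1 jl pj xB) -mulrnA.
  have xc : x *+ q ^ c q = 0.
    by have := (crit_annihilator fr cs jl (q ^ c q)).2; rewrite pj => H; exact: H.
  by apply: (mulrn_eqmod xc); rewrite Zp_valM // modn_mod mulnC.
Qed.

End NringIso.

(** * Subgroups of finite index in groups of finite rank *)

Section FiniteIndex.
Variables (A : zmodType) (H : set A).
Hypotheses (fr : finite_tf_rank A) (sH : subgroup H).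

(** Dividing a relation modulo torsion by p gives another one, so that the coefficients of a
    relation are divisible by all powers of p. *)
Lemma independent_mod_p p K s : prime p -> H `&` tors A `<=` K -> (forall x, x \in s -> H x) ->
  (forall c : nat -> int, K (\sum_(i < size s) s`_i *~ c i) ->
    forall i, (i < size s)%N -> (p %| `|c i|)%N) -> tf_independent s.
Proof.
move=> pp TK Hs ind c tc.
have Hsum (d : nat -> int) : H (\sum_(i < size s) s`_i *~ d i).
  apply: (big_ind H); [exact: subg0 | move=> u v; exact: subgD|].
  by move=> i _; apply: subgMz => //; apply: Hs; exact: mem_nth.
have dv k : forall d : nat -> int, tors A (\sum_(i < size s) s`_i *~ d i) ->
    forall i, (i < size s)%N -> (p ^ k %| `|d i|)%N.
  elim: k => [//|k IH] d td.
  have pd := ind d (TK _ (conj (Hsum d) td)).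
  have dE i : (i < size s)%N -> d i = (p : int) * (d i %/ p)%Z.
    by move=> /pd h; rewrite mulrC divzK // dvdzE.
  move=> i lt; rewrite (dE i lt) abszM expnS dvdn_mul //; apply: (IH (fun i => (d i %/ p)%Z)) => //.
  apply: (@tors_divz A _ p); first by rewrite eqz_nat -lt0n prime_gt0.
  rewrite mulrz_suml; move: td; congr (tors A); apply: eq_bigr => j _.
  by rewrite {1}(dE j (ltn_ord j)) mulrC mulrzA.
move=> i lt; apply/eqP; rewrite -absz_eq0; apply/eqP.
have := dv `|c i|%N c tc i lt; apply: contraTeq => c0.
by rewrite gtnNdvd ?lt0n // ltn_expl // prime_gt1.
Qed.

(** A family of elements of H that is maximal among those independent modulo p and the torsion
    exists, its size being bounded by the rank, and it generates H modulo p H and the torsion. *)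
Lemma fin_mod_p p : prime p -> fin_mod (sumset (H `&` tors A) (multiples H p)) H.
Proof.
move=> pp; set K := sumset _ _; have [r hr] := tf_independent_size fr.
have sT : subgroup (H `&` tors A) by apply: subgI => //; exact: subg_tors.
have sM : subgroup (multiples H p) by exact: subg_multiples.
have sK : subgroup K by exact: subg_sumset.
have TK : H `&` tors A `<=` K by apply: sumset_subl; exact: subg0.
have MK : multiples H p `<=` K by apply: sumset_subr; exact: subg0.
pose P n := `[< exists s, [/\ size s = n, forall x, x \in s -> H x &
  forall c : nat -> int, K (\sum_(i < size s) s`_i *~ c i) ->
    forall i, (i < size s)%N -> (p %| `|c i|)%N] >].
have [|n /asboolP[s [<- Hs ind]]|n /asboolP[s [sn Hs ind]] maxn] := @ex_maxnP P r.
- by exists 0%N; apply/asboolP; exists [::]; split.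
- by apply: hr; exact: (independent_mod_p pp TK Hs ind).
apply: fin_mod_subr (fin_mod_gens_torsion s sK) => x Hx; split; last first.
  by exists p; [exact: prime_gt0 | apply: MK; exists x].
have sG := subg_gens s sK; apply: contrapT => nx.
have : P n.+1; last by move/maxn; rewrite ltnn.
apply/asboolP; exists (x :: s); split; first by rewrite /= sn.
  by move=> y; rewrite in_cons => /predU1P[->|/Hs].
move=> c; rewrite big_ord_recl /= => Kc.
have pc0 : (p %| `|c 0%N|)%N.
  apply: contrapT => /negP np; apply: nx; rewrite -[x]mulr1n.
  have h1 : gens K s (x *+ p) by apply: gens_sub; apply: MK; exists x.
  have h2 : gens K s (x *+ `|c 0%N|).
    apply/subg_abs => //; apply/gens_sumP => //; exists (fun i => - c i.+1).
    rewrite (_ : \sum_(i < size s) s`_i *~ - c i.+1 = - \sum_(i < size s) s`_i *~ c i.+1).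
      by rewrite opprK.
    by rewrite -sumrN; apply: eq_bigr => i _; rewrite mulrNz.
  have := subg_gcd sG h1 h2; rewrite (eqP (_ : coprime _ _)) //.
  by rewrite prime_coprime.
case=> [|i] //= lt; apply: (ind (fun i => c i.+1)) => //.
have Kx : K (x *~ c 0%N).
  by apply/subg_abs => //; have /dvdnP[u ->] := pc0; apply: MK; rewrite mulrnA; exists (x *+ u);
    [exact: subgMn|].
by have := subgB sK Kc Kx; rewrite addrAC subrr add0r.
Qed.

(** By induction on the number of prime factors of N; the torsion prime to p is p-divisible. *)
Lemma primary_multiples N : (0 < N)%N -> fin_mod
  (sumset (H `&` [set` pipart A \pi(N)]) (multiples H N)) H.
Proof.
elim/ltn_ind: N => N IH N0; have sP := subgI sH (subg_zmod (pipart A \pi(N))).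
have sK : subgroup (sumset (H `&` [set` pipart A \pi(N)]) (multiples H N)).
  by apply: subg_sumset => //; exact: subg_multiples.
have [N1|N1] := leqP N 1.
  have N1' : N = 1%N by lia.
  apply: fin_mod_self => // x Hx; apply: sumset_subr; first exact: subg0 sP.
  by exists x; rewrite // N1'.
have pp := pdiv_prime N1; set p := pdiv N in pp.
have /dvdnP[N' NE] : (p %| N)%N by exact: pdiv_dvd.
have N'0 : (0 < N')%N by move: N0; rewrite NE; case: (N').
have pN : p \in \pi(N) by rewrite pi_pdiv.
have N'lt : (N' < N)%N by rewrite NE ltn_Pmulr // prime_gt1.
apply: fin_mod_trans (IH _ N'lt N'0); apply: fin_mod_sumset => //.
  apply: fin_mod_self => // x [Hx xN']; apply: sumset_subl; first exact: subg0 (subg_multiples _ sH).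
  split=> //; have /asboolP[k kN xk] := xN'; apply/asboolP; exists k => //.
  by apply: sub_in_pnat kN => q _; apply: (pi_of_dvd (m := N')) => //; rewrite NE dvdn_mulr.
apply: (fin_mod_multiples (fin_mod_p pp)) => _ [t [Ht tt] [_ [h Hh <-] <-]].
rewrite mulrnDl -mulrnA [(p * N')%N]mulnC -NE.
apply: subgD => //; last by apply: sumset_subr; [exact: subg0 | exists h].
have /torsP[n n0 tn] := tt; suff : sumset (H `&` [set` pipart A \pi(N)]) (multiples H p) t.
  move=> [u [Hu uP] [_ [v Hv <-] <-]]; rewrite mulrnDl -mulrnA [(p * N')%N]mulnC -NE.
  exists (u *+ N'); first by split; [exact: subgMn | exact: rpredMn].
  by exists (v *+ N) => //; exists v.
have sM := subg_multiples p sH.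
apply: (primary_ind n0 tn).
- by apply: subg0; exact: subg_sumset.
- by move=> y z; apply: subgD; exact: subg_sumset.
move=> q k j qp e; have [qE|qp'] := eqVneq q p.
  apply: sumset_subl; first exact: subg0.
  split; first exact: subgMn.
  by apply/asboolP; exists (q ^ k)%N; rewrite // pnatX pnatE // qE pN.
apply: sumset_subr; first exact: subg0.
have h1 : multiples H p (t *+ j *+ p) by exists (t *+ j) => //; exact: subgMn.
have h2 : multiples H p (t *+ j *+ q ^ k) by rewrite e; exact: subg0.
have := subg_gcd sM h1 h2; rewrite (eqP (_ : coprime _ _)) //.
by apply: coprimeXr; rewrite prime_coprime // dvdn_prime2 // eq_sym.
Qed.

End FiniteIndex.

(** * Semi-multiplications *)

Section SemiRational.
Variable A : zmodType.
Implicit Types (phi psi : endo A) (pi : nat_pred).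

Lemma pi_starP p : p \in pi_star A <-> [/\ prime p,
  exists k, forall x, x \in pipart A p -> x *+ p ^ k = 0
  & forall a, exists b, a - b *+ p \in pipart A p].
Proof.
split=> [|[pp [k hk] div]].
  rewrite inE => /andP[pp /asboolP[bd div]]; split=> //.
    have [c hc] := bounded_pprim pp bd (fun x xA => (pipartP x pp).1 xA).
    by exists c.
  move=> a; have [y _ e] := div (\pi_({quot pipart A p})%qT a) I.
  have [b eb] := quot_surj y; exists b; apply/quot_eq.
  by rewrite raddfMn /= -eb e.
rewrite inE pp; apply/asboolP; split.
  by exists (p ^ k)%N; split; [rewrite expn_gt0 prime_gt0 | exact: hk].
move=> z _; have [a ->] := quot_surj z; have [b hb] := div a.
exists (\pi_({quot pipart A p})%qT b) => //; apply/esym; rewrite -raddfMn; exact/quot_eq.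
Qed.

(** By induction on the number of prime factors of N, each of which divides A modulo its own
    component. *)
Lemma pi_star_split (S : set A) N : subgroup S -> (pi_star A).-nat N ->
  (forall p x, prime p -> (p %| N)%N -> x \in pipart A p -> S x) ->
  forall a, exists b, S (a - b *+ N).
Proof.
move=> sS; elim/ltn_ind: N => N IH piN h a; have [N0 _] := andP piN.
have [N1|N1] := leqP N 1.
  have -> : N = 1%N by lia.
  by exists a; rewrite subrr; exact: subg0.
have pp := pdiv_prime N1; set p := pdiv N in pp.
have pN : (p %| N)%N by exact: pdiv_dvd.
have /pi_starP[_ _ div] : p \in pi_star A by exact: (pnatP _ N0 piN).
have [b hb] := div a; have /dvdnP[N' NE] := pN.
have N'N : (N' %| N)%N by rewrite NE dvdn_mulr.
have N'0 : (0 < N')%N by move: N0; rewrite NE; case: (N').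
have [|||c hc] := IH N' _ _ _ b.
- by rewrite NE ltn_Pmulr // prime_gt1.
- exact: pnat_dvd piN.
- by move=> q x qp qN'; apply: h => //; exact: dvdn_trans N'N.
exists c; have -> : a - c *+ N = (a - b *+ p) + (b - c *+ N') *+ p.
  by rewrite mulrnBl -mulrnA -NE; abel.
by apply: subgD => //; [exact: h hb | exact: subgMn].
Qed.

Lemma pi_star_kill N : (pi_star A).-nat N -> exists2 m, \pi(N).-nat m &
  forall x, x \in pipart A \pi(N) -> x *+ m = 0.
Proof.
move=> piN; have [N0 _] := andP piN.
have /boolp.choice[k hk] q : exists k, q \in pi_star A -> forall x, x \in pipart A q -> x *+ q ^ k = 0.
  have [/pi_starP[_ [k hk] _]|nq] := boolP (q \in pi_star A); first by exists k.
  by exists 0%N.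
set m := (\prod_(q <- primes N) q ^ k q)%N; exists m.
  rewrite /m big_seq; apply: (big_ind (fun n => \pi(N).-nat n)) => [||q qN]; rewrite ?pnat1 //.
    by move=> a b ha hb; rewrite pnatM ha.
  rewrite pnatX pnatE //; last by move: qN; rewrite mem_primes => /andP[].
  by rewrite inE /= qN.
move=> x /asboolP[n nN xn]; have [n0 _] := andP nN.
suff : [set y : A | y *+ m = 0] x by [].
apply: (primary_ind n0 xn); first exact: mul0rn.
  by move=> y z /= hy hz; rewrite mulrnDl hy hz addr0.
move=> q j i qp e; change (x *+ i *+ m = 0); have [qN|qN] := boolP (q \in primes N).
  have qs : q \in pi_star A.
    by apply: (pnatP _ N0 piN) => //; move: qN; rewrite mem_primes => /and3P[].
  rewrite /m (big_rem q qN) /= mulrnA hk ?mul0rn //; apply/(pipartP _ qp); by exists j.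
have xn' : x *+ i *+ n = 0 by rewrite mulrnAC xn mul0rn.
have := subg_gcd (@subg_set0 A) e xn'; rewrite (eqP (_ : coprime _ _)).
  by rewrite mulr1n => ->; rewrite mul0rn.
apply: coprimeXl; rewrite prime_coprime //; apply/negP => qn.
have := pnatP _ n0 nN q qp qn; by rewrite inE /= (negbTE qN).
Qed.

(** Away from finitely many primes of pi_star, phi acts as the rational number e/d. *)
Definition scales_as phi (d : nat) (e : int) : Prop :=
  (pi_star A).-nat d /\ exists2 m, (pi_star A).-nat m & forall a, (phi a *+ d - a *~ e) *+ m = 0.

Definition int_on_primary phi : Prop := forall p, p \in pi_star A ->
  exists n : nat, forall x, x \in pipart A p -> phi x = x *+ n.

(** On the p-component m is injective and d is invertible, so that phi is the residue of e/d. *)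
Lemma int_on_coprime phi d e m p : p \in pi_star A ->
  coprime p (d * m) -> (forall a, (phi a *+ d - a *~ e) *+ m = 0) ->
  exists n : nat, forall x, x \in pipart A p -> phi x = x *+ n.
Proof.
move=> /pi_starP[pp [k hk] _]; rewrite coprimeMr => /andP[cd cm] h.
have pk0 : (0 < p ^ k)%N by rewrite expn_gt0 prime_gt0.
have [n hn] := @int_to_nat (p ^ k) e pk0.
have ck : coprime d (p ^ k) by rewrite coprime_sym; exact: coprimeXl.
pose w := chinese (p ^ k) d 1 0.
have w1 : w = 1 %[mod p ^ k] by rewrite /w chinese_modl // coprime_sym.
have /dvdnP[v wE] : (d %| w)%N.
  by apply/eqP; rewrite /w chinese_modr ?mod0n // coprime_sym.
exists (n * v)%N => x xA; have xk := hk x xA.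
have fk : phi x *+ p ^ k = 0 by rewrite -endoMn xk endo0.
have zk : (phi x *+ d - x *~ e) *+ p ^ k = 0.
  by rewrite mulrnBl mulrnAC fk mul0rn pmulrn mulrzAC -pmulrn xk mul0rz subr0.
have := subg_gcd (@subg_set0 A) zk (h x).
rewrite (eqP (coprimeXl k cm)) mulr1n => /eqP; rewrite subr_eq0 (hn _ _ xk) => /eqP e1.
by rewrite mulrnA -e1 -mulrnA mulnC -wE (mulrn_eqmod fk w1).
Qed.

Lemma scales_as_sub phi psi d e d' e' : scales_as phi d e -> scales_as psi d' e' ->
  scales_as (phi - psi) (d * d')%N (e * d' - e' * d).
Proof.
move=> [pd [m pm h]] [pd' [m' pm' h']]; split; first by rewrite pnatM pd.
exists (m * m')%N; first by rewrite pnatM pm.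
move=> a; rewrite endoBE.
have -> : (phi a - psi a) *+ (d * d') - a *~ (e * d' - e' * d) =
    (phi a *+ d - a *~ e) *+ d' - (psi a *+ d' - a *~ e') *+ d.
  rewrite !mulrnBl -!mulrnA !pmulrn mulrzBr -!mulrzA [(d' * d)%N]mulnC.
  by abel.
rewrite mulrnBl mulrnAC mulrnA h !mul0rn sub0r; apply/eqP; rewrite oppr_eq0; apply/eqP.
by rewrite [(m * m')%N]mulnC mulrnAC mulrnA h' !mul0rn.
Qed.

Lemma scales_as_mul phi psi d e d' e' : scales_as phi d e -> scales_as psi d' e' ->
  scales_as (phi * psi) (d * d')%N (e * e').
Proof.
move=> [pd [m pm h]] [pd' [m' pm' h']]; split; first by rewrite pnatM pd.
exists (m * m')%N; first by rewrite pnatM pm.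
move=> a; rewrite endoME.
have -> : phi (psi a) *+ (d * d') - a *~ (e * e') =
    (phi (psi a) *+ d - psi a *~ e) *+ d' + (psi a *+ d' - a *~ e') *~ e.
  by rewrite !mulrnBl !mulrzBl !pmulrn -!mulrzA PoszM [e' * e]mulrC [Posz d' * e]mulrC; abel.
rewrite mulrnDl mulrnAC mulrnA h !mul0rn add0r [LHS]pmulrn mulrzAC -pmulrn.
by rewrite mulnC mulrnA h' mul0rn mul0rz.
Qed.

Lemma int_on_primary_sub phi psi : int_on_primary phi -> int_on_primary psi ->
  int_on_primary (phi - psi).
Proof.
move=> h h' p ps; have [n hn] := h p ps; have [n' hn'] := h' p ps.
have /pi_starP[pp [k hk] _] := ps.
have [|u hu] := @int_to_nat (p ^ k) (n%:Z - n'%:Z); first by rewrite expn_gt0 prime_gt0.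
by exists u => x xA; rewrite endoBE hn // hn' // -hu ?hk // mulrzBr -!pmulrn.
Qed.

Lemma int_on_primary_mul phi psi : int_on_primary phi -> int_on_primary psi ->
  int_on_primary (phi * psi).
Proof.
move=> h h' p ps; have [n hn] := h p ps; have [n' hn'] := h' p ps.
by exists (n * n')%N => x xA; rewrite endoME hn' // endoMn hn // mulrnA.
Qed.

(** On A modulo the torsion at the primes of N = d m one can divide by N, so that a commutator
    with phi, which vanishes on that torsion and is killed by N, vanishes. *)
Lemma scales_as_central phi d e psi : scales_as phi d e -> int_on_primary phi ->
  phi * psi = psi * phi.
Proof.
move=> [pd [m pm h]] ip; apply: endo_ext => a.
apply/eqP; rewrite -subr_eq0 -endoBE; apply/eqP; set D := phi * psi - psi * phi.
have DN x : D x *+ (d * m) = 0.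
  have h1 := h (psi x); have h2 : psi ((phi x *+ d - x *~ e) *+ m) = 0 by rewrite h endo0.
  move: h2; rewrite endoMn endoB endoMn endoMz => h2.
  have -> : D x *+ (d * m) = (phi (psi x) *+ d - psi x *~ e) *+ m -
      (psi (phi x) *+ d - psi x *~ e) *+ m.
    by rewrite /D endoBE !endoME !mulrnBl -!mulrnA; abel.
  by rewrite h1 h2 subrr.
have sK : subgroup (D @^-1` [set 0]) by apply: subg_preim; exact: subg_set0.
have pN : (pi_star A).-nat (d * m)%N by rewrite pnatM pd.
have [|b hb] := pi_star_split sK pN _ a.
  move=> p x pp pdm xA; have [dm0 _] := andP pN.
  have [n hn] := ip p (pnatP _ dm0 pN p pp pdm).
  rewrite /preimage /mkset /D endoBE !endoME !hn ?endoMn ?subrr //.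
  by have /(pipartP _ pp)[k xk] := xA; apply/(pipartP _ pp); exists k; rewrite -endoMn xk endo0.
move: hb; rewrite /preimage /mkset endoB endoMn DN subr0; exact.
Qed.

(** A subgroup H has finite index over the elements that phi maps into H, since these include
    its torsion at the primes of N = d m and N H. *)
Lemma scales_as_inertial phi d e : finite_tf_rank A -> scales_as phi d e -> int_on_primary phi ->
  inertial phi.
Proof.
move=> fr [pd [m pm h]] ip; apply/inertialP => H sH.
have pN : (pi_star A).-nat (d * m)%N by rewrite pnatM pd.
have [N0 _] := andP pN.
have sS : subgroup (H `&` phi @^-1` H) by apply: subgI => //; exact: subg_preim.
have := fin_mod_image phi (primary_multiples fr sH N0).
have /fin_mod_subl : phi @` sumset (H `&` [set` pipart A \pi(d * m)%N]) (multiples H (d * m)) `<=` H.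
  move=> _ [_ [x [Hx xA] [_ [y Hy <-] <-]] <-]; rewrite endoD; apply: subgD => //.
    have /asboolP[n nN xn] := xA; have [n0 _] := andP nN.
    suff : (H `&` phi @^-1` H) x by case.
    apply: (primary_ind n0 xn); first exact: subg0.
      by move=> u v; exact: subgD.
    move=> p k j pp e'; split; first exact: subgMn.
    rewrite /preimage /mkset; have [pN'|npN] := boolP (p \in \pi(d * m)%N).
      have [|r hr] := ip p; first by apply: (pnatP _ N0 pN) => //; move: pN'; rewrite mem_primes => /and3P[].
      by rewrite hr; [apply: subgMn => //; exact: subgMn | apply/(pipartP _ pp); exists k].
    have xn' : x *+ j *+ n = 0 by rewrite mulrnAC xn mul0rn.
    have := subg_gcd (@subg_set0 A) e' xn'; rewrite (eqP (_ : coprime _ _)).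
      by rewrite mulr1n => ->; rewrite endo0; exact: subg0.
    apply: coprimeXl; rewrite prime_coprime //; apply/negP => qn.
    by have := pnatP _ n0 nN p pp qn; apply/negP.
  have e1 : phi (y *+ (d * m)) = y *~ e *+ m.
    by apply/eqP; rewrite -subr_eq0 endoMn mulrnA -mulrnBl h.
  by rewrite e1; apply: subgMn => //; exact: subgMz.
exact.
Qed.

End SemiRational.

Section SemiMult.
Variable A : zmodType.
Implicit Types (phi psi : endo A) (pi : nat_pred).

(** A is the sum by divisibility; and an element of N m A that is torsion at the primes of N is a
    multiple by m of such an element. *)
Lemma pi_star_direct N m : (pi_star A).-nat N -> \pi(N).-nat m ->
  (forall x, x \in pipart A \pi(N) -> x *+ m = 0) ->
  direct_sum [set: A] [set` pipart A \pi(N)] (multiples [set: A] (N * m)).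
Proof.
move=> pN mN km; have [N0 _] := andP pN; have [m0 _] := andP mN.
have sP := subg_zmod (pipart A \pi(N)).
have NN : \pi(N).-nat (N * m)%N by rewrite pnatM pnat_pi.
have pinm : (pi_star A).-nat (N * m)%N.
  rewrite pnatM pN; apply: sub_in_pnat mN => p _; rewrite inE /= mem_primes => /and3P[pp _ pd].
  exact: (pnatP _ N0 pN).
have [nm0 _] := andP NN.
split; apply/seteqP; split=> x //.
- move=> _; have [|b hb] := pi_star_split sP pinm _ x.
    move=> p y pp pd /asboolP[n np yn]; apply/asboolP; exists n => //.
    apply: sub_in_pnat np => q _ /eqP ->; exact: (pnatP _ nm0 NN).
  exists (x - b *+ (N * m)) => //; exists (b *+ (N * m)); first by exists b.
  by rewrite subrK.
- move=> [xP [y _ yx]]; suff -> : x = 0 by [].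
  have yP : y \in pipart A \pi(N).
    have /asboolP[k kN xk] := xP; apply/asboolP; exists (N * m * k)%N; first by rewrite pnatM NN.
    by rewrite mulrnA yx.
  by rewrite -yx mulnC mulrnA km // mul0rn.
- move=> ->; split; first exact: rpred0.
  by exists 0; rewrite ?mul0rn.
Qed.

Lemma trivial_component pi (C : set A) : direct_sum [set: A] [set` pipart A pi] C ->
  let Cpi := C `&` [set` pipart A pi] in divisible Cpi /\ finite_rank Cpi.
Proof.
move=> [_ dis] /=; rewrite setIC dis; split.
  by move=> n x _ ->; exists 0; rewrite ?mul0rn.
exists 0%N => -[|x s] // h [n0 _]; move: n0.
by rewrite (h x (mem_head _ _)) mem_head.
Qed.

Lemma rat_frac (d : nat) (e : int) : (0 < d)%N -> let r := e%:~R / d%:R : rat in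
  numq r * d%:Z = e * denq r /\ (`|denq r| %| d)%N.
Proof.
move=> d0 r; have h : numq r * d%:Z = e * denq r.
  apply: (@intr_inj rat); rewrite !rmorphM /= numqE mulrAC /r divfK //.
  by rewrite Num.Theory.pnatr_eq0 -lt0n.
split=> //; have cop : coprime `|denq r| `|numq r| by rewrite coprime_sym; exact: coprime_num_den.
by rewrite -(Gauss_dvdr _ cop) -(absz_nat d) -abszM h abszM dvdn_mull.
Qed.

Lemma periodic_sumset (B C : set A) : direct_sum [set: A] B C -> periodic B -> periodic C ->
  periodic [set: A].
Proof.
by move=> [e _] pB pC x; rewrite e => -[b Bb [c Cc <-]]; apply: rpredD; [exact: pB | exact: pC].
Qed.

(** This description of the semi-multiplications does not mention the finite set of primes, so
    that sums and products need no common refinement of the decompositions. Conversely the primes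
    of d m serve, and C is the group of the multiples of a suitable multiple of d m; the integers
    given on the p-components are glued by the Chinese remainder theorem. *)
Lemma semi_multP phi : ~ periodic [set: A] ->
  SM A phi <-> (exists d e, scales_as phi d e) /\ int_on_primary phi.
Proof.
move=> nper; split.
  move=> [pi [C [n [pis [_ ds [k [k0 hk]] _ _] nB sc]]]].
  have perP : periodic [set` pipart A pi] by move=> x; exact: pipart_torsion.
  case: sc => [[perC _]|[_ [r rpi hr]]].
    by exfalso; apply: nper; exact: periodic_sumset ds perP perC.
  pose d := `|denq r|%N; pose e := numq r; pose m := (k`_pi)%N.
  have dE x : x *+ d = x *~ denq r by rewrite pmulrn /d gez0_abs ?denq_ge0.
  have km x : x \in pipart A pi -> x *+ m = 0.
    move=> xA; have xk := hk x xA; have /asboolP[l lp xl] := xA.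
    have := subg_gcd (@subg_set0 A) xk xl => xg.
    have dv : (gcdn k l %| m)%N.
      have gl : pi.-nat (gcdn k l) by apply: pnat_dvd lp; exact: dvdn_gcdr.
      by rewrite -(part_pnat_id gl) partn_dvd // dvdn_gcdl.
    by have /dvdnP[u ->] := dv; rewrite mulnC mulrnA xg mul0rn.
  have pistar u : pi.-nat u -> (pi_star A).-nat u by apply: sub_in_pnat => q _; exact: pis.
  have [T _] := ds.
  have h a : (phi a *+ d - a *~ e) *+ m = 0.
    have : [set: A] a by []; rewrite T => -[x xA [c cC <-]].
    rewrite endoD [(_ + _) *+ d]mulrnDl [(x + c) *~ e]mulrzDl; have [_ ec] := hr c cC.
    have -> : phi x *+ d + phi c *+ d - (x *~ e + c *~ e) =
      (phi x *+ d - x *~ e) + (phi c *+ d - c *~ e) by abel.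
    rewrite dE [phi c *+ d]dE ec subrr addr0 -dE; apply: km; apply: rpredB; last exact: rpredMz.
    by apply: rpredMn; rewrite nB //; exact: rpredMz.
  split; first by exists d, e; split; [exact: pistar | exists m; [apply: pistar; exact: part_pnat|]].
  move=> p ps; have /pi_starP[pp [j hj] _] := ps.
  have [ppi|npi] := boolP (p \in pi).
    have [|u hu] := @int_to_nat (p ^ j) n; first by rewrite expn_gt0 prime_gt0.
    exists u => x xA; rewrite nB ?hu ?hj //; have /asboolP[l lp xl] := xA.
    by apply/asboolP; exists l => //; apply: sub_in_pnat lp => q _ /eqP ->.
  apply: (int_on_coprime ps _ h); rewrite coprime_sym; apply: (@pnat_coprime pi).
    by rewrite pnatM rpi part_pnat.
  by rewrite pnatE // inE /= npi.
move=> [[d [e [pd [m pm h]]]] ip].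
have pN : (pi_star A).-nat (d * m)%N by rewrite pnatM pd.
have [N0 _] := andP pN; have [d0 _] := andP pd.
have [m' pm' km'] := pi_star_kill pN.
have ds := pi_star_direct pN pm' km'.
have [C eC] := zmod_of_subg (subg_multiples (d * m * m') (@subgT A)).
rewrite -eC in ds; pose r : rat := e%:~R / d%:R.
have [r1 r2] := rat_frac e d0; have sub q : q \in \pi(d * m)%N -> q \in pi_star A.
  by move=> qN; apply: (pnatP _ N0 pN); move: qN; rewrite inE /= mem_primes => /and3P[].
have /boolp.choice[kn hkn] q : exists kn : nat * nat, q \in pi_star A ->
    forall x, x \in pipart A q -> x *+ q ^ kn.1 = 0 /\ phi x = x *+ kn.2.
  have [qs|nq] := boolP (q \in pi_star A); last by exists (0, 0)%N.
  have /pi_starP[_ [k hk] _] := qs; have [n hn] := ip q qs.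
  by exists (k, n) => _ x xA; split; [exact: hk | exact: hn].
have allp : all prime (primes (d * m)) by apply/allP => q; rewrite mem_primes => /andP[].
have [c hc] := crt_primes (fun q => (kn q).1) (fun q => (kn q).2) (primes_uniq (d * m)) allp.
have m'0 : (0 < m')%N by have [] := andP pm'.
exists \pi(d * m)%N, C, c; split=> //.
- split=> //.
  + split; last by move=> q; rewrite inE /= mem_primes => /andP[].
    by apply: sub_finite_set (finite_seq (primes (d * m))) => q.
  + by exists m'; split.
  + exact: trivial_component.
- move=> x /asboolP[n nN xn]; have [n0 _] := andP nN; rewrite -pmulrn.
  suff : [set y | phi y = y *+ c] x by [].
  apply: (primary_ind n0 xn); first by rewrite /mkset endo0 mul0rn.
    by move=> u v /= hu hv; rewrite endoD hu hv mulrnDl.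
  move=> q k j qp ek; change (phi (x *+ j) = x *+ j *+ c).
  have [qN|qN] := boolP (q \in primes (d * m)).
    have [|x1 x2] := hkn q (sub q qN) (x *+ j); first by apply/(pipartP _ qp); exists k.
    by rewrite x2; apply: (mulrn_eqmod x1); rewrite hc.
  have xn' : x *+ j *+ n = 0 by rewrite mulrnAC xn mul0rn.
  have := subg_gcd (@subg_set0 A) ek xn'; rewrite (eqP (_ : coprime _ _)).
    by rewrite mulr1n => ->; rewrite endo0 mul0rn.
  apply: coprimeXl; rewrite prime_coprime //; apply/negP => qn.
  by have := pnatP _ n0 nN q qp qn; rewrite inE /= (negbTE qN).
right; split.
  move=> perC; apply: nper; apply: periodic_sumset ds _ perC => x; exact: pipart_torsion.
have dN : \pi(d * m)%N.-nat d.
  by have := pnat_pi N0; rewrite pnatM => /andP[].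
exists r; first exact: pnat_dvd r2 dN.
have Cmul x (z : A) : x \in C -> z \in pipart A \pi(d * m)%N -> z \in C -> z = 0.
  by move=> _ zP zC; have [_ dis] := ds; have : ([set` pipart A \pi(d * m)%N] `&` [set` C]) z; [|rewrite dis].
move=> x xC; have [y _ yx] : multiples [set: A] (d * m * m') x by rewrite -eC.
have fC : phi x \in C.
  by have : [set` C] (phi x) by rewrite eC; exists (phi y) => //; rewrite -endoMn yx.
split=> //; apply/eqP; rewrite -subr_eq0; apply/eqP; apply: (Cmul x) => //; last first.
  by apply: rpredB; exact: rpredMz.
have ed : phi x *+ d = x *~ e.
  apply/eqP; rewrite -subr_eq0 -yx endoMn; apply/eqP.
  have -> : (d * m * m' = m * (d * m'))%N by rewrite mulnCA mulnA.
  have -> : phi y *+ (m * (d * m')) *+ d - y *+ (m * (d * m')) *~ e =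
    (phi y *+ d - y *~ e) *+ (m * (d * m')).
    by rewrite mulrnBl mulrnAC [y *~ e *+ _]pmulrn mulrzAC -pmulrn.
  by rewrite mulrnA h mul0rn.
apply/asboolP; exists d => //; rewrite mulrnBl !pmulrn mulrzAC -[phi x *~ d]pmulrn ed.
by rewrite -!mulrzA -r1 subrr.
Qed.

(** Multiplication by e/d on A modulo the torsion at the primes of d. *)
Lemma scales_as_exists d e : (pi_star A).-nat d ->
  exists sigma : endo A, scales_as sigma d e /\ int_on_primary sigma.
Proof.
move=> pd; have [m pm km] := pi_star_kill pd; have ds := pi_star_direct pd pm km.
have [d0 _] := andP pd; have [m0 _] := andP pm.
have dmN : \pi(d).-nat (d * m)%N by rewrite pnatM pnat_pi.
have [rho [r1 r2 r3 r4]] :=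
  direct_sum_proj (subg_zmod (pipart A \pi(d))) (subg_multiples (d * m) (@subgT A)) ds.
have /boolp.choice[b hb] a : exists b, b *+ (d * m) = a - rho a.
  by have [b _ eb] := r2 a; exists b.
have van (w : A) : w *+ (d * m) = 0 -> w *+ m = 0.
  by move=> h; apply: km; apply/asboolP; exists (d * m)%N.
have fP : is_endo (fun a => b a *+ m *~ e).
  apply/asboolP => x y; rewrite -mulrzDl -mulrnDl; congr (_ *~ _); apply/eqP.
  rewrite -subr_eq0 -mulrnBl; apply/eqP/van; rewrite mulrnBl mulrnDl !hb endoD; abel.
have fE a : Endo fP a = b a *+ m *~ e by [].
pose sigma := Endo fP.
have h a : (sigma a *+ d - a *~ e) *+ m = 0.
  have -> : sigma a *+ d - a *~ e = - (rho a *~ e).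
    rewrite fE [LHS]addrC pmulrn mulrzAC -pmulrn -mulrnA [(m * d)%N]mulnC hb mulrzBl.
    by abel.
  by rewrite mulNrn pmulrn mulrzAC -pmulrn km ?mul0rz ?oppr0 //; exact: r1.
have pim : (pi_star A).-nat m.
  apply: sub_in_pnat pm => p _; rewrite inE /= mem_primes => /and3P[pp _ dv].
  exact: (pnatP _ d0 pd).
exists sigma; split; first by split=> //; exists m.
move=> p ps; have /pi_starP[pp _ _] := ps.
have [pdv|npd] := boolP (p %| d)%N.
  exists 0%N => x /asboolP[n np xn]; rewrite mulr0n fE van ?mul0rz // hb r3 ?subrr //.
  apply/asboolP; exists n => //; apply: sub_in_pnat np => q _ /eqP ->.
  by rewrite inE /= mem_primes pp d0.
apply: (int_on_coprime ps _ h).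
rewrite coprime_sym; apply: (@pnat_coprime \pi(d)) => //.
by rewrite pnatE // inE /= mem_primes (negbTE npd) !andbF.
Qed.

Lemma semi_mult_periodic : periodic [set: A] -> SM A = padics_mults A.
Proof.
move=> per; apply/seteqP; split=> phi.
  move=> [pi [C [n [pis [_ ds [K [K0 hK]] _ _] nB sc]]]].
  have {sc}[alpha hal] : exists alpha, padics_scale alpha [set` C] id phi.
    by case: sc => [[_ //]|[nper _]]; exfalso; apply: nper => x _; exact: per.
  have [c hc] := int_to_nat n K0; pose gamma : padics := c%:R.
  exists (fun q : primeT => if (q : nat) \in pi then gamma q else alpha q).
  move=> p x _ xp; have pp := prime_primeT p; have /(pipartP _ pp)[k xk] := xp.
  have [T dis] := ds; have [ppi|npi] := boolP ((p : nat) \in pi).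
    have xpi : x \in pipart A pi.
      by apply/asboolP; exists (p ^ k)%N; rewrite // pnatX pnatE // ppi.
    have xk1 : x *+ p ^ k.+1 = 0 by rewrite expnSr mulrnA xk mul0rn.
    exists k => //; rewrite -(jact_pprim per gamma xk1) (jact_natr per).
    by rewrite nB // hc // hK.
  apply: hal xp; have : [set: A] x by []; rewrite T => -[y yA [z zC e]].
  suff -> : x = z by []; have /asboolP[l lp yl] := yA.
  have yk : y *+ p ^ k = 0.
    suff : ([set` pipart A pi] `&` [set` C]) (y *+ p ^ k) by rewrite dis.
    split; first exact: rpredMn.
    have -> : y *+ p ^ k = - (z *+ p ^ k) by apply/eqP; rewrite -addr_eq0 -mulrnDl e xk.
    by rewrite /= rpredN rpredMn.
  have := subg_gcd (@subg_set0 A) yl yk; rewrite (eqP (_ : coprime _ _)).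
    by rewrite mulr1n -e => ->; rewrite add0r.
  by apply: (@pnat_coprime pi) => //; rewrite pnatX pnatE // inE /= npi.
move=> [alpha hal].
have [C eC] := zmod_of_subg (@subgT A).
have e0 : [set` pipart A pred0] = [set 0].
  apply/seteqP; split=> x; last by move=> ->; exact: rpred0.
  move=> /asboolP[n np xn]; suff n1 : n = 1%N by rewrite -xn n1 mulr1n.
  by apply/eqP; rewrite -(@pnat_1 pred0 n) //; apply: sub_in_pnat np.
have ds : direct_sum [set: A] [set` pipart A pred0] [set` C].
  rewrite e0 eC; split; last by rewrite setIT.
  by apply/seteqP; split=> // x _; exists 0 => //; exists x; rewrite // add0r.
exists pred0, C, 0; split=> //.
- split=> //; [|by exists 1%N; split=> // x; rewrite e0 => ->; rewrite mul0rn|exact: trivial_component ds].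
  by split=> //; apply: sub_finite_set (finite_set0 nat).
- by rewrite e0 => x ->; rewrite endo0 mul0rz.
- by left; rewrite eC; split=> //; exists alpha.
Qed.

End SemiMult.

(** * The rational number of an inertial endomorphism *)

Section Denominators.
Variable A : zmodType.
Hypothesis fr : finite_tf_rank A.
Implicit Types (phi psi : endo A).

Lemma torsion_pdivisible p t : prime p -> t \in torsion A -> exists c, t - c *+ p \in pipart A p.
Proof.
move=> pp /torsionP[n n0 tn]; suff : [set t | exists c, t - c *+ p \in pipart A p] t by [].
apply: (primary_ind n0 tn); first by exists 0; rewrite mul0rn subr0 rpred0.
  move=> u v [a ha] [b hb]; exists (a + b).
  have -> : u + v - (a + b) *+ p = (u - a *+ p) + (v - b *+ p) by rewrite mulrnDl; abel.
  exact: rpredD.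
move=> q k j qp e; have [qE|nq] := eqVneq q p.
  by exists 0; rewrite mul0rn subr0; apply/(pipartP _ pp); exists k; rewrite -qE.
have sM := subg_multiples p (@subgT A).
have h1 : multiples [set: A] p (t *+ j *+ p) by exists (t *+ j).
have h2 : multiples [set: A] p (t *+ j *+ q ^ k) by rewrite e; exact: subg0.
have := subg_gcd sM h1 h2; rewrite (eqP (_ : coprime _ _)).
  by move=> [c _ ec]; exists c; rewrite ec mulr1n subrr rpred0.
by apply: coprimeXr; rewrite prime_coprime // dvdn_prime2 // eq_sym.
Qed.

(** If psi inverts p up to an endomorphism theta with periodic image, the sequence
    f, psi f, psi (psi f), ... of a basis element f with theta f = 0 gives elements of all
    orders p^i modulo a lattice in the kernel of theta. The scalar by which theta acts on the
    divisible part is zero on them, hence zero, and p psi = 1 there. *)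
Lemma pi_star_of_inverse psi (p : primeT) : ~ periodic [set: A] -> inertial psi ->
  periodic (range (psi *+ p - 1)) -> (p : nat) \in pi_star A.
Proof.
move=> nper ip; set theta := psi *+ p - 1 => pert; have pp := prime_primeT p.
have thE x : theta x = psi x *+ p - x by rewrite /theta endoBE endoMnE endo1E.
have [s [ind iso hs]] := kernel_basis fr pert.
have [F eF] := zmod_of_subg (subg_gens s (@subg_set0 A)).
have lF : full_lattice [set` F] by rewrite eF; exact: basis_full_lattice.
have F0 x : x \in F -> theta x = 0.
  by move=> xF; apply: (gens_kernel hs); rewrite -eF.
have perP : periodic [set: {quot F}] by apply/quot_periodic; have [] := lF.
have it : inertial theta.
  apply: inertialB; last by have := @inertial_int A 1; rewrite mulr1z.
  by rewrite -[psi *+ p]mulr_natl; apply: inertialM => //; exact: (@inertial_int A p).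
have [tb tbE] : exists tb : endo {quot F}, forall x,
    tb (\pi_({quot F})%qT x) = \pi_({quot F})%qT (theta x).
  by apply: quot_endo => x /F0 ->; exact: rpred0.
have [k [al hal]] : exists k al, forall x, pprim {quot F} p x -> tb (x *+ p ^ k) = jact perP al (x *+ p ^ k).
  have [al [fin|[k [_ _ _ _ [h _]]]]] := pprim_structure p perP (quot_inertial tbE it); last first.
    by exists k, al => x Sx; apply: h; exists x.
  have [n n0 hn] : exists2 n, (0 < n)%N & forall x, ((tb - jact perP al) @` pprim {quot F} p) x -> x *+ n = 0.
    by apply: (fin_mod_exponent perP (@subg_set0 _)); exact/fin_mod0.
  have [||k hk] := @bounded_pprim _ p ((tb - jact perP al) @` pprim {quot F} p) pp.
  - by exists n.
  - by move=> _ [x /pprimP[j xj] <-]; exists j; rewrite -endoMn xj endo0.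
  exists k, al => x Sx; apply/eqP; rewrite -subr_eq0 -endoBE endoMn hk //; by exists x.
have [f fs] : exists f, f \in s.
  apply: contrapT => h; apply: nper => x _; have s0 : s = [::].
    by case: s h {ind iso hs eF} => // y s h; exfalso; apply: h; exists y; exact: mem_head.
  have [n n0] := iso x; rewrite s0 /= => tn; exact: tors_div n0 tn.
have fF : f \in F.
  by suff : [set` F] f by []; rewrite eF; apply: gens_mem => //; exact: subg_set0.
have fp y : y \in F -> y *+ p <> f.
  move=> yF e; have : [set` F] y by []; rewrite eF.
  move=> /(gens_sumP _ _ (@subg_set0 A))[c /subr0_eq yE].
  have fi : (index f s < size s)%N by rewrite index_mem.
  have := ind (fun i => c i * p%:Z - (i == index f s)%:R) _ _ fi.
  rewrite eqxx => /(_ _)/eqP; rewrite subr_eq0 => h.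
  have /h/eqP e1 : tors A (\sum_(i < size s) s`_i *~ (c i * p - ((i : nat) == index f s)%:R)).
    suff -> : \sum_(i < size s) s`_i *~ (c i * p - ((i : nat) == index f s)%:R) = 0.
      exact: subg0 (@subg_tors A).
    under eq_bigr => i _ do rewrite mulrzBr mulrzA.
    rewrite sumrB -mulrz_suml -yE -pmulrn e.
    rewrite (bigD1 (Ordinal fi)) //= eqxx nth_index // big1 ?addr0 ?subrr // => i.
    by rewrite -val_eqE /= => /negPf ->.
  have : (`|c (index f s)| * p = 1)%N by rewrite -(absz_nat p) -abszM e1.
  by move/eqP; rewrite muln_eq1 => /andP[_ /eqP p1]; have := prime_gt1 pp; rewrite p1.
pose x i := iter i psi f.
have th_iter i y : theta y = 0 -> theta (iter i psi y) = 0.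
  move=> y0; elim: i => [//|i IH].
  by have -> : iter i.+1 psi y = psi (iter i psi y) by []; rewrite thE -endoMn -endoB -thE IH endo0.
have iter_mul i y : theta y = 0 -> iter i psi y *+ p ^ i = y.
  move=> y0; elim: i => [|i IH]; first by rewrite mulr1n.
  rewrite expnS mulrnA -[RHS]IH; congr (_ *+ _); apply/eqP; rewrite -subr_eq0 /=.
  by rewrite -thE th_iter.
have xp i j : x (j + i)%N *+ p ^ j = x i.
  by rewrite /x iterD iter_mul // th_iter // F0.
have al0 i : (residue (al p) i : nat) = 0%N.
  pose y := \pi_({quot F})%qT (x i.+1).
  have yk : y = \pi_({quot F})%qT (x (k + i.+1)%N) *+ p ^ k by rewrite -raddfMn /= xp.
  have yi : y *+ p ^ i.+1 = 0.
    by rewrite -raddfMn /=; apply/quot_eq0; have := xp 0%N i.+1; rewrite addn0 => ->.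
  have : jact perP al y = 0.
    rewrite yk -hal -?yk; first by rewrite tbE th_iter ?raddf0 ?F0.
    apply/pprimP; exists (k + i.+1)%N; rewrite expnD mulrnA -yk.
    exact: yi.
  rewrite (jact_pprim perP al yi) => r0.
  have dv : (p ^ i.+1 %| residue (al p) i)%N.
    apply: contraT => ndv.
    have := subg_pdiv pp (@subg_set0 _) yi r0 ndv; rewrite -raddfMn /= => /quot_eq0.
    have := xp 1%N i; rewrite addn1 => -> x1F; exfalso; apply: (fp (x 1%N) x1F).
    by have := xp 0%N 1%N; rewrite addn0 expn1.
  have lt : ((residue (al p) i : nat) < p ^ i.+1)%N by apply: Zp_val_lt; exact: expp_gt1.
  by apply/eqP; rewrite -(modn_small lt); exact: dv.
apply/pi_starP; split=> //.
  exists k => a /(pipartP _ pp)[j aj].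
  have ta : theta (a *+ p ^ k) = 0.
    have [_ _ FT _] := lF; apply: FT; last first.
      by apply: tors_endo; apply/torsP; exists (p ^ j)%N; rewrite ?expn_gt0 ?prime_gt0 // mulrnAC aj mul0rn.
    apply/quot_eq0; rewrite -tbE raddfMn /= hal; last first.
      by apply/pprimP; exists j; rewrite -raddfMn aj raddf0.
    rewrite (@jact_pprim_eq _ perP al 0 p _ j) ?jact0 //.
      by apply: padic_ext => i; rewrite al0; case: i.
    have paj : \pi_({quot F})%qT a *+ p ^ j = 0 by rewrite -raddfMn aj raddf0.
    by rewrite mulrnAC; apply: (etrans (congr1 (fun z => z *+ p ^ k) paj)); rewrite mul0rn.
  have itMn i y N : iter i psi y *+ N = iter i psi (y *+ N).
    by elim: i => //= i IH; rewrite -endoMn IH.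
  rewrite -(iter_mul j _ ta) itMn mulrnAC aj mul0rn.
  by elim: (j) => //= i ->; rewrite endo0.
move=> a; have [|c hc] := @torsion_pdivisible p (theta a) pp; first by apply: pert; exists a.
exists (psi a - c); have -> : a - (psi a - c) *+ p = - (theta a - c *+ p).
  by rewrite thE mulrnBl; abel.
by rewrite rpredN.
Qed.

(** Let phi be m/n modulo torsion, in lowest terms, and let the prime p divide n. By Bezout, a
    combination of phi and 1 is 1/p modulo torsion. *)
Lemma inertial_ratio phi : ~ periodic [set: A] -> inertial phi ->
  exists (n : nat) (m : int), (pi_star A).-nat n /\ forall y, tors A (phi y *+ n - y *~ m).
Proof.
move=> nper ip; have [n0 [m0 [n0p h0]]] := inertial_proportional ip.
pose g := gcdn n0 `|m0|; have g0 : (0 < g)%N by rewrite gcdn_gt0 n0p.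
have /dvdnP[n nE] : (g %| n0)%N by exact: dvdn_gcdl.
have /dvdzP[m mE] : (g %| m0)%Z by rewrite dvdzE dvdn_gcdr.
have np : (0 < n)%N by move: n0p; rewrite nE; case: (n).
have cop : coprime n `|m|.
  have := erefl g; rewrite {1}/g nE mE abszM absz_nat -muln_gcdl => /eqP.
  by rewrite -[X in _ == X]mul1n eqn_pmul2r.
have h y : tors A (phi y *+ n - y *~ m).
  apply: (tors_div g0); have := h0 y; rewrite nE mE mulrzA -pmulrn mulrnA -mulrnBl.
  exact.
exists n, m; split=> //; apply/pnatP => // q qp qn; pose p : primeT := Sub q qp.
have [u [v uv]] := Bezoutz m (q : int).
have {}uv : u * m + v * q = 1.
  rewrite uv /gcdz absz_nat; congr Posz; apply/eqP; rewrite -/(coprime _ _) coprime_sym.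
  by rewrite prime_coprime //; apply: contraL cop => qm; rewrite /coprime gtn_eqF // (leq_trans (prime_gt1 qp)) // dvdn_leq ?gcdn_gt0 ?np // dvdn_gcd qn.
have /dvdnP[n' n'E] := qn.
pose psi : endo A := phi *~ (u * n') + 1 *~ v.
apply: (@pi_star_of_inverse psi p) => //.
  apply: inertialD; last exact: inertial_int.
  by rewrite -mulrzr; apply: inertialM => //; exact: inertial_int.
move=> _ [y _ <-]; rewrite endoBE endoMnE endo1E endoDE !endoMzE endo1E.
have -> : (phi y *~ (u * n') + y *~ v) *+ p - y = (phi y *+ n - y *~ m) *~ u.
  have ey : y = y *~ (u * m) + y *~ (v * q) by rewrite -mulrzDr uv mulr1z.
  rewrite [X in _ - X]ey -[nat_of_primeT p]/q mulrnDl mulrzBl !pmulrn -!mulrzA.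
  by rewrite n'E PoszM [n'%:Z * q%:Z * u]mulrC mulrA [m * u]mulrC; abel.
by apply: rpredMz; exact: h.
Qed.

Theorem inertial_modulo_periodic phi : ~ periodic [set: A] -> inertial phi ->
  exists2 sigma, SM A sigma & periodic (range (phi - sigma)).
Proof.
move=> nper ip; have [n [m [pn h]]] := inertial_ratio nper ip.
have [sigma [s1 s2]] := scales_as_exists m pn.
exists sigma; first by apply/(semi_multP _ nper); split=> //; exists n, m.
have [n0 _] := andP pn; have [_ [l pl hl]] := s1; have [l0 _] := andP pl.
move=> _ [a _ <-]; apply: (tors_div n0); rewrite endoBE.
have -> : (phi a - sigma a) *+ n = (phi a *+ n - a *~ m) - (sigma a *+ n - a *~ m).
  by rewrite mulrnBl; abel.
apply: rpredB; first exact: h.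
by apply: (tors_div l0); rewrite hl; exact: rpred0.
Qed.

Lemma SM_inertial : SM A `<=` IE A.
Proof.
move=> phi; have [per|nper] := pselect (periodic [set: A]).
  rewrite (semi_mult_periodic per) => -[al /(padics_scaleP per idfun phi al (@subgT A)) h].
  rewrite (_ : phi = jact per al); first exact: inertial_jact.
  by apply: endo_ext => x; rewrite h.
move=> /(semi_multP _ nper)[[d [e h]] hi]; exact: scales_as_inertial fr h hi.
Qed.

Lemma SM_central phi psi : SM A phi -> phi * psi = psi * phi.
Proof.
have [per|nper] := pselect (periodic [set: A]).
  rewrite (semi_mult_periodic per) => -[al /(padics_scaleP per idfun phi al (@subgT A)) h].
  apply: endo_ext => x; rewrite !endoME !h //; exact/esym/jact_comm.
move=> /(semi_multP _ nper)[[d [e h]] hi]; exact: scales_as_central h hi.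
Qed.

Lemma SM_subring : is_subring (SM A).
Proof.
have [per|nper] := pselect (periodic [set: A]).
  rewrite (semi_mult_periodic per).
  have P phi : padics_mults A phi <-> exists al, forall x, phi x = jact per al x.
    split=> -[al h]; exists al; last by apply/(padics_scaleP per idfun phi al (@subgT A)) => x _; exact: h.
    by move=> x; exact: (padics_scaleP per idfun phi al (@subgT A)).1 h x I.
  split; first by apply/P; exists 0 => x; rewrite jact0 endo0E.
    move=> phi psi /P[al h] /P[be h']; apply/P; exists (al - be) => x.
    by rewrite endoBE h h' jactB.
  move=> phi psi /P[al h] /P[be h']; apply/P; exists (al * be) => x.
  by rewrite endoME h' h jactM.
split; first (apply/(semi_multP _ nper); split).
- exists 1%N, 0; split; first by [].
  by exists 1%N => // a; rewrite endo0E mulr0z subrr.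
- by move=> p _; exists 0%N => x _; rewrite endo0E.
- move=> phi psi /(semi_multP _ nper)[[d [e h]] hi] /(semi_multP _ nper)[[d' [e' h']] hi'].
  apply/(semi_multP _ nper); split; last exact: int_on_primary_sub.
  by do 2!eexists; exact: scales_as_sub h h'.
- move=> phi psi /(semi_multP _ nper)[[d [e h]] hi] /(semi_multP _ nper)[[d' [e' h']] hi'].
  apply/(semi_multP _ nper); split; last exact: int_on_primary_mul.
  by do 2!eexists; exact: scales_as_mul h h'.
Qed.

End Denominators.

(** * Isomorphisms of quotient rings *)

Section Cosets.
Variables (R : pzRingType) (S I : set R).
Hypotheses (hS : is_subring S) (hI : is_ideal S I).
Local Notation coset x := (sumset [set x] I).

Lemma ideal0 : I 0. Proof. by case: hI. Qed.

Lemma idealN x : I x -> I (- x).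
Proof. by have [_ I0 IB _] := hI => Ix; rewrite -sub0r; apply: (IB). Qed.

Lemma idealD x y : I x -> I y -> I (x + y).
Proof. by have [_ _ IB _] := hI => Ix Iy; rewrite -[y]opprK; apply: (IB) => //; exact: idealN. Qed.

Lemma cosetE x y : coset x y <-> I (y - x).
Proof.
split=> [[_ -> [i Ii <-]]|h]; first by rewrite addrAC subrr add0r.
by exists x => //; exists (y - x); rewrite // addrC subrK.
Qed.

Lemma coset_eq x y : coset x = coset y <-> I (x - y).
Proof.
split=> [e|h]; first by apply/cosetE; rewrite -e; apply/cosetE; rewrite subrr; exact: ideal0.
apply/seteqP; split=> z /cosetE hz; apply/cosetE.
  by have := idealD hz h; rewrite addrA subrK.
by have := idealD hz (idealN h); rewrite opprB addrA subrK.
Qed.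

Lemma cosetD x y : sumset (coset x) (coset y) = coset (x + y).
Proof.
apply/seteqP; split=> z.
  move=> [u /cosetE hu [v /cosetE hv <-]]; apply/cosetE.
  by rewrite opprD addrACA; exact: idealD.
move=> /cosetE h; exists x; first by apply/cosetE; rewrite subrr; exact: ideal0.
by exists (z - x); [apply/cosetE; rewrite -addrA -opprD | rewrite addrC subrK].
Qed.

Lemma cosetM x y : S x -> S y ->
  sumset [set u * v | u in coset x & v in coset y] I = coset (x * y).
Proof.
have [IS _ _ IM] := hI => Sx Sy; apply/seteqP; split=> z.
  move=> [_ [u /cosetE hu [v /cosetE hv <-]] [i Ii <-]]; apply/cosetE.
  have Sv : S v by rewrite -[v](subrK y); apply: subringD => //; exact: IS.
  have -> : u * v + i - x * y = (u - x) * v + x * (v - y) + i.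
    by rewrite mulrBl mulrBr addrA subrK addrAC.
  by apply: idealD => //; apply: idealD; [exact: (IM v _ Sv hu).2 | exact: (IM x _ Sx hv).1].
move=> /cosetE h; exists (x * y).
  exists x; first by apply/cosetE; rewrite subrr; exact: ideal0.
  by exists y => //; apply/cosetE; rewrite subrr; exact: ideal0.
by exists (z - x * y); rewrite // addrC subrK.
Qed.

End Cosets.

(** The two rings are compared through a relation rho, because an element of S/I has no canonical
    representative to which a function could be applied. The map g parametrizes the target: it is
    the identity for a subring and the projection for a quotient ring. *)
Lemma quot_rng_iso (R R2 : pzRingType) (S I : set R) (T : set R2) (rho : R -> R2 -> Prop)
    (Q : rng) (g : R2 -> rng_sort Q) :
  is_subring S -> is_ideal S I ->
  (forall x, S x -> exists2 a, T a & rho x a) -> (forall a, T a -> exists2 x, S x & rho x a) ->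
  (forall x y a b, S x -> S y -> rho x a -> rho y b -> rho (x - y) (a - b) /\ rho (x * y) (a * b)) ->
  (forall x y a b, S x -> S y -> T a -> T b -> rho x a -> rho y b -> (I (x - y) <-> g a = g b)) ->
  rng_dom Q = g @` T ->
  is_subring T ->
  (forall a b, T a -> T b -> rng_add (g a) (g b) = g (a + b)) ->
  (forall a b, T a -> T b -> rng_mul (g a) (g b) = g (a * b)) ->
  rng_iso (quot_rng S I) Q.
Proof.
move=> hS hI ex1 ex2 rBM ker domQ hT gD gM.
have [S0 SB SM] := hS; have [_ _ TM] := hT.
have SD := fun x y => @subringD _ S x y hS; have TD := fun x y => @subringD _ T x y hT.
have /boolp.choice[al hal] x : exists a, S x -> T a /\ rho x a.
  by have [Sx|nS] := pselect (S x); [have [a Ta ra] := ex1 x Sx; exists a | exists 0].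
have rD x y a b : S x -> S y -> rho x a -> rho y b -> rho (x + y) (a + b).
  move=> Sx Sy ra rb; have [r0 _] := rBM _ _ _ _ Sy Sy rb rb; rewrite !subrr in r0.
  have [rN _] := rBM _ _ _ _ S0 Sy r0 rb; rewrite !sub0r in rN.
  have SN : S (- y) by rewrite -sub0r; exact: (SB).
  by have [+ _] := rBM _ _ _ _ Sx SN ra rN; rewrite !opprK.
pose rep X := xget 0 [set x | S x /\ X = sumset [set x] I].
pose f X := g (al (rep X)).
have fE x a : S x -> T a -> rho x a -> f (sumset [set x] I) = g a.
  move=> Sx Ta ra; have [Sr er] : S (rep (sumset [set x] I)) /\
      sumset [set x] I = sumset [set rep (sumset [set x] I)] I.
    by apply: (@xgetPex _ 0 [set y | S y /\ sumset [set x] I = sumset [set y] I]); exists x.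
  have [Ta' ra'] := hal _ Sr; apply/esym; apply/(ker _ _ _ _ Sx Sr Ta Ta' ra ra').
  exact/(coset_eq hI).
exists f; split=> /=.
- split.
  + move=> _ [x Sx <-] /=; have [a Ta ra] := ex1 x Sx.
    by rewrite (fE x a) // domQ; exists a.
  + move=> X Y; rewrite !inE => -[x Sx <-] [y Sy <-].
    have [a Ta ra] := ex1 x Sx; have [b Tb rb] := ex1 y Sy.
    rewrite (fE x a) // (fE y b) // => e; apply/(coset_eq hI).
    exact/(ker _ _ _ _ Sx Sy Ta Tb ra rb).
  + rewrite domQ => _ [a Ta <-]; have [x Sx rx] := ex2 a Ta.
    by exists (sumset [set x] I); [exists x | exact: fE].
- move=> _ _ [x Sx <-] [y Sy <-]; have [a Ta ra] := ex1 x Sx; have [b Tb rb] := ex1 y Sy.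
  have rd := rD _ _ _ _ Sx Sy ra rb.
  by rewrite (cosetD hI) (fE x a) // (fE y b) // (fE _ (a + b)) ?gD //; [exact: SD | exact: TD].
- move=> _ _ [x Sx <-] [y Sy <-]; have [a Ta ra] := ex1 x Sx; have [b Tb rb] := ex1 y Sy.
  have [_ rm] := rBM _ _ _ _ Sx Sy ra rb.
  by rewrite (cosetM hS hI) // (fE x a) // (fE y b) // (fE _ (a * b)) ?gM //; [exact: SM | exact: TM].
Qed.

(** * The ring of inertial endomorphisms in finite rank *)

Section FiniteRank.
Variable A : zmodType.
Hypothesis fr : finite_tf_rank A.
Implicit Types (phi psi : endo A).

Lemma full_lattice_exists : exists F, full_lattice (A := A) F.
Proof.
by have [s ind iso] := finite_rank_basis fr; exists (gens [set 0] s); exact: basis_full_lattice.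
Qed.

Lemma IE_subring : is_subring (IE A).
Proof. by split; [exact: inertial0 | exact: inertialB | exact: inertialM]. Qed.

Lemma periodic_rangeB phi psi : periodic (range phi) -> periodic (range psi) ->
  periodic (range (phi - psi)).
Proof.
move=> h h' _ [a _ <-]; rewrite endoBE.
by apply: rpredB; [apply: h | apply: h']; exists a.
Qed.

Lemma UI_subring : is_subring (UI A).
Proof.
have [F lF] := full_lattice_exists; have [sF _ _ perF] := lF.
split.
- apply/(uniformP _ fr lF); split; first exact: inertial0.
    by move=> _ [a _ <-]; rewrite endo0E; exact: rpred0.
  exists 0; apply: unif_fin => //; apply: sub_finite_set (finite_set1 (0 : A)) => _ [a _ <-].
  by rewrite endo0E.
- move=> phi psi /(uniformP _ fr lF)[i1 p1 [a u1]] /(uniformP _ fr lF)[i2 p2 [b u2]].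
  apply/(uniformP _ fr lF); split; [exact: inertialB | exact: periodic_rangeB |].
  by exists (a - b); exact: unifB.
- move=> phi psi /(uniformP _ fr lF)[i1 p1 [a u1]] /(uniformP _ fr lF)[i2 p2 [b u2]].
  apply/(uniformP _ fr lF); split; first exact: inertialM.
    by move=> _ [x _ <-]; apply: p1; exists (psi x).
  by exists (a * b); exact: unifM.
Qed.

Section WithSequence.
Variables (len : option nat) (p : nat -> nat) (B C : nat -> zmodClosed A).
Hypothesis cs : critical_sequence len p B C.
Local Notation N := (Nring len B C).

Lemma Nring_periodic phi : N phi -> periodic (range phi).
Proof.
move=> /(NringP cs)[J [r [Jl [hB hC]]]] _ [x _ <-].
have [rho [r1 r2 _ _]] := proj_first cs Jl.
rewrite -[x](subrK (rho x)) endoD (hC _ (r2 x)) add0r; apply: tors_endo.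
have sT := @subg_tors A.
apply: (sum_first_min sT _ (r1 x)) => j y jJ yB.
have [_ sub] := crit_bounded cs (le_len_trans jJ Jl).
by apply: pipart_torsion; exact: sub.
Qed.

(** Uniform endomorphisms and elements of N have periodic image; the converse is the
    decomposition of inertial endomorphisms with periodic image. *)
Lemma periodic_image_sum : sumset (UI A) N = [set phi | IE A phi /\ periodic (range phi)].
Proof.
have [F lF] := full_lattice_exists; apply/seteqP; split=> phi.
  move=> [u /(uniformP _ fr lF)[iu pu _] [v vN <-]]; rewrite -[v]opprK.
  have iv : IE A (- v) by apply: inertialN; exact: (Nring_inertial fr cs).
  have pv : periodic (range (- v)).
    by move=> _ [a _ <-]; rewrite endoNE /= rpredN; apply: (Nring_periodic vN); exists a.
  by split; [exact: inertialB|exact: periodic_rangeB].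
move=> [ip pp]; have [v vN u] := periodic_decomposition fr cs ip pp.
by exists (phi - v) => //; exists v; rewrite // subrK.
Qed.

Lemma periodic_image_ideal : is_ideal (IE A) (sumset (UI A) N).
Proof.
rewrite periodic_image_sum; split.
- by move=> phi [].
- split; first exact: inertial0.
  by move=> _ [a _ <-]; rewrite endo0E; exact: rpred0.
- by move=> phi psi [i1 p1] [i2 p2]; split; [exact: inertialB | exact: periodic_rangeB].
- move=> psi phi ip [i1 p1]; split; split; try exact: inertialM.
    by move=> _ [a _ <-]; rewrite endoME; apply: tors_endo; apply: p1; exists a.
  by move=> _ [a _ <-]; apply: p1; exists (psi a).
Qed.

Lemma IE_sum : IE A = sumset (sumset (SM A) (UI A)) N.
Proof.
apply/seteqP; split=> phi; last first.
  move=> [_ [s Ss [u Uu <-]] [v Nv <-]]; apply: inertialD; last exact: (Nring_inertial fr cs).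
  by apply: inertialD; [exact: SM_inertial | case: Uu].
move=> ip; have [s Ss ps] : exists2 s, SM A s & periodic (range (phi - s)).
  have [per|nper] := pselect (periodic [set: A]); last exact: inertial_modulo_periodic.
  exists 0; first by have [] := @SM_subring A.
  by move=> x _; exact: per.
have [v vN u] := periodic_decomposition fr cs (inertialB ip (SM_inertial fr Ss)) ps.
exists (s + (phi - s - v)); first by exists s => //; exists (phi - s - v).
by exists v => //; abel.
Qed.

Definition ratio phi (r : rat) : Prop := exists (n : nat) (m : int),
  [/\ (0 < n)%N, r = m%:~R / n%:R & forall y, tors A (phi y *+ n - y *~ m)].

Lemma rat_piP pi r : rat_pi pi r <->
  exists (n : nat) (m : int), pi.-nat n /\ r = m%:~R / n%:R.
Proof.
split=> [h|[n [m [pn ->]]]].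
  exists `|denq r|%N, (numq r); split=> //; rewrite -[LHS]divq_num_den; congr (_ / _).
  by rewrite -[RHS]/(`|denq r|%N%:~R) gez0_abs ?denq_ge0.
by have [n0 _] := andP pn; have [_ dv] := rat_frac m n0; exact: pnat_dvd dv pn.
Qed.

Lemma fracB (n n' : nat) (m m' : int) : (0 < n)%N -> (0 < n')%N ->
  m%:~R / n%:R - m'%:~R / n'%:R = (m * n'%:Z - m' * n%:Z)%:~R / (n * n')%:R :> rat.
Proof.
move=> n0 n'0; rewrite intrB !intrM natrM -!pmulrn; field.
by rewrite !Num.Theory.pnatr_eq0 -!lt0n n0 n'0.
Qed.

Lemma fracM (n n' : nat) (m m' : int) :
  m%:~R / n%:R * (m'%:~R / n'%:R) = (m * m')%:~R / (n * n')%:R :> rat.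
Proof. by rewrite intrM natrM invfM mulrACA. Qed.

Lemma rat_pi_subring pi : is_subring (rat_pi pi).
Proof.
split.
- by apply/rat_piP; exists 1%N, 0; split; rewrite ?mul0r.
- move=> r r' /rat_piP[n [m [pn ->]]] /rat_piP[n' [m' [pn' ->]]]; apply/rat_piP.
  have [n0 _] := andP pn; have [n'0 _] := andP pn'.
  by rewrite fracB //; do 2!eexists; split; [|reflexivity]; rewrite pnatM pn.
- move=> r r' /rat_piP[n [m [pn ->]]] /rat_piP[n' [m' [pn' ->]]]; apply/rat_piP.
  by rewrite fracM; do 2!eexists; split; [|reflexivity]; rewrite pnatM pn.
Qed.

Lemma frac_eq (n n' : nat) (m m' : int) : (0 < n)%N -> (0 < n')%N ->
  m%:~R / n%:R = m'%:~R / n'%:R :> rat <-> m * n'%:Z - m' * n%:Z = 0.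
Proof.
move=> n0 n'0; have nn0 : ((n * n')%:R : rat) != 0.
  by rewrite Num.Theory.pnatr_eq0 -lt0n muln_gt0 n0.
split=> [/eqP|h]; last by apply/eqP; rewrite -subr_eq0 fracB // h mul0r.
rewrite -subr_eq0 fracB // mulf_eq0 invr_eq0 (negPf nn0) orbF => /eqP e.
by apply: (@intr_inj rat); rewrite e.
Qed.

(** An inertial endomorphism is sent to the rational number by which it acts on A/T(A); it has
    periodic image if and only if this number is 0. *)
Lemma ratio_iso : ~ periodic [set: A] ->
  rng_iso (quot_rng (IE A) (sumset (UI A) N)) (sub_rng (rat_pi (pi_star A))).
Proof.
move=> nper; apply: (@quot_rng_iso _ rat _ _ (rat_pi (pi_star A)) ratio (sub_rng _) id) => //.
- exact: IE_subring.
- exact: periodic_image_ideal.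
- move=> phi ip; have [n [m [pn h]]] := inertial_ratio fr nper ip.
  have [n0 _] := andP pn; exists (m%:~R / n%:R); last by exists n, m.
  by apply/rat_piP; exists n, m.
- move=> _ /rat_piP[n [m [pn ->]]]; have [n0 _] := andP pn.
  have [s [s1 s2]] := scales_as_exists m pn.
  exists s; first exact: scales_as_inertial fr s1 s2.
  exists n, m; split=> // y; have [_ [l pl hl]] := s1; have [l0 _] := andP pl.
  by apply: (tors_div l0); rewrite hl; exact: rpred0.
- move=> phi psi _ _ ip iq [n [m [n0 -> h]]] [n' [m' [n'0 -> h']]]; split.
    rewrite fracB //; do 2!eexists; split; [|reflexivity|]; first by rewrite muln_gt0 n0.
    move=> y; rewrite endoBE.
    have -> : (phi y - psi y) *+ (n * n') - y *~ (m * n' - m' * n) =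
        (phi y *+ n - y *~ m) *+ n' - (psi y *+ n' - y *~ m') *+ n.
      rewrite !mulrnBl -!mulrnA !pmulrn mulrzBr -!mulrzA [(n' * n)%N]mulnC; abel.
    by apply: rpredB; apply: rpredMn; [exact: h | exact: h'].
  rewrite fracM; do 2!eexists; split; [|reflexivity|]; first by rewrite muln_gt0 n0.
  move=> y; rewrite endoME.
  have -> : phi (psi y) *+ (n * n') - y *~ (m * m') =
      (phi (psi y) *+ n - psi y *~ m) *+ n' + (psi y *+ n' - y *~ m') *~ m.
    by rewrite !mulrnBl !mulrzBl !pmulrn -!mulrzA PoszM [m' * m]mulrC [Posz n' * m]mulrC; abel.
  by apply: rpredD; [apply: rpredMn; exact: h | apply: rpredMz; exact: h'].
- move=> phi psi _ _ ip iq _ _ [n [m [n0 -> h]]] [n' [m' [n'0 -> h']]].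
  have e y : tors A ((phi - psi) y *+ (n * n') - y *~ (m * n' - m' * n)).
    rewrite endoBE.
    have -> : (phi y - psi y) *+ (n * n') - y *~ (m * n' - m' * n) =
        (phi y *+ n - y *~ m) *+ n' - (psi y *+ n' - y *~ m') *+ n.
      rewrite !mulrnBl -!mulrnA !pmulrn mulrzBr -!mulrzA [(n' * n)%N]mulnC; abel.
    by apply: rpredB; apply: rpredMn; [exact: h | exact: h'].
  have nn0 : (0 < n * n')%N by rewrite muln_gt0 n0.
  rewrite periodic_image_sum frac_eq //; split=> [[_ per]|e0]; last first.
    split; first exact: inertialB.
    move=> _ [y _ <-]; apply: (tors_div nn0); have := e y.
    by rewrite e0 mulr0z subr0.
  apply: contrapT => /eqP c0; apply: nper => y _; apply: (tors_divz c0).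
  rewrite -[y *~ _](subrK ((phi - psi) y *+ (n * n'))) -opprB.
  apply: rpredD; first by rewrite rpredN; exact: e.
  by apply: rpredMn; apply: per; exists y.
- by apply/seteqP; split=> r /=; [exists r | move=> [? ? <-]].
- exact: rat_pi_subring.
Qed.

End WithSequence.
End FiniteRank.

(** * The ideal of the p-adic integers acting with finite image *)

Section Valuation.
Variable p : primeT.
Implicit Types a b : padic p.

Lemma residue_nat n k : (residue (n%:R : padic p) k : nat) = n %[mod p ^ k.+1].
Proof.
elim: n => [|n IH]; first by [].
by rewrite mulrSr residueD residue1 -modnDml IH modnDml addn1.
Qed.

(** Division by p^e shifts the residues by e places. *)
Lemma padic_divide a e : (forall k, (k < e)%N -> (residue a k : nat) = 0%N) ->
  padic_ideal (Some e) a.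
Proof.
move=> h; have dv k : (p ^ e %| residue a (k + e))%N.
  case: e h => [|e] h; first by rewrite dvd1n.
  have le : (e <= (k + e).+1)%N by lia.
  by rewrite addnS /dvdn -(residue_le a le) h ?mod0n.
pose c (r : primeT) k := if r == p then (residue a (k + e) %/ p ^ e)%N else 0%N.
have pe0 : (0 < p ^ e)%N by rewrite expn_gt0 prime_gt0 // prime_primeT.
have [|al hal] := @mk_padics c.
  move=> r k; rewrite /c; case: eqP => [->|] //.
  apply/eqP; rewrite -(eqn_pmul2l pe0) !muln_modr -expnD ![(p ^ e * (_ %/ _))%N]mulnC.
  rewrite !divnK // addSn addnS eq_sym [(e + k)%N]addnC; apply/eqP.
  exact: (@residue_le p a (k + e) (k + e).+1).
exists (al p) => //; apply: padic_ext => k.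
have lt (u : padic p) : ((residue u k : nat) < p ^ k.+1)%N by apply: Zp_val_lt; exact: expp_gt1.
rewrite -[RHS](modn_small (lt a)) -[LHS](modn_small (lt _)) residueM -natrX.
rewrite -modnMml residue_nat modnMml -modnMmr hal /c eqxx modnMmr mulnC divnK //.
by apply/esym/residue_le; exact: leq_addr.
Qed.

Lemma padic_valuation a : a <> 0 -> exists v,
  (forall k, (k < v)%N -> (residue a k : nat) = 0%N) /\
  forall k, (v <= k)%N -> ~~ (p ^ v.+1 %| residue a k)%N.
Proof.
move=> a0; have ex : exists k, (residue a k : nat) != 0%N.
  apply: contrapT => h; apply: a0; apply: padic_ext => k; apply: contrapT => nz.
  by apply: h; exists k; apply/eqP.
have [v nz minv] := ex_minnP ex; exists v; split=> k vk.
  by apply/eqP; apply: contraT => /minv; rewrite leqNgt vk.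
rewrite /dvdn -(residue_le a vk) modn_small //.
by apply: Zp_val_lt; exact: expp_gt1.
Qed.

Lemma not_padic_ideal a e : ~ padic_ideal (Some e) a -> exists2 v, (v < e)%N &
  forall k, (v <= k)%N -> ~~ (p ^ v.+1 %| residue a k)%N.
Proof.
move=> na; have [|v [h1 h2]] := @padic_valuation a.
  by move=> a0; apply: na; rewrite a0; exists 0; rewrite ?mulr0.
exists v => //; rewrite ltnNge; apply/negP => ev; apply: na; apply: padic_divide => k ke.
by apply: h1; exact: leq_trans ev.
Qed.

Lemma padic_ideal0 x : padic_ideal x (0 : padic p).
Proof. by case: x => [e|//]; exists 0; rewrite ?mulr0. Qed.

Lemma padic_ideal_act (V : zmodType) (perV : periodic [set: V]) (al : padics) b e x k :
  al p = p%:R ^+ e * b -> x *+ p ^ k.+1 = 0 ->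
  jact perV al x = x *+ p ^ e *+ (residue b k : nat).
Proof.
move=> e1 xk; rewrite (jact_pprim perV al xk) e1 -mulrnA; apply: (mulrn_eqmod xk).
by rewrite residueM -natrX -modnMml residue_nat modnMml.
Qed.

(** Up to units, an element of valuation v acts on the p-component as p^v. *)
Lemma valuation_act (V : zmodType) (perV : periodic [set: V]) (al : padics) v :
  (forall k, (v <= k)%N -> ~~ (p ^ v.+1 %| residue (al p) k)%N) ->
  forall x, pprim V p x -> (jact perV al @` pprim V p) (x *+ p ^ v).
Proof.
move=> h x Sx; have /pprimP[k xk] := Sx; set K := maxn k v.
have xK : x *+ p ^ K.+1 = 0.
  have -> : K.+1 = (k + (K.+1 - k))%N by rewrite subnKC // leqW // leq_maxl.
  by rewrite expnD mulrnA xk mul0rn.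
have sJ : subgroup (jact perV al @` pprim V p) by apply: subg_image; exact: subg_pprim.
apply: (subg_pdiv (prime_primeT p) sJ (M := K.+1) _ _ (h K (leq_maxr _ _))).
  by rewrite xK; exact: subg0.
by rewrite -(jact_pprim perV al xK); exists x.
Qed.

End Valuation.

Lemma finite_range_components (V : zmodType) (f : endo V) (s : seq primeT) :
  periodic [set: V] ->
  (forall q : primeT, q \notin s -> forall x, pprim V q x -> f x = 0) ->
  (forall q : primeT, q \in s -> finite_set (f @` pprim V q)) -> finite_set (range f).
Proof.
move=> per h0 hf; pose W := foldr (fun (q : primeT) X => sumset (f @` pprim V q) X) [set 0] s.
have sfq (q : primeT) : subgroup (f @` pprim V q) by apply: subg_image; exact: subg_pprim.
have sWr r : subgroup (foldr (fun (q : primeT) X => sumset (f @` pprim V q) X) [set 0] r).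
  by elim: r => [|q r IH] /=; [exact: subg_set0 | exact: subg_sumset].
have fW : finite_set W.
  rewrite /W; elim: s hf {h0 W} => [|q r IH] hf /=; first exact: finite_set1.
  apply: finite_image2; first by apply: hf; exact: mem_head.
  by apply: IH => q' q'r; apply: hf; rewrite in_cons q'r orbT.
have inW (q : primeT) : q \in s -> f @` pprim V q `<=` W.
  rewrite /W; elim: (s) => [|q' r IH] //=; rewrite in_cons => /orP[/eqP <- | qr].
    exact: (sumset_subl (subg0 (sWr r))).
  by move=> y /(IH qr); exact: (sumset_subr (subg0 (sfq q'))).
have sW : subgroup W by exact: sWr.
apply: sub_finite_set fW => _ [x _ <-]; have [n [n0 xn]] := ord_ex per x.
suff : (f @^-1` W) x by [].
apply: (primary_ind n0 xn); first by rewrite /preimage /mkset endo0; exact: subg0.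
  by move=> y z hy hz; rewrite /preimage /mkset endoD; exact: subgD.
move=> q0 k j pq e; pose q : primeT := Sub q0 pq.
have Sx : pprim V q (x *+ j) by apply/pprimP; exists k.
rewrite /preimage /mkset; have [qs|nq] := boolP (q \in s).
  by apply: (inW q qs); exists (x *+ j).
by rewrite (h0 q nq _ Sx); exact: subg0.
Qed.

Section HIdeal.
Variables (A : zmodType) (F : zmodClosed A).
Hypothesis perP : periodic [set: {quot F}].
Local Notation comp q := [set` pipart {quot F} (nat_of_primeT q)].

Let compP (q : primeT) x : comp q x <-> pprim {quot F} q x.
Proof. by rewrite pprimP; apply: pipartP; exact: prime_primeT. Qed.

Lemma e_expP (q : primeT) : if e_exp F q is Some e then is_bound (comp q) (q ^ e)%N
  else ~ bounded (comp q).
Proof.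
rewrite /e_exp; case: asboolP => // bd; have pp := prime_primeT q.
have [c hc] := bounded_pprim pp bd (fun x xA => (pipartP x pp).1 xA).
have [e he] := power_bound pp hc.
by apply: (@xgetPex _ 0%N [set e | is_bound (comp q) (q ^ e)%N]); exists e.
Qed.

Lemma eps_expP (q : primeT) : if eps_exp F q is Some d
  then is_least [set d | finite_set [set x *+ (q ^ d) | x in comp q]] d
  else ~ bounded (comp q).
Proof.
rewrite /eps_exp; case: asboolP => // bd; have pp := prime_primeT q.
have [c hc] := bounded_pprim pp bd (fun x xA => (pipartP x pp).1 xA).
apply: (@xgetPex _ 0%N [set e | is_least [set d | finite_set [set x *+ (q ^ d) | x in comp q]] e]).
have ex : exists n, `[< finite_set [set x *+ (q ^ n) | x in comp q] >].
  exists c; apply/asboolP; apply: sub_finite_set (finite_set1 0) => _ [x hx <-]; exact: hc.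
have [d /asboolP fd mind] := ex_minnP ex; exists d; split=> // m fm; apply: mind; exact/asboolP.
Qed.

(** An element of the second summand of the ideal kills the quotient by F, and one of the first
    summand has finite image on each of finitely many components. Conversely, if alpha has finite
    image, almost all components are killed by alpha, and an alpha of valuation v at q acts on
    the q-component as q^v, up to a unit; the definitions of e_q and epsilon_q bound v. *)
Lemma H_idealP alpha : H_ideal F alpha <-> finite_set (range (jact perP alpha)).
Proof.
split=> [[be [/finite_seqP[s sE] hbe] [ga hga <-]]|fin].
  have g0 x : jact perP ga x = 0.
    have [n [n0 xn]] := ord_ex perP x; suff : [set x | jact perP ga x = 0] x by [].
    apply: (primary_ind n0 xn); first by rewrite /mkset endo0.
      by move=> y z hy hz; rewrite /mkset endoD hy hz addr0.
    move=> q0 k j pq e; pose q : primeT := Sub q0 pq; rewrite /mkset.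
    have Sx : comp q (x *+ j) by apply/compP/pprimP; exists k.
    have := hga q; have := e_expP q; case: (e_exp F q) => [c [[_ hc] _] [b _ eb]|_ ga0].
      rewrite (@padic_ideal_act q _ perP ga b c (x *+ j) k) //; first by rewrite hc // mul0rn.
      by rewrite expnSr mulrnA [X in X *+ _ = _]e mul0rn.
    by rewrite (@jact_pprim_eq _ perP ga 0 q _ k) ?jact0.
  suff fb : finite_set (range (jact perP be)).
    by apply: sub_finite_set fb => _ [x _ <-]; exists x => //; rewrite jactD g0 addr0.
  have sP (q : primeT) : q \in s <-> be q != 0.
    by have : [set q | be q != 0] q <-> [set` s] q by [rewrite sE]; move=> /= ->.
  apply: (@finite_range_components _ _ s perP) => q.
    move=> nq x /pprimP[k xk]; rewrite (@jact_pprim_eq _ perP be 0 q x k) ?jact0 //.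
    by apply/eqP; apply: contraNT nq => /sP.
  move=> qs; have := hbe q; have := eps_expP q.
  case: (eps_exp F q) => [d [fd _] [b _ eb]|_ b0]; last first.
    apply: sub_finite_set (finite_set1 0) => _ [x /pprimP[k xk] <-].
    by rewrite (@jact_pprim_eq _ perP be 0 q x k) ?jact0.
  apply: sub_finite_set fd => _ [x Sx <-]; have /pprimP[k xk] := Sx.
  have xk1 : x *+ q ^ k.+1 = 0 by rewrite expnSr mulrnA xk mul0rn.
  rewrite (@padic_ideal_act q _ perP be b d x k) //.
  exists (x *+ (residue b k : nat)); last by rewrite mulrnAC.
  by apply/compP; apply: subgMn Sx; exact: subg_pprim.
have [N N0 hN] : exists2 n, (0 < n)%N & forall x, range (jact perP alpha) x -> x *+ n = 0.
  by apply: (fin_mod_exponent perP (@subg_set0 _)); exact/fin_mod0.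
have off (q : primeT) : ~~ (q %| N)%N -> forall x, pprim {quot F} q x -> jact perP alpha x = 0.
  move=> qN x /pprimP[k xk]; have h1 : jact perP alpha x *+ q ^ k = 0 by rewrite -endoMn xk endo0.
  have := subg_gcd (@subg_set0 _) h1 (hN _ (ex_intro2 _ _ x I erefl)).
  rewrite (eqP (_ : coprime _ _)) ?mulr1n //; apply: coprimeXl.
  by rewrite prime_coprime // prime_primeT.
have bd_of (q : primeT) v : finite_set (jact perP alpha @` pprim {quot F} q) ->
    (forall k, (v <= k)%N -> ~~ (q ^ v.+1 %| residue (alpha q) k)%N) -> bounded (comp q).
  move=> fj hv; have [n n0 hn] : exists2 n, (0 < n)%N &
      forall x, (jact perP alpha @` pprim {quot F} q) x -> x *+ n = 0.
    by apply: (fin_mod_exponent perP (@subg_set0 _)); exact/fin_mod0.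
  exists (q ^ v * n)%N; split; first by rewrite muln_gt0 n0 expn_gt0 prime_gt0 // prime_primeT.
  by move=> x /compP Sx; rewrite mulrnA; apply: hn; exact: valuation_act hv _ Sx.
have finq (q : primeT) : finite_set (jact perP alpha @` pprim {quot F} q).
  by apply: sub_finite_set fin => _ [x _ <-]; exists x.
pose be : padics := fun q => if (q %| N)%N then alpha q else 0.
pose ga : padics := fun q => if (q %| N)%N then 0 else alpha q.
exists be; last first.
  exists ga; last first.
    apply/functional_extensionality_dep => q; rewrite -[LHS]/(be q + ga q) /be /ga.
    by case: ifP; rewrite ?addr0 ?add0r.
  move=> q; rewrite /ga; case: ifPn => [_|qN]; first exact: padic_ideal0.
  have o := off q qN; have := e_expP q; case: (e_exp F q) => [e [_ he]|nbd].
    apply: contrapT => /not_padic_ideal[v ve hv].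
    have : (q ^ e <= q ^ v)%N.
      apply: he; split; first by rewrite expn_gt0 prime_gt0 // prime_primeT.
      move=> x /compP Sx; have [y Sy <-] := valuation_act perP hv Sx; exact: o.
    by rewrite leq_exp2l ?prime_gt1 ?prime_primeT // leqNgt ve.
  apply: contrapT => a0; have [v [_ hv]] := padic_valuation a0.
  by apply: nbd; exact: bd_of (finq q) hv.
split.
  apply: sub_finite_set (finite_seq (pmap insub (primes N) : seq primeT)) => q /=.
  rewrite /be mem_pmap_sub mem_primes N0; case: ifP => [qN _|_]; last by rewrite eqxx.
  by rewrite !andbT; exact: prime_primeT.
move=> q; rewrite /be; case: ifPn => [qN|_]; last exact: padic_ideal0.
have := eps_expP q; case: (eps_exp F q) => [d [_ hd]|nbd].
  apply: contrapT => /not_padic_ideal[v vd hv].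
  suff : (d <= v)%N by rewrite leqNgt vd.
  apply: hd; apply: sub_finite_set (finq q) => _ [x /compP Sx <-].
  exact: valuation_act hv _ Sx.
apply: contrapT => a0; have [v [_ hv]] := padic_valuation a0.
by apply: nbd; exact: bd_of (finq q) hv.
Qed.

End HIdeal.

(** * Uniform endomorphisms modulo the finitary ones *)

Lemma periodic_finite_rank (A : zmodType) : periodic [set: A] -> finite_tf_rank A.
Proof.
move=> per; exists 0%N => -[|z s] // h [n0 _]; move: n0.
have [x ex] := quot_surj z; have z0 : z = 0 by rewrite ex; apply/quot_eq0; exact: per.
by rewrite z0 mem_head.
Qed.

Section UniformQuotient.
Variables (A : zmodType) (F : set A).
Hypotheses (fr : finite_tf_rank A) (lF : full_lattice F).
Implicit Types (phi psi : endo A).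

Let sF : subgroup F. Proof. by case: lF. Qed.
Let perF x : exists2 n, (0 < n)%N & F (x *+ n). Proof. by case: lF. Qed.
Let FT x : F x -> tors A x -> x = 0. Proof. by case: lF => _ _ h _; exact: h. Qed.

Lemma FE_UI : FE A `<=` UI A.
Proof.
move=> phi fp; apply/(uniformP _ fr lF); split; first exact: inertial_fin.
  have /fin_mod0 f0 := fp; have sR : subgroup (range phi) by apply: subg_image; exact: subgT.
  move=> x Rx; have [n n0 e] := fin_mod_multiple (@subg_set0 A) sR f0 Rx.
  by apply/torsionP; exists n.
by exists 0; exact: unif_fin.
Qed.

Lemma FE_ideal : is_ideal (UI A) (FE A).
Proof.
split; first exact: FE_UI.
- by apply: sub_finite_set (finite_set1 (0 : A)) => _ [x _ <-]; rewrite endo0E.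
- move=> phi psi h1 h2; apply: sub_finite_set (finite_imageB h1 h2) => _ [x _ <-].
  by exists x; rewrite // endoBE.
- move=> psi phi _ h; split.
    apply: sub_finite_set (finite_image psi h) => _ [x _ <-].
    by exists (phi x); [exists x | rewrite endoME].
  by apply: sub_finite_set h => _ [x _ <-]; exists (psi x); rewrite // endoME.
Qed.

Lemma unif00 : unif F 0 0.
Proof. by apply: unif_fin => //; have [] := FE_ideal. Qed.

Definition unif_scalars : set padics := [set alpha | exists2 phi, UI A phi & unif F phi alpha].

Lemma unif_scalars_subring : is_subring unif_scalars.
Proof.
have [U0 UB UM] := UI_subring fr; split.
- by exists 0 => //; exact: unif00.
- move=> a b [phi h u] [psi h' u']; exists (phi - psi); [exact: UB | exact: unifB].
- move=> a b [phi h u] [psi h' u']; exists (phi * psi); [exact: UM | exact: unifM].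
Qed.

Lemma FE_unif phi alpha : UI A phi -> unif F phi alpha -> (FE A phi <-> unif F 0 alpha).
Proof.
move=> hU u; have [_ per _] := (uniformP phi fr lF).1 hU; split=> h.
  have u0 := unif_fin sF h.
  have := unifB sF perF unif00 (unifB sF perF u0 u).
  by rewrite subrr subr0 sub0r sub0r opprK.
apply: (fin_unif sF perF FT per); have := unifB sF perF u h.
by rewrite subr0 subrr.
Qed.

End UniformQuotient.

Section ScalarIso.
Variables (A : zmodType) (F : zmodClosed A).
Hypotheses (fr : finite_tf_rank A) (fpF : free_periodic_quot F).

Lemma free_periodic_lattice : full_lattice [set` F].
Proof.
have [freeF perP] := fpF; apply: free_full_lattice => //; first exact: subg_zmod.
exact/quot_periodic.
Qed.

Local Notation lF := free_periodic_lattice.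
Let sF : subgroup [set` F]. Proof. exact: subg_zmod. Qed.
Let perF x : exists2 n, (0 < n)%N & [set` F] (x *+ n). Proof. by case: lF. Qed.

Lemma H_ideal_unif alpha : H_ideal F alpha <-> unif [set` F] 0 alpha.
Proof.
have [_ perP] := fpF; rewrite (H_idealP perP) (unif_quotP perP); split=> h.
  apply: sub_finite_set (finite_image (fun x => - x) h) => _ [a _ <-].
  exists (jact perP alpha (\pi_({quot F})%qT a)); first by exists (\pi_({quot F})%qT a).
  by rewrite endo0E raddf0 sub0r.
apply: sub_finite_set (finite_image (fun x => - x) h) => _ [x _ <-].
have [a ->] := quot_surj x; eexists; first by exists a.
by rewrite endo0E raddf0 sub0r opprK.
Qed.

Local Notation T := (unif_scalars [set` F]).

Lemma H_ideal_ideal : is_ideal T (H_ideal F).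
Proof.
have [U0 _ _] := UI_subring fr; split.
- by move=> al /H_ideal_unif h; exists 0.
- by apply/H_ideal_unif; exact: (unif00 fr lF).
- by move=> a b /H_ideal_unif h /H_ideal_unif h'; apply/H_ideal_unif;
    have := unifB sF perF h h'; rewrite subr0.
- move=> a b [phi _ u] /H_ideal_unif h; split; apply/H_ideal_unif.
    by have := unifM sF perF u h; rewrite mulr0.
  by have := unifM sF perF h u; rewrite mul0r.
Qed.

(** If phi acts as alpha modulo F on a subgroup of finite index, then phi is finitary if and only
    if 0 also acts as alpha, that is, if alpha has finite image on the quotient by F. *)
Lemma UI_FE_iso : rng_iso (quot_rng (UI A) (FE A)) (quot_rng T (H_ideal F)).
Proof.
have hT := unif_scalars_subring fr lF; have hI := H_ideal_ideal.
apply: (@quot_rng_iso _ padics _ _ T (unif [set` F]) (quot_rng T (H_ideal F))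
  (fun a => sumset [set a] (H_ideal F))) => //.
- exact: UI_subring.
- exact: (FE_ideal fr lF).
- by move=> phi hU; have [_ _ [a u]] := (uniformP phi fr lF).1 hU; exists a => //; exists phi.
- by move=> phi psi a b _ _ u u'; split; [exact: unifB | exact: unifM].
- move=> phi psi a b hU hU' _ _ u u'; have [_ UB _] := UI_subring fr.
  rewrite (FE_unif fr lF (UB _ _ hU hU') (unifB sF perF u u')) -H_ideal_unif.
  by split=> [/(coset_eq hI)|/(coset_eq hI)].
- by move=> a b _ _; exact: (cosetD hI).
- by move=> a b Ta Tb; exact: (cosetM hT hI).
Qed.

End ScalarIso.

(** * Periodic groups *)

Section Periodic.
Variables (A : zmodType) (F : set A).
Hypotheses (per : periodic [set: A]) (lF : full_lattice F).

Let fr : finite_tf_rank A := periodic_finite_rank per.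
Let sF : subgroup F. Proof. by case: lF. Qed.
Let perF x : exists2 n, (0 < n)%N & F (x *+ n). Proof. by case: lF. Qed.
Let FT x : F x -> tors A x -> x = 0. Proof. by case: lF => _ _ h _; exact: h. Qed.

Lemma jact_unif alpha : unif F (jact per alpha) alpha.
Proof.
apply: fin_mod_self; first exact: subg_agree.
move=> a _ n n0 Fn; have an : a *+ n = 0 by apply: FT => //; exact: per.
by rewrite (jactE per alpha n0 an) subrr; exact: subg0.
Qed.

Lemma jact_UI alpha : UI A (jact per alpha).
Proof.
apply/(uniformP _ fr lF); split; first exact: inertial_jact.
  by move=> x _; exact: per.
by exists alpha; exact: jact_unif.
Qed.

Lemma padics_multsP phi : padics_mults A phi <-> exists alpha, phi = jact per alpha.
Proof.
split=> -[al h]; exists al.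
  by apply: endo_ext => x; exact: (padics_scaleP per idfun phi al (@subgT A)).1 h x I.
by apply/(padics_scaleP per idfun phi al (@subgT A)) => x _; rewrite h.
Qed.

Lemma UI_periodic : UI A = sumset (padics_mults A) (FE A).
Proof.
apply/seteqP; split=> phi.
  move=> hU; have [_ pr [al u]] := (uniformP phi fr lF).1 hU.
  exists (jact per al); first by apply/padics_multsP; exists al.
  exists (phi - jact per al); last by rewrite addrC subrK.
  apply: (fin_unif sF perF FT); first by move=> x _; exact: per.
  by have := unifB sF perF u (jact_unif al); rewrite subrr.
move=> [_ /padics_multsP[al ->] [f ff <-]]; apply: subringD; first exact: UI_subring.
  exact: jact_UI.
exact: (FE_UI fr lF).
Qed.

Lemma unif_scalars_periodic : unif_scalars F = [set: padics].
Proof.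
apply/seteqP; split=> // al _; exists (jact per al); [exact: jact_UI | exact: jact_unif].
Qed.

Lemma IE_periodic len p (B C : nat -> zmodClosed A) : critical_sequence len p B C ->
  IE A = sumset (sumset (padics_mults A) (FE A)) (Nring len B C).
Proof.
move=> cs; rewrite (IE_sum fr cs) (semi_mult_periodic per) UI_periodic.
apply/seteqP; split=> phi.
  move=> [_ [_ /padics_multsP[a ->] [_ [_ /padics_multsP[b ->] [f ff <-]] <-]] [v vN <-]].
  exists (jact per (a + b) + f); last first.
    exists v => //; congr (_ + _); rewrite addrA; congr (_ + _).
    by apply: endo_ext => x; rewrite jactD endoDE.
  by exists (jact per (a + b)); [apply/padics_multsP; exists (a + b) | exists f].
move=> [_ [m hm [f ff <-]] [v vN <-]]; exists (m + f); last by exists v.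
exists m => //; exists f => //; exists 0; last by exists f; rewrite // add0r.
by apply/padics_multsP; exists 0; apply: endo_ext => x; rewrite jact0 endo0E.
Qed.

End Periodic.

(** * Infinite torsion-free rank *)

Section InfiniteRank.
Variable A : zmodType.
Hypothesis infr : ~ finite_tf_rank A.
Implicit Types (phi : endo A).

Lemma infinite_independent_seq : exists x : nat -> A, forall N (d : nat -> int),
  tors A (\sum_(k < N) x k *~ d k) -> forall k, (k < N)%N -> d k = 0.
Proof.
have [x hx] := seq_choice (fun s => infinite_rank_isolator s infr); exists x.
have sT := @subg_tors A; elim=> // N IH d; rewrite big_ord_recr /= => h.
have dN : d N = 0.
  apply/eqP; apply: contrapT => /negP dN; apply: (hx N); apply: (isolator_divz dN).
  have sG := subg_gens (mkseq x N) sT.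
  set S := \sum_(k < N) _ in h; have GS : gens (tors A) (mkseq x N) S.
    apply: (big_ind (gens (tors A) (mkseq x N))); [exact: subg0 | move=> u v; exact: subgD|].
    move=> k _; apply: subgMz => //; apply: gens_mem => //; apply: map_f.
    by rewrite mem_iota /= ltn_ord.
  have -> : x N *~ d N = (S + x N *~ d N) - S by rewrite addrAC subrr add0r.
  by apply: subgB => //; exact: gens_sub.
move: h; rewrite dN mulr0z addr0 => /IH h k; rewrite ltnS leq_eqVlt => /predU1P[->//|].
exact: h.
Qed.

Lemma not_torsion : exists y, ~ tors A y.
Proof.
have [y hy] := infinite_rank_isolator [::] infr; exists y => ty; apply: hy.
by exists 1%N.
Qed.

Lemma mulz_eq (m n : int) : (forall x : A, x *~ m = x *~ n) -> m = n.
Proof.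
have [y ny] := not_torsion => h; apply/eqP; rewrite -subr_eq0; apply: contrapT => /negP nz.
by apply: ny; apply: (tors_divz nz); rewrite mulrzBr h subrr; exact: rpred0.
Qed.

(** Modulo torsion, phi is a rational number m/n; since phi maps two terms of an independent
    sequence to elements congruent modulo the subgroup generated by the sequence, n divides m. *)
Lemma inertial_integer phi : inertial phi ->
  exists c : int, forall y, tors A (phi y - y *~ c).
Proof.
move=> ip; have [n [m [n0 h]]] := inertial_proportional ip.
have [x indx] := infinite_independent_seq.
have s0 := @subg_set0 A; have [i [j [N [ij hN]]]] := inertial_seq x ip s0.
pose N' := maxn N j.+1.
have {}hN : gens [set 0] (mkseq x N') (phi (x j) - phi (x i)).
  apply: gens_subseq hN => // _ /mapP[k + ->]; rewrite mem_iota /= => kN.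
  by apply: map_f; rewrite mem_iota /= /N'; lia.
have [c /subr0_eq hc] := (gens_sumP _ _ s0).1 hN; rewrite size_mkseq in hc.
have {}hc : phi (x j) - phi (x i) = \sum_(k < N') x k *~ c k.
  by rewrite hc; apply: eq_bigr => k _; rewrite nth_mkseq.
have single l : (l < N')%N -> \sum_(k < N') x k *~ ((k : nat) == l)%:R = x l.
  move=> lN; rewrite (bigD1 (Ordinal lN)) //= eqxx big1 ?addr0 // => k.
  by rewrite -val_eqE /= => /negPf ->.
pose d (k : nat) : int := ((k == j)%:R - (k == i)%:R) * m - c k * n.
have jN : (j < N')%N by rewrite /N'; lia.
have iN : (i < N')%N by lia.
have /indx/(_ _ jN) : tors A (\sum_(k < N') x k *~ d k).
  have -> : \sum_(k < N') x k *~ d k = (phi (x i) *+ n - x i *~ m) - (phi (x j) *+ n - x j *~ m).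
    under eq_bigr => k _ do rewrite /d mulrzBr !mulrzA mulrzBr.
    rewrite sumrB -!mulrz_suml -hc sumrB !single // -pmulrn mulrnBl mulrzBl; abel.
  by apply: rpredB; exact: h.
rewrite /d eqxx (gtn_eqF ij) subr0 mul1r => /subr0_eq e.
exists (c j) => y; apply: (tors_div n0); have := h y.
by rewrite e mulrzA -pmulrn -mulrnBl.
Qed.

(** In infinite rank the kernel of phi contains elements independent of any given finite family;
    adding them makes any element independent of the family without changing its image. *)
Lemma periodic_image_finite phi : inertial phi -> periodic (range phi) -> finite_set (range phi).
Proof.
move=> ip per; apply: (inertial_disjoint_finite ip (@subg_tors A)) => //.
  by move=> x _; apply: per; exists x.
move=> s x _ _.
have indep z : ~ isolator s z ->
    forall g c, gens [set 0] s g -> tors A (g + z *~ c) -> z *~ c = 0.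
  move=> nz g c hg tc; have [->|c0] := eqVneq c 0; first by rewrite mulr0z.
  exfalso; apply: nz; apply: (isolator_divz c0).
  have sG := subg_gens s (@subg_tors A).
  have -> : z *~ c = (g + z *~ c) - g by rewrite addrAC subrr add0r.
  apply: subgB => //; first exact: gens_sub.
  by apply: (gens_subseq (@subg_tors A) _ _ hg) => // _ ->; exact: subg0 (@subg_tors A).
have [ix|nx] := pselect (isolator s x); last by exists x; split=> //; exact: indep.
have [y ny] := infinite_rank_isolator s infr.
have /torsP[n n0 yn] : tors A (phi y) by apply: per; exists y.
exists (x + y *+ n); split=> //; first by rewrite endoD endoMn yn addr0.
apply: indep => ixy; apply: ny; have sI := @subg_isolator A s.
have := subgB sI ixy ix; rewrite addrAC subrr add0r => -[k k0 hk].
exists (n * k)%N; first by rewrite muln_gt0 n0.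
by rewrite mulrnA.
Qed.

Lemma IE_infinite_rank : IE A = sumset (int_mults A) (FE A).
Proof.
have iz c : int_mults A (1 *~ c) by exists c => x _; rewrite endoMzE.
apply/seteqP; split=> phi.
  move=> ip; have [c hc] := inertial_integer ip.
  exists (1 *~ c) => //; exists (phi - 1 *~ c); last by rewrite addrC subrK.
  apply: periodic_image_finite; first by apply: inertialB => //; exact: inertial_int.
  by move=> _ [y _ <-]; rewrite endoBE endoMzE; exact: hc.
move=> [m [c hm] [f ff <-]]; apply: inertialD; last exact: inertial_fin.
have -> : m = 1 *~ c by apply: endo_ext => x; rewrite endoMzE hm.
exact: inertial_int.
Qed.

Lemma int_mults_FE : int_mults A `&` FE A = [set 0].
Proof.
apply/seteqP; split=> phi; last first.
  move=> ->; split; first by exists 0 => x _; rewrite endo0E mulr0z.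
  by apply: sub_finite_set (finite_set1 (0 : A)) => _ [x _ <-]; rewrite endo0E.
move=> [[c hc] ff]; suff c0 : c = 0.
  by apply: endo_ext => x; rewrite hc // c0 mulr0z endo0E.
have [y ny] := not_torsion; apply/eqP; apply: contrapT => /negP c0; apply: ny.
apply: (tors_divz c0); rewrite -hc //.
have sR : subgroup (range phi) by apply: subg_image; exact: subgT.
have /fin_mod0 f0 := ff.
have [n n0 e] := fin_mod_multiple (@subg_set0 A) sR f0 (ex_intro2 _ _ y I erefl).
by apply/torsP; exists n.
Qed.

Lemma int_mults_iso : rng_iso (sub_rng (int_mults A)) (sub_rng [set: int]).
Proof.
pose f phi := xget 0 [set n : int | int_scale n [set: A] phi].
have fE phi n : int_scale n [set: A] phi -> f phi = n.
  move=> h; apply: (@xget_unique _ 0 [set n | int_scale n [set: A] phi] n h) => m h'.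
  apply: mulz_eq => x.
  by rewrite -h // -h'.
exists f; split=> /=.
- split=> //.
  + move=> phi psi; rewrite !inE => -[n hn] [m hm]; rewrite (fE _ _ hn) (fE _ _ hm) => e.
    by apply: endo_ext => x; rewrite hn // hm // e.
  + move=> n _; have h : int_scale n [set: A] (1 *~ n) by move=> x _; rewrite endoMzE.
    by exists (1 *~ n); [exists n | exact: fE].
- move=> phi psi [n hn] [m hm]; rewrite (fE _ _ hn) (fE _ _ hm); apply: fE => x _.
  by rewrite endoDE hn // hm // mulrzDr.
- move=> phi psi [n hn] [m hm]; rewrite (fE _ _ hn) (fE _ _ hm); apply: fE => x _.
  by rewrite endoME hm // endoMz hn // -mulrzA.
Qed.

End InfiniteRank.

Theorem theorem2 (A : zmodType) :
  (* (a) *)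
  (~ finite_tf_rank A ->
    [/\ IE A = sumset (int_mults A) (FE A),
        int_mults A `&` FE A = [set 0]
      & rng_iso (sub_rng (int_mults A)) (sub_rng [set: int])]) /\
  (* (b) *)
  (finite_tf_rank A ->
    [/\ [/\ is_subring (SM A), SM A `<=` IE A
          & forall phi psi, SM A phi -> IE A psi -> phi * psi = psi * phi],
        is_subring (UI A),
        forall (len : option nat) (p : nat -> nat) (B C : nat -> zmodClosed A),
          critical_sequence len p B C ->
          let N := Nring len B C in
          [/\ IE A = sumset (sumset (SM A) (UI A)) N,
              [/\ is_subring N, N `<=` IE A,
                  forall phi, N phi -> mini_mult phi
                & rng_iso (sub_rng N) (sub_rng (sum_cyclic A))],
              is_ideal (IE A) (sumset (UI A) N),
              sumset (UI A) N = [set phi | IE A phi /\ periodic (range phi)]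
            & ~ periodic [set: A] ->
              rng_iso (quot_rng (IE A) (sumset (UI A) N))
                      (sub_rng (rat_pi (pi_star A)))]
      & forall F : zmodClosed A, free_periodic_quot F ->
          is_ideal (UI A) (FE A) /\
          exists T : set padics,
            [/\ is_subring T, H_ideal F `<=` T
              & rng_iso (quot_rng (UI A) (FE A)) (quot_rng T (H_ideal F))]]) /\
  (* (c) *)
  (periodic [set: A] ->
    [/\ forall (len : option nat) (p : nat -> nat) (B C : nat -> zmodClosed A),
          critical_sequence len p B C ->
          IE A = sumset (sumset (padics_mults A) (FE A)) (Nring len B C),
        SM A = padics_mults A,
        UI A = sumset (padics_mults A) (FE A)
      & forall F : zmodClosed A, free_periodic_quot F ->
          rng_iso (quot_rng (UI A) (FE A)) (quot_rng [set: padics] (H_ideal F))]).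
Proof.
split; first by move=> inf; split;
  [exact: IE_infinite_rank | exact: int_mults_FE | exact: int_mults_iso].
split=> [fr|per].
  split; [|exact: UI_subring|move=> len p B C cs N|move=> F fpF].
  - by split; [exact: SM_subring | exact: SM_inertial | move=> phi psi h _; exact: SM_central].
  - split.
    + exact: (IE_sum fr cs).
    + split; [exact: (Nring_subring cs) | by move=> phi; exact: (Nring_inertial fr cs) | | exact: (Nring_iso fr cs)].
      by move=> phi; exact: (Nring_mini cs).
    + exact: (periodic_image_ideal fr cs).
    + exact: (periodic_image_sum fr cs).
    + exact: (ratio_iso fr cs).
  - have lF := free_periodic_lattice fr fpF; split; first exact: (FE_ideal fr lF).
    exists (unif_scalars [set` F]); split; first exact: (unif_scalars_subring fr lF).
      by have [] := H_ideal_ideal fr fpF.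
    exact: (UI_FE_iso fr fpF).
have fr := periodic_finite_rank per; have [F lF] := full_lattice_exists fr.
split.
- by move=> len p B C cs; exact: (IE_periodic per lF cs).
- exact: semi_mult_periodic.
- exact: (UI_periodic per lF).
- move=> Z fpZ; rewrite -(unif_scalars_periodic per (free_periodic_lattice fr fpZ)).
  exact: (UI_FE_iso fr fpZ).
Qed.
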